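(* Let $d\ge 3$, $r>0$ and let $R\in SO(d)$ be a fixed rotation. There do not exist real constants $w_l$, $l=1,\dots,2^{2^d}-1$, such that the local estimator $$\hat V_{d-2}(X\cap a\mathbb{L})=a^{d-2}\sum_{l=1}^{2^{2^d}-1} w_l\,N_l(X\cap a\mathbb{L})$$ satisfies $$\lim_{a\to 0^+}E\,\hat V_{d-2}(X\cap a\mathbb{L})=V_{d-2}(X)$$ for every compact $r$-regular set $X\subseteq\mathbb{R}^d$, where $a\mathbb{L}=aR(\mathbb{Z}^d+c)$ with $c$ uniformly distributed in $[0,1]^d$ (stationary non-isotropic lattice).
   Context: A closed set $X\subseteq\mathbb{R}^d$ is $r$-regular ($r>0$) if for every $x\in\partial X$ there are two closed balls $B_i,B_o$ of radius $r$, both containing $x$, with $B_i\subseteq X$ and $\operatorname{int}(B_o)\subseteq\mathbb{R}^d\setminus X$. Then $\partial X$ is a $C^1$ hypersurface with unique outward unit normal $n(x)$; $n$ is differentiable $\mathcal{H}^{d-1}$-a.e. on $\partial X$, and the principal curvatures $k_1,\dots,k_{d-1}$ are, a.e., the eigenvalues of $d_xn$ on $T_x\partial X$. For compact $X$ put $V_{d-2}(X)=\frac1{2\pi}\int_{\partial X}(k_1+\dots+k_{d-1})\,d\mathcal{H}^{d-1}$. Configurations: let $C_0=\{0,1\}^d$. Enumerate $C_0=\{x_0,\dots,x_{2^d-1}\}$ by $x=x_i$ with $i=\sum_{k=1}^d2^{k-1}\mathbf 1_{\langle x,e_k\rangle=1}$, where $e_1,\dots,e_d$ is the standard basis. The configurations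 are the subsets $\xi_l\subseteq C_0$, $l=0,\dots,2^{2^d}-1$, with index $l=\sum_{i}2^i\mathbf 1_{x_i\in\xi_l}$ (so $\xi_0=\emptyset$). For the lattice $a\mathbb{L}=aR(\mathbb{Z}^d+c)$ ($a>0$), $$N_l(X\cap a\mathbb{L})=\#\{z\in aR\mathbb{Z}^d : X\cap(z+aR(C_0+c))=z+aR(\xi_l+c)\}.$$ $E$ denotes expectation with respect to $c$. *)

(* Defs.v *)
From HB Require Import structures.
From mathcomp Require Import all_boot all_order all_algebra.
From mathcomp Require Import finmap.
From mathcomp Require Import all_classical all_reals all_analysis.
From mathcomp Require Import zify.

Set Implicit Arguments.
Unset Strict Implicit.
Unset Printing Implicit Defensive.

Import Order.TTheory GRing.Theory Num.Theory.
Import numFieldNormedType.Exports.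

Local Open Scope classical_set_scope.
Local Open Scope ring_scope.

(* R^d is 'cV[R]_d. Its library topology comes from the sup norm and is the
   Euclidean one; the library norm itself is not Euclidean, so lengths are
   measured with [enorm]. *)
Section euclidean.
Context {R : realType} {d : nat}.
Implicit Types (x y c v n : 'cV[R]_d) (X A : set 'cV[R]_d).

Definition dot x y : R := \sum_i x i 0 * y i 0.
Definition enorm x : R := Num.sqrt (dot x x).
Definition ecball c (r : R) : set 'cV[R]_d := [set y | enorm (y - c) <= r].
Definition bd X : set 'cV[R]_d := closure X `\` X°.

Definition r_regular (r : R) X :=
  closed X /\ forall x, bd X x -> exists ci co,
    [/\ ecball ci r x, ecball co r x, ecball ci r `<=` X &
        (ecball co r)° `<=` ~` X].

(* The added 0 only matters for A = set0. *)
Definition ediam A : \bar R :=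
  ereal_sup ([set 0%E] `|` [set (enorm (p.1 - p.2))%:E | p in A `*` A]).

End euclidean.

Section cover_outer_measure.
Local Open Scope ereal_scope.
Context {R : realType} {T : Type}.
Variables (C : set (set T)) (g : set T -> \bar R).

Definition cover_outer (X : set T) : \bar R :=
  ereal_inf [set \sum_(k <oo) g (A k) | A in
    [set A : (set T)^nat | (forall k, C (A k)) /\ X `<=` \bigcup_k A k]].

Hypotheses (C0 : C set0) (g0 : g set0 = 0) (g_ge0 : forall A, 0 <= g A).

Lemma cover_outer_ge0 X : 0 <= cover_outer X.
Proof. by apply: le_ereal_inf_tmp => _ [A _ <-]; exact: nneseries_ge0. Qed.

Lemma cover_outer0 : cover_outer set0 = 0.
Proof.
apply/eqP; rewrite eq_le cover_outer_ge0 andbT.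
apply: ereal_inf_lbound; exists (fun=> set0); first by split.
by apply: eseries0 => k _ _.
Qed.

Lemma le_cover_outer : {homo cover_outer : A B / A `<=` B >-> A <= B}.
Proof.
move=> A B AB; apply/ereal_inf_le_tmp => _ [F [CF BF] <-].
by exists F => //; split => //; exact: subset_trans BF.
Qed.

Lemma cover_outer_sigma_subadditive : sigma_subadditive cover_outer.
Proof.
move=> A; have [[i ioo]|] := pselect (exists i, cover_outer (A i) = +oo).
  rewrite (eseries_pinfty _ _ ioo) ?leey// => n _.
  by rewrite -ltNye (lt_le_trans _ (cover_outer_ge0 _)).
rewrite -forallNE => Aoo.
suff add2e (e : {posnum R}) : cover_outer (\bigcup_n A n) <=
    \sum_(i <oo) cover_outer (A i) + e%:num%:E.
  by apply/lee_addgt0Pr => _/posnumP[].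
rewrite (le_trans _ (epsilon_trick _ _ _))//; last first.
  by move=> n; exact: cover_outer_ge0.
pose P n (B : (set T)^nat) :=
  ((forall k, C (B k)) /\ A n `<=` \bigcup_k B k) /\
  \sum_(k <oo) g (B k) <= cover_outer (A n) + (e%:num / (2 ^ n.+1)%:R)%:E.
have [G PG] : {G : ((set T)^nat)^nat & forall n, P n (G n)}.
  apply: (@choice _ _ P) => n; rewrite /P /cover_outer.
  set S := (X in ereal_inf X); move infS : (ereal_inf S) => iS.
  case: iS infS => [r Sr|Soo|Soo].
  - have en1 : (0 < e%:num / (2 ^ n.+1)%:R)%R by [].
    have /(lb_ereal_inf_adherent en1) : ereal_inf S \is a fin_num by rewrite Sr.
    move=> [x [B [mB AnB] muBx] xS].
    by exists B; split => //; rewrite muBx -Sr; exact/ltW.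
  - by have := Aoo n; rewrite /cover_outer Soo.
  - suff : lbound S 0 by move/le_ereal_inf_tmp; rewrite Soo.
    by move=> /= _ [B [mB AnB] <-]; exact: nneseries_ge0.
have gG_ge0 x : 0 <= (g \o uncurry G) x by exact: g_ge0.
apply: (@le_trans _ _ (\esum_(i in setT) (g \o uncurry G) i)).
  rewrite /cover_outer; apply: ereal_inf_lbound => /=.
  have /card_esym/ppcard_eqP[f] := card_nat2.
  exists (uncurry G \o f).
    split => [i|] /=; first by case: (f i) => a b; exact: (PG a).1.1.
    apply: (@subset_trans _  (\bigcup_n \bigcup_k G n k)) => [t [i _]|].
      by move=> /(PG i).1.2 -[j _ ?]; exists i => //; exists j.
    move=> t [i _ [j _ Bijt]]; exists (f^-1%FUN (i, j)) => //=.
    by rewrite invK ?inE.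
  rewrite -(esum_pred_image (g \o uncurry G) _ xpredT) ?[fun=> _]set_true//.
  by rewrite image_eq.
rewrite (_ : esum _ _ = \sum_(i <oo) \sum_(j <oo ) g (G i j)); last first.
  pose J : nat -> set (nat * nat) := fun i => [set (i, j) | j in setT].
  rewrite (_ : setT = \bigcup_k J k); last first.
    by rewrite predeqE => -[a b]; split => // _; exists a => //; exists b.
  rewrite esum_bigcupT /=; last 2 first.
    - apply/trivIsetP => i j _ _ ij.
      rewrite predeqE => -[n m] /=; split => //= -[] [_] _ [<-{n} _].
      by move=> [m' _] [] /esym/eqP; rewrite (negbTE ij).
    - by move=> /= [n m]; exact: g_ge0.
  rewrite -(image_id [set: nat]) -fun_true esum_pred_image//; last first.
    by move=> n _; exact: esum_ge0.
  apply: eq_eseriesr => /= j _.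
  rewrite -(esum_pred_image (g \o uncurry G) (pair j) predT)//=; last first.
    by move=> ? ? _ _; exact: (@can_inj _ _ _ snd).
  by congr esum; rewrite predeqE => -[a b]; split; move=> [i _ <-]; exists i.
apply: lee_lim.
- apply: is_cvg_nneseries => n *.
  by apply: nneseries_ge0 => m *; exact: (gG_ge0 (n, m)).
- apply: is_cvg_nneseries => n *; apply: adde_ge0 => //.
  exact: cover_outer_ge0.
- by near=> n; apply: lee_sum => i _; exact: (PG i).2.
Unshelve. all: by end_near. Qed.

End cover_outer_measure.

(* Volume of the n-dimensional Euclidean unit ball, pi^(n/2) / Gamma(n/2 + 1). *)
Fixpoint ball_vol (R : realType) (n : nat) : R :=
  match n with
  | 0 => 1
  | 1 => 2
  | m.+2 => 2 * pi / m.+2%:R * ball_vol R m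
  end.

Section hausdorff_measure.
Local Open Scope ereal_scope.
Context {R : realType} {d : nat}.
Variable n : nat.
Implicit Types A X : set 'cV[R]_d.

Definition hcost A : \bar R :=
  if A == set0 then 0 else (ball_vol R n / 2 ^+ n)%:E * ediam A ^+ n.

Definition hausdorff_delta (delta : R) X : \bar R :=
  cover_outer [set A | ediam A <= delta%:E] hcost X.

(* n-dimensional Hausdorff (outer) measure on R^d, normalised so as to agree
   with Lebesgue measure when n = d. *)
Definition hausdorff X : \bar R :=
  ereal_sup [set hausdorff_delta delta X | delta in [set e : R | (0 < e)%R]].

Lemma ball_vol_ge0 m : (0 <= ball_vol R m)%R.
Proof.
suff : (0 <= ball_vol R m)%R /\ (0 <= ball_vol R m.+1)%R by case.
elim: m => [//|m [h1 h2]]; split => //=.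
by rewrite mulr_ge0// divr_ge0// mulr_ge0// pi_ge0.
Qed.

Lemma ediam_ge0 A : 0 <= ediam A.
Proof. by apply: ereal_sup_ubound; left. Qed.

Lemma ediam0 : ediam (set0 : set 'cV[R]_d) = 0.
Proof. by rewrite /ediam set0X image_set0 setU0 ereal_sup1. Qed.

Lemma hcost0 : hcost set0 = 0.
Proof. by rewrite /hcost eqxx. Qed.

Lemma hcost_ge0 A : 0 <= hcost A.
Proof.
rewrite /hcost; case: ifP => // _; apply: mule_ge0.
  by rewrite lee_fin divr_ge0// ?ball_vol_ge0// exprn_ge0.
by rewrite expe_ge0// ediam_ge0.
Qed.

Lemma hausdorff_delta0 (delta : R) : (0 < delta)%R ->
  hausdorff_delta delta set0 = 0.
Proof.
move=> delta0; apply: cover_outer0; [|exact: hcost0|exact: hcost_ge0].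
by rewrite /= ediam0 lee_fin ltW.
Qed.

Lemma hausdorff_ge0 X : 0 <= hausdorff X.
Proof.
apply: (@le_trans _ _ (hausdorff_delta 1 X)).
  by apply: cover_outer_ge0; exact: hcost_ge0.
by apply: ereal_sup_ubound; exists 1%R => //=.
Qed.

Lemma hausdorff0 : hausdorff set0 = 0.
Proof.
apply/eqP; rewrite eq_le hausdorff_ge0 andbT.
by apply: ge_ereal_sup => _ [e /= e0 <-]; rewrite hausdorff_delta0.
Qed.

Lemma le_hausdorff : {homo hausdorff : A B / A `<=` B >-> A <= B}.
Proof.
move=> A B AB; apply: ge_ereal_sup => _ [e /= e0 <-].
apply: (le_trans (le_cover_outer _ _ AB)).
by apply: ereal_sup_ubound; exists e.
Qed.

Lemma hausdorff_sigma_subadditive : sigma_subadditive hausdorff.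
Proof.
move=> F; apply: ge_ereal_sup => _ [e /= e0 <-].
apply: (le_trans (cover_outer_sigma_subadditive _ hcost_ge0 F)).
apply: lee_nneseries => [k _ _|k _].
  by apply: cover_outer_ge0; exact: hcost_ge0.
by apply: ereal_sup_ubound; exists e.
Qed.

HB.instance Definition _ := isOuterMeasure.Build R 'cV[R]_d hausdorff
  hausdorff0 hausdorff_ge0 le_hausdorff hausdorff_sigma_subadditive.

Definition hausdorff_outer : {outer_measure set 'cV[R]_d -> \bar R} :=
  hausdorff.

Definition hausdorff_measure :
    {measure set (caratheodory_type hausdorff_outer) -> \bar R} :=
  (hausdorff_outer : set (caratheodory_type hausdorff_outer) -> \bar R).

End hausdorff_measure.

Arguments hausdorff {R d} n X.
Arguments hausdorff_measure {R d} n.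

Section curvature.
Context {R : realType} {d : nat}.
Implicit Types (x y v u : 'cV[R]_d) (X : set 'cV[R]_d).

(* Tangent space of the boundary: velocities at x of curves in bd X. *)
Definition tangent X x v := exists gamma : R -> 'cV[R]_d,
  [/\ gamma 0 = x, \forall t \near (0 : R), bd X (gamma t) &
      h^-1 *: (gamma h - x) @[h --> (0 : R)^'] --> v].

Definition is_outward_normal X x u :=
  [/\ enorm u = 1, forall v, tangent X x v -> dot u v = 0 &
      \forall t \near (0 : R)^'+, ~ X (x + t *: u)].

Definition normal X x : 'cV[R]_d := xget 0 [set u | is_outward_normal X x u].

(* The matrix A represents d_x n on the tangent space: only its action on
   tangent vectors is determined by this condition. *)
Definition normal_diff X x (A : 'M[R]_d) := forall e : R, 0 < e ->
  \forall y \near x, bd X y ->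
    enorm (normal X y - normal X x - A *m (y - x)) <= e * enorm (y - x).

(* k lists with multiplicity the eigenvalues of d_x n on the tangent space:
   the columns of B form a basis of it, M is the matrix of d_x n in B. *)
Definition is_principal_curvatures X x (k : 'rV[R]_d.-1) :=
  exists (A : 'M[R]_d) (B : 'M[R]_(d, d.-1)) (M : 'M[R]_d.-1),
    [/\ normal_diff X x A, \rank B = d.-1,
        forall v, tangent X x v <-> exists c : 'cV[R]_d.-1, v = B *m c,
        A *m B = B *m M &
        char_poly M = \prod_(i < d.-1) ('X - (k 0 i)%:P)].

(* Set to 0 at the (H^(d-1)-negligible) points where n is not differentiable. *)
Definition principal_curvatures X x : 'rV[R]_d.-1 :=
  xget 0 [set k | is_principal_curvatures X x k].

(* The intrinsic volume V_(d-2). *)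
Definition intrinsic_volume_dm2 X : \bar R :=
  ((2 * pi)^-1)%:E *
  \int[hausdorff_measure d.-1]_(x in bd X)
    (\sum_(i < d.-1) principal_curvatures X x 0 i)%:E.

End curvature.

Section uniform_cube.
Context {R : realType}.

Definition tcons n (p : measurableTypeR R * n.-tuple (measurableTypeR R)) :
  n.+1.-tuple (measurableTypeR R) := [tuple of p.1 :: p.2].

Lemma measurable_tcons n : measurable_fun setT (@tcons n).
Proof. exact: measurable_cons. Qed.

HB.instance Definition _ n := isMeasurableFun.Build _ _ _ _ (@tcons n)
  (@measurable_tcons n).

(* Law of n independent uniform variables on [0, 1], i.e. the uniform
   distribution on [0, 1]^n. *)
Fixpoint uniform_cube n : probability (n.-tuple (measurableTypeR R)) R :=
  match n with
  | 0 => \d_([tuple] : 0.-tuple (measurableTypeR R))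
  | m.+1 => distribution (uniform_prob (@ltr01 R) \x uniform_cube m)%E (@tcons m)
  end.

End uniform_cube.

Definition bit (l i : nat) : bool := odd (l %/ 2 ^ i).

Lemma bit_expansion n l : (l < 2 ^ n)%N -> (\sum_(i < n) 2 ^ i * bit l i)%N = l.
Proof.
elim: n l => [|n IH] l; first by rewrite expn0 big_ord0; lia.
move=> ln; rewrite big_ord_recl /bit expn0 divn1 mul1n.
rewrite (eq_bigr (fun i : 'I_n => 2 * (2 ^ i * bit l./2 i)))%N; last first.
  by move=> i _; rewrite /bit /= /bump /= add1n expnS -divn2 -divnMA mulnA.
by rewrite -big_distrr /= IH; [|move: ln; rewrite expnS]; lia.
Qed.

Section estimator.
Context {R : realType} {d : nat}.
Implicit Types (x z c : 'cV[R]_d) (X S : set 'cV[R]_d) (Q : 'M[R]_d).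

Definition is_rotation Q := Q *m Q^T = 1%:M /\ \det Q = 1.

Definition C0 : set 'cV[R]_d := [set x | forall k, x k 0 = 0 \/ x k 0 = 1].

Definition vertex_index x : nat := (\sum_(k < d) 2 ^ k * (x k 0%R == 1%R))%N.

(* [bit_expansion]: for l < 2^(2^d), l is the sum of the 2^i such that the
   vertex of index i belongs to [config l]. *)
Definition config (l : nat) : set 'cV[R]_d :=
  [set x | C0 x /\ bit l (vertex_index x)].

(* z + a R (S + c) *)
Definition placed (a : R) Q z c S : set 'cV[R]_d :=
  [set z + a *: (Q *m (x + c)) | x in S].

Definition hits (l : nat) X (a : R) Q c : set 'cV[R]_d :=
  [set z | (exists u : 'cV[int]_d, z = a *: (Q *m map_mx intr u)) /\
           X `&` placed a Q z c C0 = placed a Q z c (config l)].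

(* The cardinal of an infinite set is taken to be 0 here; [hits l X a Q c] is
   finite when 0 < l < 2^(2^d), Q is a rotation, a > 0 and X is bounded. *)
Definition Nconf (l : nat) X (a : R) Q c : nat :=
  #|` fset_set (hits l X a Q c)|.

Definition estimator (w : nat -> R) X (a : R) Q c : R :=
  a ^+ (d - 2) * \sum_(1 <= l < 2 ^ (2 ^ d)) w l * (Nconf l X a Q c)%:R.

Definition cube_point (t : d.-tuple (measurableTypeR R)) : 'cV[R]_d :=
  \col_i tnth t i.

Definition mean_estimator (w : nat -> R) X (a : R) Q : \bar R :=
  'E_(uniform_cube d) [fun t => estimator w X a Q (cube_point t)].

End estimator.

(* Main.v *)
(* Modify a set X locally into X', near a boundary point whose normal is close to
   a direction in which no two vertices of the rotated unit cell have the same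
   height.  There a cell meets X (or X') in an initial segment of the vertices
   ordered by height, so the number of cells showing a given nonempty segment is
   the difference of two numbers of lattice points of X in shifted cells; the
   lattice being invariant under these shifts, N_l(X') = N_l(X) for every shift c
   of the lattice and all small a, unless l is the full configuration, for which
   the difference is the difference of the numbers of lattice points in X' and X.
   Hence the limit is monotone under local growth (or under local shrinking,
   according to the sign of the weight W of the full configuration).  As the
   intrinsic volume is invariant under reflections, this holds at every boundary
   point with nearly spherical neighbourhood.  A ball can be enlarged to a
   concentric ball by finitely many such local modifications, whereas for d >= 3
   the intrinsic volume of a ball is a positive multiple of the (d-2)-nd power of
   its radius.  This excludes W <= 0.  If W > 0, all intermediate intrinsic
   volumes are finite by monotonicity, but already the first modification changes
   the mean of the estimator by a quantity of order a^-2. *)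
From HB Require Import structures.
Require Import Defs.
From mathcomp Require Import all_boot all_order all_algebra.
From mathcomp Require Import finmap.
From mathcomp Require Import all_classical all_reals all_analysis.
From mathcomp Require Import measurable_realfun.
From mathcomp Require Import ring lra zify.
Import Order.TTheory GRing.Theory Num.Theory.
Import numFieldNormedType.Exports.
Set Implicit Arguments.
Unset Strict Implicit.
Unset Printing Implicit Defensive.
Local Open Scope classical_set_scope.
Local Open Scope ring_scope.

(** * Euclidean geometry of column vectors *)

(** The order in which the constants are chosen shapes the proof. The radius [delta] of one
    modification depends only on [r] and the dimension; it fixes the finite family of bumps; this
    family fixes one bound [M] valid for all its tails; only then is the height [eps] chosen, so
    small that every intermediate set is still [r]-regular with normals turned only slightly.
    Starting from radius [2 * r] leaves room for this. The estimator is controlled only where the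
    normal is near the direction of the vector of powers of two, rotated by [Q]. Hence the set, not
    the lattice, is reflected: the assumed convergence is applied to the reflected sets, and the
    outcome is read back through the invariance of the intrinsic volume. Curvatures of intermediate
    sets are never computed and their volumes might be infinite, so all comparisons take place in
    the extended reals and use integrals of functions not known to be measurable. Monotonicity
    survives this; splitting off a constant does not, and measurability is established only for the
    estimator of a ball. The modification that yields the blow-up is therefore one of the exact
    ball. *)

Section euclidean_space.
Context {R : realType} {d : nat}.
Implicit Types (x y z u v w : 'cV[R]_d) (a b k : R) (Q : 'M[R]_d) (A X : set 'cV[R]_d).

Lemma dotC x y : dot x y = dot y x.
Proof. by apply: eq_bigr => i _; rewrite mulrC. Qed.

Lemma dotDl x y z : dot (x + y) z = dot x z + dot y z.
Proof. by rewrite -big_split; apply: eq_bigr => i _; rewrite mxE mulrDl. Qed.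

Lemma dotDr x y z : dot x (y + z) = dot x y + dot x z.
Proof. by rewrite dotC dotDl !(dotC x). Qed.

Lemma dotZl a x y : dot (a *: x) y = a * dot x y.
Proof. by rewrite mulr_sumr; apply: eq_bigr => i _; rewrite mxE mulrA. Qed.

Lemma dotZr a x y : dot x (a *: y) = a * dot x y.
Proof. by rewrite dotC dotZl dotC. Qed.

Lemma dotNl x y : dot (- x) y = - dot x y.
Proof. by rewrite -scaleN1r dotZl mulN1r. Qed.

Lemma dotNr x y : dot x (- y) = - dot x y.
Proof. by rewrite dotC dotNl dotC. Qed.

Definition dotE := (dotDl, dotDr, dotZl, dotZr, dotNl, dotNr).

Lemma dot0l x : dot 0 x = 0.
Proof. by rewrite -(scale0r (0 : 'cV[R]_d)) dotZl mul0r. Qed.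

Lemma dot0r x : dot x 0 = 0.
Proof. by rewrite dotC dot0l. Qed.

Lemma dot_ge0 x : 0 <= dot x x.
Proof. by apply: sumr_ge0 => i _; rewrite -expr2 sqr_ge0. Qed.

Lemma dot_eq0 x : (dot x x == 0) = (x == 0).
Proof.
apply/eqP/eqP => [/eqP|->]; last exact: dot0l.
rewrite psumr_eq0 => [/allP h|i _]; last by rewrite -expr2 sqr_ge0.
apply/matrixP => i j; rewrite ord1 mxE; apply/eqP.
by have := h i (mem_index_enum _); rewrite -expr2 sqrf_eq0.
Qed.

Lemma enorm_ge0 x : 0 <= enorm x.
Proof. exact: sqrtr_ge0. Qed.

Lemma sqr_enorm x : enorm x ^+ 2 = dot x x.
Proof. by rewrite sqr_sqrtr// dot_ge0. Qed.

Lemma enorm_eq0 x : (enorm x == 0) = (x == 0).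
Proof. by rewrite sqrtr_eq0 -dot_eq0 [RHS]eq_le dot_ge0 andbT. Qed.

Lemma enorm0 : enorm (0 : 'cV[R]_d) = 0.
Proof. by apply/eqP; rewrite enorm_eq0. Qed.

Lemma enormZ a x : enorm (a *: x) = `|a| * enorm x.
Proof. by rewrite /enorm dotZl dotZr mulrA -expr2 sqrtrM ?sqr_ge0// sqrtr_sqr. Qed.

Lemma enormN x : enorm (- x) = enorm x.
Proof. by rewrite /enorm dotNl dotNr opprK. Qed.

Lemma enormB x y : enorm (x - y) = enorm (y - x).
Proof. by rewrite -enormN opprB. Qed.

Lemma enorm_le x k : 0 <= k -> (enorm x <= k) = (dot x x <= k ^+ 2).
Proof. by move=> k0; rewrite -sqr_enorm ler_sqr// nnegrE// enorm_ge0. Qed.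

Lemma enorm_lt x k : 0 <= k -> (enorm x < k) = (dot x x < k ^+ 2).
Proof. by move=> k0; rewrite -sqr_enorm ltr_sqr// nnegrE// enorm_ge0. Qed.

Lemma enorm_eq x k : 0 <= k -> (enorm x == k) = (dot x x == k ^+ 2).
Proof. by move=> k0; rewrite -sqr_enorm eqrXn2// enorm_ge0. Qed.

Lemma cauchy_schwarz x y : `|dot x y| <= enorm x * enorm y.
Proof.
rewrite -ler_sqr ?nnegrE ?mulr_ge0 ?enorm_ge0// exprMn !sqr_enorm real_normK ?num_real//.
have [->|y0] := eqVneq y 0; first by rewrite !dot0r expr0n mulr0.
have yy : 0 < dot y y by rewrite lt_def dot_eq0 y0 dot_ge0.
have := dot_ge0 (dot y y *: x - dot x y *: y).
rewrite !dotE (dotC y x) => h.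
rewrite -subr_ge0 -(pmulr_rge0 _ yy); apply: le_trans h _.
by rewrite le_eqVlt; apply/orP; left; apply/eqP; ring.
Qed.

Lemma dot_le x y : dot x y <= enorm x * enorm y.
Proof. exact: le_trans (ler_norm _) (cauchy_schwarz x y). Qed.

Lemma enormD x y : enorm (x + y) <= enorm x + enorm y.
Proof.
rewrite enorm_le ?addr_ge0 ?enorm_ge0// !dotE (dotC y x) sqrrD !sqr_enorm.
have := dot_le x y; lra.
Qed.

Lemma enorm_distD z x y : enorm (x - y) <= enorm (x - z) + enorm (z - y).
Proof. by apply: le_trans (enormD _ _); rewrite addrA subrK. Qed.

Lemma coord_le_enorm x i : `|x i 0| <= enorm x.
Proof.
rewrite -ler_sqr ?nnegrE ?enorm_ge0// sqr_enorm real_normK ?num_real//.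
rewrite /dot (bigD1 i)//= -expr2 lerDl sumr_ge0// => j _.
by rewrite -expr2 sqr_ge0.
Qed.

Lemma enorm_le_coord x k : 0 <= k -> (forall i, `|x i 0| <= k) ->
  enorm x <= Num.sqrt d%:R * k.
Proof.
move=> k0 h; rewrite enorm_le ?mulr_ge0 ?sqrtr_ge0// exprMn sqr_sqrtr ?ler0n//.
apply: (@le_trans _ _ (\sum_(i < d) k ^+ 2)).
  by apply: ler_sum => i _; rewrite -expr2 -real_normK ?num_real// ler_sqr ?nnegrE.
by rewrite sumr_const card_ord mulr_natl.
Qed.

Lemma dotM Q x y : dot (Q *m x) y = dot x (Q^T *m y).
Proof.
have E u v : dot u v = (u^T *m v) 0 0.
  by rewrite mxE; apply: eq_bigr => i _; rewrite !mxE.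
by rewrite !E trmx_mul mulmxA.
Qed.

Lemma dot_orth Q x y : Q *m Q^T = 1%:M -> dot (Q *m x) (Q *m y) = dot x y.
Proof.
by move=> /mulmx1C QQ; rewrite dotM mulmxA QQ mul1mx.
Qed.

Lemma enorm_orth Q x : Q *m Q^T = 1%:M -> enorm (Q *m x) = enorm x.
Proof. by move=> QQ; rewrite /enorm dot_orth. Qed.

(** The sup norm and the Euclidean norm bound each other up to the factor sqrt d, so both define the
    same neighbourhoods. *)
Lemma nbhs_enormP x A :
  nbhs x A <-> exists2 e, 0 < e & forall y, enorm (y - x) < e -> A y.
Proof.
split.
  move=> /nbhs_ballP[e /= e0 xeA]; exists e => // y yx; apply: xeA.
  split => // i j; rewrite ord1 /ball /= distrC.
  by apply: le_lt_trans yx; have := coord_le_enorm (y - x) i; rewrite !mxE.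
move=> [e e0 xeA]; apply/nbhs_ballP.
have sd : 0 < Num.sqrt d%:R + 1 :> R by rewrite ltr_wpDl// sqrtr_ge0.
exists (e / (Num.sqrt d%:R + 1)) => /=; first by rewrite divr_gt0.
move=> y [_ yx]; apply: xeA.
have k0 : 0 < e / (Num.sqrt d%:R + 1) by rewrite divr_gt0.
apply: (@le_lt_trans _ _ (Num.sqrt d%:R * (e / (Num.sqrt d%:R + 1)))).
  apply: enorm_le_coord => [|i]; first exact: ltW.
  by have := yx i 0; rewrite /ball /= !mxE distrC => /ltW.
by rewrite mulrCA -[ltRHS]mulr1 ltr_pM2l// ltr_pdivrMr// mul1r ltrDl.
Qed.

Lemma interior_enormP x A :
  A° x <-> exists2 e, 0 < e & forall y, enorm (y - x) < e -> A y.
Proof. exact: nbhs_enormP. Qed.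

Lemma closure_enormP x A :
  closure A x <-> forall e, 0 < e -> exists2 y, A y & enorm (y - x) < e.
Proof.
split=> [cl e e0|h B].
  by have [|y []] := cl [set y | enorm (y - x) < e]; [apply/nbhs_enormP; exists e|exists y].
by move=> /nbhs_enormP[e e0 B_]; have [y Ay yx] := h _ e0; exists y; split => //; exact: B_.
Qed.

End euclidean_space.

(** * Lattice configurations under a local modification *)

Definition ncard (T : choiceType) (A : set T) : nat := #|` fset_set A|.

Section ncard.
Context {T : choiceType}.
Implicit Types A B : set T.

Lemma ncardID A B : finite_set A -> ncard A = (ncard (A `&` B) + ncard (A `\` B))%N.
Proof.
move=> finA; rewrite /ncard -(cardfsID (fset_set (A `&` B)) (fset_set A)); congr (_ + _)%N.
  rewrite -fset_setI//; first by rewrite setIA setIid.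
  exact: finite_setIl.
rewrite -fset_setD//; last exact: finite_setIl.
by rewrite setDIr setDv set0U.
Qed.

Lemma le_ncard A B : finite_set B -> A `<=` B -> (ncard A <= ncard B)%N.
Proof.
move=> finB AB; rewrite (ncardID A finB) (setIidr AB); exact: leq_addr.
Qed.

Lemma ncard_image (U : choiceType) (f : T -> U) A :
  injective f -> finite_set A -> ncard (f @` A) = ncard A.
Proof. by move=> fI finA; rewrite /ncard fset_set_image// card_imfset. Qed.

End ncard.

Section lattice_configurations.
Context {U : zmodType} {E : finType}.
Variables (v : E -> U) (h : E -> nat).
Hypothesis h_inj : injective h.
Implicit Types (O near : set U) (S : set E).

Definition cfg S O : set U := [set u | forall e, O (u + v e) <-> S e].

(** In a cell based in [near], the occupied vertices form an initial segment for the height [h]. *)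
Definition monotone_near near O := forall u e e', near u -> (h e < h e')%N ->
  O (u + v e') -> O (u + v e).

Lemma finite_shift O e : finite_set O -> finite_set [set u | O (u + v e)].
Proof.
move=> finO; apply: (@sub_finite_set _ _ ((fun u => u - v e) @` O)).
  by move=> u /= Ou; exists (u + v e) => //; rewrite addrK.
exact: finite_image.
Qed.

(** Translation invariance of the lattice: the number of cells occupied at vertex [e] does not
    depend on [e]. All cancellations below rest on this. *)
Lemma ncard_shift O e : finite_set O -> ncard [set u | O (u + v e)] = ncard O.
Proof.
move=> finO; rewrite -(@ncard_image _ _ (fun u => u - v e) O _ finO).
  congr ncard; apply/seteqP; split => u /=.
    by move=> Ou; exists (u + v e) => //; rewrite addrK.
  by move=> [w Ow <-]; rewrite subrK.
exact: addIr.
Qed.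

Lemma finite_cfg S O : S !=set0 -> finite_set O -> finite_set (cfg S O).
Proof.
move=> [e Se] finO; apply: sub_finite_set (finite_shift e finO).
by move=> u /(_ e) h1 /=; apply/h1.
Qed.

Section local_modification.
Variables (near O O' : set U).
Hypotheses (finO : finite_set O) (finO' : finite_set O').
Hypothesis far : forall u e, ~ near u -> O (u + v e) <-> O' (u + v e).
Hypotheses (mO : monotone_near near O) (mO' : monotone_near near O').

Let N e (P : set U) := [set u | P (u + v e)] `&` near.

Let finN e : finite_set (N e O).
Proof. exact/finite_setIl/finite_shift. Qed.

Let finN' e : finite_set (N e O').
Proof. exact/finite_setIl/finite_shift. Qed.

(** Away from [near] the two sets agree, so the whole difference of their cardinals is seen in the
    cells of [near], and it is the same for every vertex [e]. The additive form avoids truncated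
    subtraction. *)
Let ncardN e : (ncard (N e O) + ncard O' = ncard (N e O') + ncard O)%N.
Proof.
rewrite -(ncard_shift e finO) -(ncard_shift e finO').
rewrite (ncardID near (finite_shift e finO)) (ncardID near (finite_shift e finO')).
rewrite (_ : [set u | O' (u + v e)] `\` near = [set u | O (u + v e)] `\` near).
  rewrite -/(N e O) -/(N e O'); move: (ncard _) (ncard _) (ncard _) => x y z; lia.
by apply/seteqP; split => u /= [Ou nu]; split => //; apply/far.
Qed.

Let cfg_far S : cfg S O `\` near = cfg S O' `\` near.
Proof.
apply/seteqP; split => u /= [Ou nu]; split => // e; split.
- by move=> /(far e nu) /(Ou e).
- by move=> /(Ou e) /(far e nu).
- by move=> /(far e nu) /(Ou e).
- by move=> /(Ou e) /(far e nu).
Qed.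

(** By monotonicity a cell of [near] is full exactly when its highest vertex is occupied; [ncardN]
    at this vertex gives the count. *)
Lemma ncard_cfg_full (e0 : E) :
  (ncard (cfg setT O) + ncard O' = ncard (cfg setT O') + ncard O)%N.
Proof.
have T0 : [set: E] !=set0 by exists e0.
rewrite (ncardID near (finite_cfg T0 finO)) (ncardID near (finite_cfg T0 finO')).
rewrite cfg_far.
have [e1 _ e1max] := @arg_maxnP _ e0 xpredT h isT.
have {}e1max e : (h e <= h e1)%N by exact: e1max.
have cfgN P : monotone_near near P -> cfg setT P `&` near = N e1 P.
  move=> mP; apply/seteqP; split => u /=.
    by move=> [/(_ e1) h1 nu]; split => //; apply/h1.
  move=> [Pu nu]; split => // e; split => // _.
  have [->//|ee1] := eqVneq e e1.
  apply: mP Pu => //; rewrite ltn_neqAle e1max// andbT.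
  by apply: contra ee1 => /eqP /h_inj ->.
rewrite (cfgN _ mO) (cfgN _ mO'); move: (ncardN e1).
by move: (ncard _) (ncard _) (ncard _) (ncard _) (ncard _) => x y z t w; lia.
Qed.

(* A cell of [near] shows S exactly when it is hit at the last vertex of S and
   missed at the first vertex outside S. *)
Lemma ncard_cfg S : S !=set0 -> S != setT -> ncard (cfg S O) = ncard (cfg S O').
Proof.
move=> S0 ST.
rewrite (ncardID near (finite_cfg S0 finO)) (ncardID near (finite_cfg S0 finO')).
rewrite cfg_far; congr (_ + _)%N.
(* If [S] is not an initial segment for [h], no cell of [near] can show it, before or after the
   modification. *)
have [dS|] := pselect (forall e e', (h e < h e')%N -> S e' -> S e); last first.
  move=> ndS.
  have cfg0 P : monotone_near near P -> cfg S P `&` near = set0.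
    move=> mP; apply/seteqP; split => // u [Pu nu]; apply: ndS => e e' ee' Se'.
    by apply/Pu; apply: mP nu ee' _; apply/Pu.
  by rewrite (cfg0 _ mO) (cfg0 _ mO').
have [s Ss] := S0.
have [t St] : exists t, ~ S t.
  apply: contrapT => /forallNP nS; move/eqP : ST; apply.
  by apply/seteqP; split => // e _; apply: contrapT; exact: nS.
have [e1 Se1 e1max] : exists2 e1, S e1 & forall e, S e -> (h e <= h e1)%N.
  have sS : `[< S s >] by exact/asboolP.
  by case: (@arg_maxnP _ s (fun e => `[< S e >]) h sS) => e1 /asboolP ? e1max; exists e1 => // e /asboolP; exact: e1max.
have [e2 Se2 e2min] : exists2 e2, ~ S e2 & forall e, ~ S e -> (h e2 <= h e)%N.
  have tS : `[< ~ S t >] by exact/asboolP.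
  by case: (@arg_minnP _ t (fun e => `[< ~ S e >]) h tS) => e2 /asboolP ? e2min; exists e2 => // e /asboolP; exact: e2min.
have e12 : (h e1 < h e2)%N.
  rewrite ltnNge; apply/negP; rewrite leq_eqVlt => /orP[/eqP /h_inj e21|].
    by apply: Se2; rewrite e21.
  by move=> /dS /(_ Se1).
have cfgN P : monotone_near near P -> cfg S P `&` near = N e1 P `\` N e2 P.
  move=> mP; apply/seteqP; split => u /=.
    move=> [Pu nu]; split; first by split => //; apply/Pu.
    by move=> [/Pu].
  move=> [[P1 nu] P2]; split => // e; split.
    move=> Pe; apply: contrapT => Se; apply: P2; split => //.
    have [<-//|e2e] := eqVneq e e2.
    apply: mP Pe => //; rewrite ltn_neqAle e2min// andbT.
    by apply: contra e2e => /eqP /h_inj ->.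
  move=> Se; have [->//|ee1] := eqVneq e e1.
  apply: mP P1 => //; rewrite ltn_neqAle e1max// andbT.
  by apply: contra ee1 => /eqP /h_inj ->.
(* The two sets are nested, so the count is a difference of cardinals, and by [ncardN] both terms
   change by the same amount. *)
have N12 P : monotone_near near P -> N e1 P `&` N e2 P = N e2 P.
  move=> mP; apply/setIidr => u [Pu nu]; split => //; exact: mP Pu.
rewrite (cfgN _ mO) (cfgN _ mO').
have := ncardID (N e2 O) (finN e1); have := ncardID (N e2 O') (finN' e1).
rewrite (N12 _ mO) (N12 _ mO') => h1 h2.
move: (ncardN e1) (ncardN e2) h1 h2.
by do 8 move: (ncard _) => ?; lia.
Qed.

End local_modification.
End lattice_configurations.

(** * Binary indices of the vertices of the unit cell *)

Section cube_vertices.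
Context {d : nat}.
Implicit Types (e : 'cV[bool]_d) (u : 'cV[int]_d).

Definition vert e : 'cV[int]_d := map_mx (fun b : bool => (b : nat)%:Z) e.

(** Besides being the index of the vertex in the enumeration, this number serves as its height, by
    [dot_binary_vector]. *)
Definition vidx e : nat := (\sum_(k < d) 2 ^ k * e k 0%R)%N.

End cube_vertices.

Lemma bit_sum n (f : nat -> bool) j : (j < n)%N ->
  bit (\sum_(i < n) 2 ^ i * f i)%N j = f j.
Proof.
elim: n f j => // n IH f j jn.
rewrite big_ord_recl expn0 mul1n.
rewrite (eq_bigr (fun i : 'I_n => 2 * (2 ^ i * f i.+1)))%N; last first.
  by move=> i _; rewrite lift0 expnS mulnA.
rewrite -big_distrr /=; case: j jn => [_|j jn].
  by rewrite /bit expn0 divn1 oddD oddM /= addbF; case: (f 0%N).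
rewrite /bit expnS divnMA divnDr ?dvdn_mulr// mulKn//.
rewrite (_ : (f 0 %/ 2)%N = 0%N) ?add0n; last by case: (f 0%N).
exact: (IH (fun i => f i.+1)).
Qed.

Section vertex_index.
Context {d : nat}.
Implicit Types (e : 'cV[bool]_d).

Lemma bit_vidx e (i : 'I_d) : bit (vidx e) i = e i 0.
Proof.
pose f k := if insub k is Some k' then e k' 0%R else false.
have -> : vidx e = (\sum_(k < d) 2 ^ k * f k)%N.
  by apply: eq_bigr => k _; rewrite /f valK.
by rewrite bit_sum// /f valK.
Qed.

Lemma vidx_inj : injective (@vidx d).
Proof. by move=> e e' ee'; apply/matrixP => i j; rewrite ord1 -!bit_vidx ee'. Qed.

Lemma vidx_surj i : (i < 2 ^ d)%N -> exists e, vidx e = i.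
Proof.
move=> id; exists (\col_k bit i k); rewrite -[RHS](bit_expansion id).
by apply: eq_bigr => k _; rewrite mxE.
Qed.

Lemma config_neq0 l : (0 < l < 2 ^ (2 ^ d))%N -> exists e, bit l (@vidx d e).
Proof.
move=> /andP[l0 ld]; apply: contrapT => /forallNP nb.
move: l0; rewrite -(bit_expansion ld) big1// => i _.
have [e <-] := vidx_surj (ltn_ord i).
by have /negP/negPf -> := nb e; rewrite muln0.
Qed.

End vertex_index.

(** * Reduction of the estimator to counts of integer cells *)

Section lattice_points.
Context {R : realType} {d : nat}.
Implicit Types (x y c : 'cV[R]_d) (u : 'cV[int]_d) (e : 'cV[bool]_d).
Implicit Types (Q : 'M[R]_d) (a : R) (Y : set 'cV[R]_d).

Definition toR u : 'cV[R]_d := map_mx intr u.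

Lemma toRD u w : toR (u + w) = toR u + toR w.
Proof. by apply/matrixP => i j; rewrite !mxE intrD. Qed.

Lemma toR_inj : injective toR.
Proof.
move=> u w uw; apply/matrixP => i j; have /matrixP/(_ i j) := uw.
by rewrite !mxE => /eqP; rewrite eqr_int => /eqP.
Qed.

Lemma C0P x : C0 x <-> exists e, x = toR (vert e).
Proof.
split=> [C0x|[e ->] k]; last by rewrite !mxE; case: (e k 0); [right|left].
exists (\col_k (x k 0 == 1)); apply/matrixP => i j; rewrite ord1 !mxE.
by have [->|->] := C0x i; rewrite ?eqxx// eq_sym oner_eq0.
Qed.

Lemma vertex_index_vert e : vertex_index (toR (vert e)) = vidx e.
Proof.
apply: eq_bigr => k _; rewrite !mxE; congr (_ * _)%N.
by case: (e k 0); rewrite ?eqxx// eq_sym oner_eq0.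
Qed.

Definition lattice_point a Q c u : 'cV[R]_d := a *: (Q *m (toR u + c)).

Definition occupied Y a Q c : set 'cV[int]_d := [set u | Y (lattice_point a Q c u)].

Definition vconf l : set 'cV[bool]_d := [set e | bit l (vidx e)].

Lemma lattice_point_inj a Q c : a != 0 -> Q *m Q^T = 1%:M -> injective (lattice_point a Q c).
Proof.
move=> a0 /mulmx1C QQ u w /(scalerI a0) /(congr1 (mulmx Q^T)).
by rewrite !mulmxA QQ !mul1mx => /addIr /toR_inj.
Qed.

Lemma lattice_pointDvert a Q c u e : lattice_point a Q c (u + vert e) =
  a *: (Q *m toR u) + a *: (Q *m (toR (vert e) + c)).
Proof. by rewrite /lattice_point toRD -addrA mulmxDr scalerDr. Qed.

(** Injectivity of [lattice_point] turns the equality of point sets in [hits] into a vertexwise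
    equivalence, so cells can be counted through their integer base points. *)
Lemma hitsE l Y a Q c : a != 0 -> Q *m Q^T = 1%:M ->
  hits l Y a Q c = (fun u => a *: (Q *m toR u)) @` cfg vert (vconf l) (occupied Y a Q c).
Proof.
move=> a0 QQ; apply/seteqP; split => z /=.
  move=> [[u ->] h]; exists u => // e; rewrite /occupied /= lattice_pointDvert; split.
    move=> Ye.
    have [] : (Y `&` placed a Q (a *: (Q *m toR u)) c C0) (lattice_point a Q c (u + vert e)).
      rewrite lattice_pointDvert; split => //; exists (toR (vert e)) => //; by apply/C0P; exists e.
    move=> Yp Cp; have : (Y `&` placed a Q (a *: (Q *m toR u)) c C0) (lattice_point a Q c (u + vert e)).
      by split.
    rewrite h => -[x [/C0P[e' ->{x}]]]; rewrite vertex_index_vert -lattice_pointDvert => be'.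
    by move=> /(lattice_point_inj a0 QQ) /addrI /(congr1 toR) /(congr1 vertex_index); rewrite !vertex_index_vert /vconf /= => <-.
  move=> be.
  have : placed a Q (a *: (Q *m toR u)) c (config l) (lattice_point a Q c (u + vert e)).
    exists (toR (vert e)); last by rewrite lattice_pointDvert.
    by split; [apply/C0P; exists e|rewrite vertex_index_vert].
  by rewrite -h lattice_pointDvert => -[].
move=> [u hu <-]; split; first by exists u.
apply/seteqP; split => y /=.
  move=> [Yy [x /C0P[e ->{x}]] ye]; exists (toR (vert e)) => //.
  split; first by apply/C0P; exists e.
  by rewrite vertex_index_vert; apply/(hu e); rewrite /occupied /= lattice_pointDvert ye.
move=> [x [/C0P[e ->{x}]]]; rewrite vertex_index_vert => /(hu e).
rewrite /occupied /= lattice_pointDvert => Ye <-; split => //.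
by exists (toR (vert e)) => //; apply/C0P; exists e.
Qed.

Lemma finite_int_box n : finite_set [set u : 'cV[int]_d | forall i, (absz (u i ord0) <= n)%N].
Proof.
apply: (@sub_finite_set _ _ ((fun f : {ffun 'I_d -> 'I_(n + n).+1} =>
   \col_i ((f i)%:Z - n%:Z) : 'cV[int]_d) @` setT)); last first.
  exact/finite_image/finite_finset.
move=> u /= un; exists [ffun i => inord (absz (u i ord0 + n%:Z)%R)] => //.
apply/matrixP => i j; rewrite [j]ord1 mxE ffunE.
by have := un i; move: (u i ord0) => k kn; rewrite inordK; lia.
Qed.

Definition ebounded (Y : set 'cV[R]_d) := exists K, forall y, Y y -> enorm y <= K.

Lemma finite_occupied Y a Q c : a != 0 -> Q *m Q^T = 1%:M -> ebounded Y ->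
  finite_set (occupied Y a Q c).
Proof.
move=> a0 QQ [K YK].
pose n := (`|Num.ceil (K / `|a| + enorm c)|)%N.
apply: sub_finite_set (finite_int_box n) => u /YK; rewrite enormZ enorm_orth// => uK i.
have ap : 0 < `|a| by rewrite normr_gt0.
have {}uK : enorm (toR u) <= K / `|a| + enorm c.
  apply: (@le_trans _ _ (enorm (toR u + c) + enorm c)).
    by rewrite -{1}(addrK c (toR u)); apply: le_trans (enormD _ _) _; rewrite enormN.
  by rewrite lerD2r ler_pdivlMr// mulrC.
have := le_trans (coord_le_enorm (toR u) i) uK; rewrite mxE => uiK.
have := le_trans uiK (Num.Theory.ceil_ge _).
rewrite -intr_norm ler_int => h; rewrite /n -lez_nat.
rewrite abszE; apply: le_trans h _.
by rewrite abszE ler_norm.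
Qed.

Lemma Nconf_cfg l Y a Q c : (0 < l < 2 ^ (2 ^ d))%N ->
  a != 0 -> Q *m Q^T = 1%:M -> ebounded Y ->
  Nconf l Y a Q c = ncard (cfg vert (vconf l) (occupied Y a Q c)).
Proof.
move=> ld a0 QQ bY; rewrite /Nconf hitsE// -/(ncard _) ncard_image//.
  move=> u w /(scalerI a0) /(congr1 (mulmx Q^T)).
  by rewrite !mulmxA (mulmx1C QQ) !mul1mx => /toR_inj.
apply: finite_cfg; last exact: finite_occupied.
by have [e] := config_neq0 ld; exists e.
Qed.

(** Only the last index, all of whose bits are set, passes the filter; the filtered sum spares the
    computation of that index. *)
Definition full_weight (w : nat -> R) : R :=
  \sum_(1 <= l < 2 ^ (2 ^ d) | [forall e : 'cV[bool]_d, bit l (vidx e)]) w l.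

Lemma estimator_local_modification (near : set 'cV[int]_d) w Y Y' a Q c :
  a != 0 -> Q *m Q^T = 1%:M -> ebounded Y -> ebounded Y' ->
  (forall u e, ~ near u -> Y (lattice_point a Q c (u + vert e)) <-> Y' (lattice_point a Q c (u + vert e))) ->
  monotone_near vert vidx near (occupied Y a Q c) ->
  monotone_near vert vidx near (occupied Y' a Q c) ->
  estimator w Y' a Q c = estimator w Y a Q c + a ^+ (d - 2) * full_weight w *
    ((ncard (occupied Y' a Q c))%:R - (ncard (occupied Y a Q c))%:R).
Proof.
move=> a0 QQ bY bY' far mY mY'; rewrite /estimator -mulrA -mulrDr; congr (_ * _).
rewrite /full_weight [X in _ + X * _]big_mkcond mulr_suml -big_split /=.
apply: eq_big_nat => l ld.
rewrite !Nconf_cfg//.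
have finY := finite_occupied c a0 QQ bY.
have finY' := finite_occupied c a0 QQ bY'.
case: ifPn => [/forallP full|nfull].
  have -> : vconf l = setT by apply/seteqP; split => // e _; exact: full.
  have := ncard_cfg_full vidx_inj finY finY' far mY mY' 0.
  move: (ncard _) (ncard _) (ncard _) (ncard _) => n1 n2 n3 n4 /(congr1 (GRing.natmul (1 : R))).
  by rewrite !natrD => ?; rewrite -mulrDr; congr (_ * _); lra.
rewrite mul0r addr0; congr (_ * _%:R); apply/esym.
apply: (ncard_cfg vidx_inj finY finY' far mY mY').
  by have [e] := config_neq0 ld; exists e.
apply: contra nfull => /eqP full; apply/forallP => e.
by have : vconf l e by rewrite full.
Qed.

End lattice_points.

(** * Tangent spaces and normals of r-regular sets *)

Lemma dnbhs0P (R : realType) (P : set R) : (\forall h \near (0 : R)^', P h) <->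
  exists2 e, 0 < e & forall h, h != 0 -> `|h| < e -> P h.
Proof.
split=> [/nbhs_ballP[e /= e0 eP]|[e e0 eP]].
  by exists e => // h h0 he; apply: eP => //; rewrite /ball /= sub0r normrN.
apply/nbhs_ballP; exists e => //= h; rewrite /ball /= sub0r normrN => he h0.
exact: eP.
Qed.

Section regular_boundary.
Context {R : realType} {d : nat}.
Implicit Types (x y z n v : 'cV[R]_d) (X : set 'cV[R]_d) (r : R).

Lemma interior_ecball c r y : enorm (y - c) < r -> (ecball c r)° y.
Proof.
move=> yc; apply/interior_enormP; exists (r - enorm (y - c)); first by rewrite subr_gt0.
move=> z zy; rewrite /ecball /=; apply: le_trans (enorm_distD y _ _) _; lra.
Qed.

(** The supremum of the parameters with value in [X] is attained because [X] is closed, and its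
    point is not interior because later parameters leave [X]. *)
Lemma bd_segment X p q : closed X -> X p -> ~ X q ->
  exists2 t, 0 <= t <= 1 & bd X (p + t *: (q - p)).
Proof.
move=> cX Xp Xq; pose T := [set t | 0 <= t <= 1 /\ X (p + t *: (q - p))].
have T0 : T 0 by rewrite /T /= scale0r addr0 lexx ler01.
have T1 : ubound T 1 by move=> t [/andP[]].
have hT : has_sup T by split; [exists 0|exists 1].
pose s := sup T.
have s0 : 0 <= s by apply: ub_le_sup => //; exists 1.
have s1 : s <= 1 by apply: ge_sup => //; exists 0.
have K0 : 0 < enorm (q - p) + 1 by rewrite ltr_wpDl// enorm_ge0.
have dist t t' : enorm (p + t *: (q - p) - (p + t' *: (q - p))) = `|t - t'| * enorm (q - p).
  by rewrite opprD addrACA subrr add0r -scalerBl enormZ.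
have Xs : X (p + s *: (q - p)).
  apply: cX; apply/closure_enormP => e e0.
  have [t Tt st] := sup_adherent (divr_gt0 e0 K0) hT.
  exists (p + t *: (q - p)); first exact: Tt.2.
  have ts : t <= s by apply: ub_le_sup => //; exists 1.
  rewrite dist ler0_norm ?subr_le0// opprB.
  apply: (@le_lt_trans _ _ ((s - t) * (enorm (q - p) + 1))).
    by rewrite ler_wpM2l ?subr_ge0// lerDl.
  by rewrite -ltr_pdivlMr// ltrBlDl -ltrBlDr.
exists s; first by rewrite s0 s1.
split; first exact: subset_closure.
move=> /interior_enormP[e e0 eX].
have s_lt1 : s < 1.
  rewrite lt_neqAle s1 andbT; apply/eqP => se.
  by apply: Xq; move: Xs; rewrite se scale1r addrC subrK.
pose k := Num.min (1 - s) (e / 2 / (enorm (q - p) + 1)).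
have k0 : 0 < k by rewrite lt_min subr_gt0 s_lt1/= !divr_gt0.
have : T (s + k).
  split; last first.
    apply: eX; rewrite dist addrC addKr ger0_norm ?(ltW k0)//.
    apply: (@le_lt_trans _ _ (e / 2)); last by rewrite ltr_pdivrMr// mulr_natr mulr2n ltrDl.
    apply: (@le_trans _ _ (k * (enorm (q - p) + 1))).
      by rewrite ler_wpM2l ?ltW// ltrDl.
    by rewrite -ler_pdivlMr// ge_min lexx orbT.
  rewrite addr_ge0 ?(ltW k0)//= addrC -lerBrDr ge_min lexx//.
by move=> /(ub_le_sup (ex_intro _ 1 T1)); rewrite -/s gerDl leNgt k0.
Qed.

(** The normal described by its two touching balls. Unlike [normal], it can be checked on a concrete
    set without knowing the tangent space; [normal_eq] links the two. *)
Definition ball_normal r X x n :=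
  [/\ enorm n = 1, ecball (x - r *: n) r `<=` X &
      forall y, enorm (y - (x + r *: n)) < r -> ~ X y].

Lemma r_regular_ball_normal r X x : 0 < r -> r_regular r X -> bd X x ->
  exists n, ball_normal r X x n.
Proof.
move=> r0 [cX rX] bx; have [ci [co [xi xo iX oX]]] := rX x bx.
have ei : enorm (ci - x) = r.
  apply/eqP; rewrite eq_le enormB xi/= leNgt; apply/negP => h.
  by case: bx => _; apply; move/interior_ecball: h; exact: interiorS.
have eo : enorm (co - x) = r.
  apply/eqP; rewrite eq_le enormB xo/= leNgt; apply/negP => h.
  rewrite -subr_gt0 in h; have [y Xy yx] := (@closure_enormP _ _ x X).1 bx.1 _ h.
  apply: (oX y) => //; apply: interior_ecball.
  by apply: le_lt_trans (enorm_distD x _ _) _; rewrite -ltrBrDr.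
have [p cip] : exists p, ci = x + p by exists (ci - x); rewrite addrC subrK.
have [q coq] : exists q, co = x + q by exists (co - x); rewrite addrC subrK.
move: ei eo; rewrite {1}cip {1}coq !(addrC x) !addrK => ei eo.
(* Otherwise the midpoint of the centres would lie in both open balls, hence both inside and outside
   [X]. *)
have pq : 2 * r <= enorm (p - q).
  rewrite leNgt; apply/negP => h.
  pose m := x + 2^-1 *: (p + q).
  have mi : enorm (m - ci) < r.
    have -> : m - ci = 2^-1 *: (q - p).
      by rewrite cip; apply/matrixP => i j; rewrite !mxE; field.
    by rewrite enormZ enormB ger0_norm// mulrC ltr_pdivrMr// mulrC.
  have mo : enorm (m - co) < r.
    have -> : m - co = 2^-1 *: (p - q).
      by rewrite coq; apply/matrixP => i j; rewrite !mxE; field.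
    by rewrite enormZ ger0_norm// mulrC ltr_pdivrMr// mulrC.
  by apply: (oX m); [exact: interior_ecball|apply: iX; exact: ltW].
have qp : p = - q.
  apply/eqP; rewrite -addr_eq0 -dot_eq0 eq_le dot_ge0 andbT.
  have : (2 * r) ^+ 2 <= dot (p - q) (p - q).
    by rewrite -sqr_enorm ler_sqr// nnegrE ?enorm_ge0// mulr_ge0// ltW.
  have := sqr_enorm p; have := sqr_enorm q; rewrite ei eo !dotE (dotC q p); nra.
exists (r^-1 *: q); split.
- by rewrite enormZ eo ger0_norm ?invr_ge0 ?ltW// mulVf// gt_eqF.
- by rewrite scalerA mulfV ?gt_eqF// scale1r -qp -cip.
- move=> y; rewrite scalerA mulfV ?gt_eqF// scale1r -coq => h.
  by apply: oX; exact: interior_ecball.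
Qed.

Section at_boundary_point.
Variables (r : R) (X : set 'cV[R]_d) (x n : 'cV[R]_d).
Hypotheses (r0 : 0 < r) (cX : closed X) (bx : bd X x) (nx : ball_normal r X x n).

(** A boundary point lies in neither of the two open touching balls; expanding the two squared
    distances to their centres gives the two signs of the bound. *)
Lemma bd_quadratic z : bd X z -> `|dot n (z - x)| <= dot (z - x) (z - x) / (2 * r).
Proof.
case: nx => n1 iX oX bz; rewrite ler_pdivlMr ?mulr_gt0//.
have nn : dot n n = 1 by rewrite -sqr_enorm n1 expr1n.
have h1 : r ^+ 2 <= dot (z - (x - r *: n)) (z - (x - r *: n)).
  rewrite leNgt -enorm_lt ?ltW//; apply/negP => h; case: bz => _; apply.
  by move/interior_ecball: h; exact: interiorS.
have h2 : r ^+ 2 <= dot (z - (x + r *: n)) (z - (x + r *: n)).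
  rewrite leNgt -enorm_lt ?ltW//; apply/negP => h.
  have [y Xy yz] := (@closure_enormP _ _ z X).1 bz.1 (r - enorm (z - (x + r *: n))) ltac:(by rewrite subr_gt0).
  by apply: oX Xy; apply: le_lt_trans (enorm_distD z _ _) _; lra.
move: h1 h2; rewrite (opprB x) (opprD x) !addrA (addrAC z) (addrC _ (- x)) (addrC (- x)).
rewrite [X in _ -> r ^+ 2 <= X -> _](_ : _ = dot (z - x - r *: n) (z - x - r *: n)); last by [].
move: (z - x) => h; rewrite !dotE (dotC h n) nn => h1 h2.
by rewrite normrEsign; case: (dot n h < 0); rewrite ?expr0 ?expr1; nra.
Qed.

(* [x + t *: v - s *: n] is in X and [x + t *: v + s *: n] is not, for s of order t^2. *)
Lemma curve_along v : dot n v = 0 -> exists gamma : R -> 'cV[R]_d,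
  [/\ gamma 0 = x, (forall t, bd X (gamma t)) &
      exists2 t0, 0 < t0 & forall t, `|t| < t0 ->
        enorm (gamma t - (x + t *: v)) <= t ^+ 2 * ((dot v v + 1) / r)].
Proof.
case: nx => n1 iX oX nv; have vv := dot_ge0 v.
have nn : dot n n = 1 by rewrite -sqr_enorm n1 expr1n.
(* With s = t^2 C one has s r = t^2 (|v|^2 + 1), and s < r for small t, so 2 s r > s^2 + t^2 |v|^2.
   This puts the points at height -s and +s over the tangent plane strictly inside the inner and the
   outer ball. *)
pose C := (dot v v + 1) / r.
have C0 : 0 < C by rewrite divr_gt0// ltr_wpDl.
pose t0 := r / (dot v v + 1).
have t00 : 0 < t0 by rewrite divr_gt0// ltr_wpDl.
have key t : `|t| < Num.min t0 r -> t != 0 ->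
    exists2 z, bd X z & enorm (z - (x + t *: v)) <= t ^+ 2 * C.
  rewrite lt_min => /andP[tt0 t1] tn0.
  have t2 : 0 < t ^+ 2 by rewrite exprn_even_gt0.
  pose s := t ^+ 2 * C.
  have s0 : 0 < s by rewrite mulr_gt0.
  have sr : s * r = t ^+ 2 * (dot v v + 1) by rewrite /s /C; field; rewrite gt_eqF.
  have s_lt : s < r.
    rewrite -(ltr_pM2r r0) sr.
    have tv : `|t| * (dot v v + 1) < r by rewrite -ltr_pdivlMr// ltr_wpDl.
    have t_gt0 : 0 < `|t| by rewrite normr_gt0.
    by rewrite -real_normK ?num_real//; nra.
  have Xp : X (x + t *: v - s *: n).
    apply: iX; rewrite /ecball /= enorm_le ?ltW//.
    have -> : x + t *: v - s *: n - (x - r *: n) = t *: v + (r - s) *: n.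
      by apply/matrixP => i j; rewrite !mxE; ring.
    rewrite !dotE (dotC v n) nv nn.
    have := mulr_ge0 (ltW s0) (ltW (etrans (subr_gt0 s r) s_lt)); nra.
  have Xq : ~ X (x + t *: v + s *: n).
    apply: oX; rewrite enorm_lt ?ltW//.
    have -> : x + t *: v + s *: n - (x + r *: n) = t *: v + (s - r) *: n.
      by apply/matrixP => i j; rewrite !mxE; ring.
    rewrite !dotE (dotC v n) nv nn.
    have := mulr_ge0 (ltW s0) (ltW (etrans (subr_gt0 s r) s_lt)); nra.
  have [th th01 bz] := bd_segment cX Xp Xq; exists (x + t *: v - s *: n + th *: (x + t *: v + s *: n - (x + t *: v - s *: n))) => //.
  have -> : x + t *: v - s *: n + th *: (x + t *: v + s *: n - (x + t *: v - s *: n)) - (x + t *: v) = (s * (2 * th - 1)) *: n.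
    by apply/matrixP => i j; rewrite !mxE; ring.
  rewrite enormZ n1 mulr1 normrM (ger0_norm (ltW s0)) -[leRHS]/s -[leRHS]mulr1 ler_pM2l//.
  by move/andP: th01 => [? ?]; rewrite ler_norml; apply/andP; split; lra.
(* For large [t] the curve stays at [x]; [tangent] only asks for boundary points near 0 and for the
   velocity there. *)
have /choice[gamma hg] : forall t, exists z, bd X z /\ (t = 0 -> z = x) /\
    (`|t| < Num.min t0 r -> enorm (z - (x + t *: v)) <= t ^+ 2 * C).
  move=> t; have [->|tn0] := eqVneq t 0.
    exists x; split => //; split => // _.
    by rewrite scale0r addr0 subrr enorm0 expr0n mul0r.
  have [tt|tt] := pselect (`|t| < Num.min t0 r).
    have [z bz hz] := key t tt tn0; exists z; split => //; split => // t00'.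
    by rewrite t00' eqxx in tn0.
  exists x; split => //.
exists gamma; split.
- by have [_ [h _]] := hg 0; exact: h.
- by move=> t; have [] := hg t.
- exists (Num.min t0 r); first by rewrite lt_min t00 r0.
  by move=> t; have [_ [_ h]] := hg t; exact: h.
Qed.

(** [curve_along] has velocity [v] because its error is of order t^2. Conversely, by [bd_quadratic]
    the difference quotients of a boundary curve have a normal component of order h. *)
Lemma tangent_ball_normal v : tangent X x v <-> dot n v = 0.
Proof.
split=> [[gamma [g0 bg gv]]|/curve_along[gamma [g0 bg [t0 t00 gv]]]]; last first.
  exists gamma; split; [exact: g0|near=> t; exact: bg|].
  move=> A /nbhs_enormP[e e0 vA].
  pose C := (dot v v + 1) / r.
  have C0 : 0 < C by rewrite divr_gt0// ltr_wpDl// dot_ge0.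
  suff H : \forall h \near (0 : R)^', A (h^-1 *: (gamma h - x)) by exact: H.
  apply/dnbhs0P; exists (Num.min t0 (e / C)); first by rewrite lt_min t00 divr_gt0.
  move=> h hn0; rewrite lt_min => /andP[ht0 hC]; apply: vA.
  have -> : h^-1 *: (gamma h - x) - v = h^-1 *: (gamma h - (x + h *: v)).
    by rewrite opprD addrA [RHS]scalerBr scalerA mulVf// scale1r.
  rewrite enormZ normfV ltr_pdivrMl ?normr_gt0//.
  apply: le_lt_trans (gv h ht0) _.
  rewrite -real_normK ?num_real// expr2 -mulrA ltr_pM2l ?normr_gt0//.
  by rewrite -ltr_pdivlMr.
have n1 : enorm n = 1 by case: nx.
apply/eqP; rewrite -normr_le0; apply/ler_addgt0Pl => e e0; rewrite addr0.
pose V := enorm v + e / 2.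
have V0 : 0 < V by rewrite ltr_wpDl ?enorm_ge0// divr_gt0.
have /dnbhs0P[e1 e10 gA] : \forall h \near (0 : R)^', enorm (h^-1 *: (gamma h - x) - v) < e / 2.
  by apply: (gv [set w | enorm (w - v) < e / 2]); apply/nbhs_enormP; exists (e / 2) => //; rewrite divr_gt0.
have /dnbhs0P[e2 e20 bg2] : \forall h \near (0 : R)^', bd X (gamma h) by exact: nbhs_dnbhs.
pose e3 := Num.min (Num.min e1 e2) (e * r / V ^+ 2).
have e30 : 0 < e3 by rewrite !lt_min e10 e20/= divr_gt0 ?mulr_gt0// exprn_gt0.
pose h := e3 / 2.
have h0 : 0 < h by rewrite divr_gt0.
have hn0 : h != 0 by rewrite gt_eqF.
have : `|h| < e3 by rewrite gtr0_norm// ltr_pdivrMr// mulr_natr mulr2n ltrDl.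
rewrite !lt_min => /andP[/andP[he1 he2] hs].
have hb := bg2 h hn0 he2; have hv := gA h hn0 he1.
set w := h^-1 *: (gamma h - x) in hv.
have gw : gamma h - x = h *: w by rewrite /w scalerA mulfV// scale1r.
clearbody w.
have wV : enorm w <= V.
  by rewrite -(subrK v w); apply: le_trans (enormD _ _) _; rewrite /V addrC lerD2l ltW.
have nw : `|dot n w| <= e / 2.
  have := bd_quadratic hb; rewrite gw !dotE normrM.
  have -> : h * (h * dot w w) / (2 * r) = `|h| * (`|h| * dot w w / (2 * r)).
    by rewrite gtr0_norm//; ring.
  rewrite ler_pM2l ?normr_gt0// => /le_trans; apply.
  have ww : dot w w <= V ^+ 2 by rewrite -enorm_le// ltW.
  rewrite ler_pdivrMr ?mulr_gt0//.
  apply: (@le_trans _ _ (`|h| * V ^+ 2)); first by rewrite ler_wpM2l.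
  apply: (@le_trans _ _ (e * r / V ^+ 2 * V ^+ 2)); first by rewrite ler_wpM2r ?sqr_ge0// ltW.
  by rewrite divfK ?gt_eqF ?exprn_gt0//; lra.
have -> : dot n v = dot n w - dot n (w - v) by rewrite !dotE; ring.
apply: le_trans (ler_normB _ _) _.
have : `|dot n (w - v)| <= e / 2.
  by apply: le_trans (cauchy_schwarz _ _) _; rewrite n1 mul1r ltW.
lra.
Unshelve. all: by end_near. Qed.

(** A unit vector orthogonal to the tangent space is [n] or [- n], and [- n] points into the inner
    ball, hence into [X]. *)
Lemma normal_eq : normal X x = n.
Proof.
have [n1 iX oX] := nx; have nn : dot n n = 1 by rewrite -sqr_enorm n1 expr1n.
have on : is_outward_normal X x n.
  split => //; first by move=> v /tangent_ball_normal.
  near=> t; apply: oX; rewrite opprD addrACA subrr add0r -scalerBl enormZ n1 mulr1.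
  have t0 : 0 < t by near: t; exact: nbhs_right_gt.
  have tr : t < r by near: t; exact: nbhs_right_lt.
  by rewrite ler0_norm; lra.
have un u : is_outward_normal X x u -> u = n.
  move=> [u1 ut uo]; have uu : dot u u = 1 by rewrite -sqr_enorm u1 expr1n.
  have tv : tangent X x (u - dot u n *: n).
    by apply/tangent_ball_normal; rewrite !dotE nn dotC; ring.
  have := ut _ tv; rewrite !dotE uu => h1.
  have uE : u = dot u n *: n.
    by apply/eqP; rewrite -subr_eq0 -dot_eq0; rewrite !dotE uu nn (dotC n u); apply/eqP; nra.
  have /eqP : (dot u n - 1) * (dot u n + 1) = 0 by lra.
  rewrite mulf_eq0 => /orP[]; first by rewrite subr_eq0 => /eqP un1; rewrite uE un1 scale1r.
  rewrite addr_eq0 => /eqP un1; exfalso.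
  have : \forall t \near (0 : R)^'+, False.
    near=> t; have : ~ X (x + t *: u) by near: t.
    apply; apply: iX; rewrite /ecball /= uE un1.
    have -> : x + t *: (-1 *: n) - (x - r *: n) = (r - t) *: n.
      by apply/matrixP => i j; rewrite !mxE; ring.
    rewrite enormZ n1 mulr1.
    have t0 : 0 < t by near: t; exact: nbhs_right_gt.
    have tr : t < r by near: t; exact: nbhs_right_lt.
    by rewrite ger0_norm; lra.
  by move=> /filter_ex[].
by rewrite /normal; apply: xget_unique.
Unshelve. all: by end_near. Qed.

End at_boundary_point.
End regular_boundary.

(** * Integrals under a measure preserving involution *)

Section involution_preserving_integral.
Import HBNNSimple.
Context {R : realType} {d : measure_display} {T : measurableType d}.
Variables (mu : {measure set T -> \bar R}) (g : T -> T).
Hypotheses (gg : involutive g) (mg : measurable_fun setT g).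
Hypothesis mu_g : forall A, mu (g @^-1` A) = mu A.

Section nnsfun_comp.
Variable h : {nnsfun T >-> R}.

Definition nnsfun_comp : T -> R := h \o g.

Lemma nnsfun_comp_measurable : measurable_fun setT nnsfun_comp.
Proof. exact: measurableT_comp. Qed.
HB.instance Definition _ := @isMeasurableFun.Build _ _ _ _ nnsfun_comp
  nnsfun_comp_measurable.

Lemma nnsfun_comp_finite : finite_set (range nnsfun_comp).
Proof.
by apply: sub_finite_set (fimfunP h) => _ [x _ <-]; exists (g x).
Qed.
HB.instance Definition _ := @FiniteImage.Build _ _ nnsfun_comp nnsfun_comp_finite.

Lemma nnsfun_comp_ge0 x : 0 <= nnsfun_comp x.
Proof. exact: fun_ge0. Qed.
HB.instance Definition _ := @isNonNegFun.Build _ _ nnsfun_comp nnsfun_comp_ge0.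

Definition nnsfun_comp_nnsfun : {nnsfun T >-> R} := nnsfun_comp.

Lemma sintegral_comp : sintegral mu nnsfun_comp_nnsfun = sintegral mu h.
Proof. by apply: eq_fsbigr => x _; rewrite -(mu_g (h @^-1` _)). Qed.

End nnsfun_comp.

Local Open Scope ereal_scope.

Let ge0_integral_involution (f : T -> \bar R) : (forall x, 0 <= f x) ->
  \int[mu]_x f x <= \int[mu]_x f (g x).
Proof.
move=> f0; rewrite !ge0_integralTE//.
apply: ge_ereal_sup => _ [h /= hf <-]; apply: ereal_sup_ubound.
exists (nnsfun_comp_nnsfun h); last exact: sintegral_comp.
by move=> x; exact: hf.
Qed.

(** Composition with [g] carries simple functions below [f] to simple functions below [f \o g] with
    the same integral; as [g] is an involution, the inequality so obtained is an equality. This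
    covers the curvature integrand, about whose measurability nothing is known here. *)
Lemma integral_involution (D : set T) (f : T -> \bar R) :
  \int[mu]_(x in g @^-1` D) f (g x) = \int[mu]_(x in D) f x.
Proof.
have E (F : T -> \bar R) : (forall x, 0 <= F x) -> \int[mu]_x F (g x) = \int[mu]_x F x.
  move=> F0; apply/eqP; rewrite eq_le ge0_integral_involution// andbT.
  have := @ge0_integral_involution (F \o g) (fun x => F0 (g x)).
  by under [X in _ <= X]eq_integral do rewrite /= gg.
rewrite integral_mkcond [RHS]integral_mkcond integralE [RHS]integralE.
have -> : (fun x => f (g x)) \_ (g @^-1` D) = (f \_ D) \o g.
  by apply/funext => x; rewrite !patchE /= (_ : (x \in g @^-1` D) = (g x \in D))//; apply/idP/idP; rewrite !inE.
have Ep := E _ (funepos_ge0 (f \_ D)).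
have En := E _ (funeneg_ge0 (f \_ D)).
congr (_ - _); [rewrite -Ep|rewrite -En]; apply: eq_integral => x _; by rewrite ?funeposE ?funenegE.
Qed.

End involution_preserving_integral.

(** * Hausdorff measure *)

Section hausdorff_theory.
Context {R : realType} {d : nat}.
Variable n : nat.
Implicit Types (A B X : set 'cV[R]_d) (phi : 'cV[R]_d -> R).
Local Open Scope ereal_scope.

Lemma ediam_leP A (D : R) : (0 <= D)%R ->
  ediam A <= D%:E <-> forall x y, A x -> A y -> (enorm (x - y) <= D)%R.
Proof.
move=> D0; split=> [h x y Ax Ay|h].
  rewrite -lee_fin; apply: le_trans h; apply: ereal_sup_ubound; right.
  by exists (x, y).
apply: ge_ereal_sup => _ [->|[[x y] [/= Ax Ay] <-]]; first by rewrite lee_fin.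
by rewrite lee_fin; exact: h.
Qed.

Lemma ediam_fin A (D : R) : ediam A <= D%:E ->
  exists2 k : R, (0 <= k)%R & ediam A = k%:E.
Proof.
have := ediam_ge0 A; case: (ediam A) => [k k0 _| |//]; last by rewrite leye_eq.
by exists k.
Qed.

Lemma le_ediam A B : A `<=` B -> ediam A <= ediam B.
Proof.
move=> AB; apply: ge_ereal_sup => _ [->|[[x y] [/= Ax Ay] <-]]; first exact: ediam_ge0.
by apply: ereal_sup_ubound; right; exists (x, y) => //; split; exact: AB.
Qed.

Lemma le_expe (x y : \bar R) m : 0 <= x -> x <= y -> x ^+ m <= y ^+ m.
Proof.
move=> x0 xy; elim: m => [|m IH]; first by rewrite !expe0.
by rewrite !expeS; apply: lee_pmul => //; exact: expe_ge0.
Qed.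

Lemma le_hcost A B : A `<=` B -> hcost n A <= hcost n B.
Proof.
move=> AB; rewrite {1}/hcost; case: eqP => [_|/eqP/set0P[x Ax]]; first exact: hcost_ge0.
rewrite /hcost; case: eqP => [B0|_]; first by exfalso; rewrite B0 in AB; exact: AB Ax.
apply: lee_wpmul2l; first by rewrite lee_fin divr_ge0 ?ball_vol_ge0// exprn_ge0.
by apply: le_expe; [exact: ediam_ge0|exact: le_ediam].
Qed.

Lemma hcost_lipschitz (f : 'cV[R]_d -> 'cV[R]_d) (t D : R) A : (0 <= t)%R ->
  ediam A <= D%:E ->
  (forall x y, A x -> A y -> enorm (f x - f y) <= t * enorm (x - y))%R ->
  ediam (f @` A) <= t%:E * ediam A /\ hcost n (f @` A) <= (t ^+ n)%:E * hcost n A.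
Proof.
move=> t0 AD ft; have [k k0 Ak] := ediam_fin AD.
have fk : ediam (f @` A) <= (t * k)%:E.
  apply/ediam_leP; first exact: mulr_ge0.
  move=> _ _ [x Ax <-] [y Ay <-]; apply: le_trans (ft _ _ Ax Ay) _.
  by rewrite ler_wpM2l//; apply: (ediam_leP A k0).1 => //; rewrite Ak.
split; first by rewrite Ak -EFinM.
have [k' k'0 fk'] := ediam_fin fk.
rewrite /hcost; case: eqP => [_|/eqP/set0P[_ [x Ax _]]].
  by rewrite mule_ge0// ?lee_fin ?exprn_ge0//; exact: hcost_ge0.
rewrite ifF; last by apply/negP => /eqP A0; rewrite A0 in Ax.
rewrite fk' Ak -!EFin_expe -!EFinM lee_fin mulrCA -exprMn.
rewrite ler_wpM2l// ?divr_ge0 ?ball_vol_ge0 ?exprn_ge0//.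
by rewrite lerXn2r ?nnegrE ?mulr_ge0// -lee_fin -fk'.
Qed.

Lemma hausdorff_delta_le (delta : R) X (A : (set 'cV[R]_d)^nat) :
  (forall k, ediam (A k) <= delta%:E) -> X `<=` \bigcup_k A k ->
  hausdorff_delta n delta X <= \sum_(k <oo) hcost n (A k).
Proof. by move=> Ad XA; apply: ereal_inf_lbound; exists A. Qed.

Lemma le_hausdorff_delta (e1 e2 : R) X : (e1 <= e2)%R ->
  hausdorff_delta n e2 X <= hausdorff_delta n e1 X.
Proof.
move=> e12; apply: le_ereal_inf_tmp => _ [A [Ae XA] <-].
by apply: hausdorff_delta_le => // k; apply: le_trans (Ae k) _; rewrite lee_fin.
Qed.

Lemma hausdorff_delta_le_hausdorff (e : R) X : (0 < e)%R ->
  hausdorff_delta n e X <= hausdorff n X.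
Proof. by move=> e0; apply: ereal_sup_ubound; exists e. Qed.

Lemma hausdorff_lipschitz (f : 'cV[R]_d -> 'cV[R]_d) (t : R) X : (0 < t)%R ->
  (forall x y, X x -> X y -> enorm (f x - f y) <= t * enorm (x - y))%R ->
  hausdorff n (f @` X) <= (t ^+ n)%:E * hausdorff n X.
Proof.
move=> t0 ft; apply: ge_ereal_sup => _ [e /= e0 <-].
have et0 : (0 < e / t)%R by rewrite divr_gt0.
apply: (@le_trans _ _ ((t ^+ n)%:E * hausdorff_delta n (e / t) X)); last first.
  by rewrite lee_pmul2l ?lte_fin ?exprn_gt0//; exact: hausdorff_delta_le_hausdorff.
rewrite -lee_pdivrMl ?exprn_gt0//.
apply: le_ereal_inf_tmp => _ [A [Ae XA] <-].
rewrite lee_pdivrMl ?exprn_gt0//.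
(* The covering sets are cut down to [X], where alone [f] is Lipschitz. *)
have AXe k : ediam (A k `&` X) <= (e / t)%:E by apply: le_trans (Ae k); apply: le_ediam => x [].
have lipA k := @hcost_lipschitz f t (e / t) (A k `&` X) (ltW t0) (AXe k)
  (fun x y Ax Ay => ft x y Ax.2 Ay.2).
apply: (@le_trans _ _ (\sum_(k <oo) hcost n (f @` (A k `&` X)))).
  apply: hausdorff_delta_le => [k|_ [x Xx <-]].
    apply: le_trans (lipA k).1 _; apply: (@le_trans _ _ (t%:E * (e / t)%:E)).
      by rewrite lee_pmul2l.
    by rewrite -EFinM mulrC divfK// gt_eqF.
  by have [k _ Akx] := XA x Xx; exists k => //; exists x.
rewrite -nneseriesZl; last by move=> *; exact: hcost_ge0.
  apply: lee_nneseries => k *; first exact: hcost_ge0.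
  apply: le_trans (lipA k).2 _; rewrite lee_pmul2l ?lte_fin ?exprn_gt0//.
  by apply: le_hcost => x [].
Qed.

(** A covering set of diameter less than [t - s] cannot meet both [A] and [B], so a fine cover of
    the union splits into separate covers. *)
Lemma hausdorff_separated phi (s t : R) A B :
  (forall x y, `|phi x - phi y| <= enorm (x - y))%R -> (s < t)%R ->
  (forall x, A x -> phi x <= s)%R -> (forall x, B x -> t <= phi x)%R ->
  hausdorff n A + hausdorff n B <= hausdorff n (A `|` B).
Proof.
move=> phiL st As Bt.
have sep (e : R) : (0 < e)%R -> (e < t - s)%R ->
    hausdorff_delta n e A + hausdorff_delta n e B <= hausdorff_delta n e (A `|` B).
  move=> e0 ets; apply: le_ereal_inf_tmp => _ [C [Ce ABC] <-].
  apply: (@le_trans _ _ (\sum_(k <oo) (hcost n (C k `&` A) + hcost n (C k `&` B)))).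
    rewrite nneseriesD; last 2 first.
      by move=> *; exact: hcost_ge0.
      by move=> *; exact: hcost_ge0.
    apply: leeD; apply: hausdorff_delta_le => [k|x Ax].
    - by apply: le_trans (Ce k); apply: le_ediam => x [].
    - by have [k _ Ck] := ABC x (or_introl Ax); exists k.
    - by apply: le_trans (Ce k); apply: le_ediam => x [].
    - by have [k _ Ck] := ABC x (or_intror Ax); exists k.
  apply: lee_nneseries => k *; first by rewrite adde_ge0// hcost_ge0.
  have [[x [Cx Ax]]|nA] := pselect (exists x, (C k `&` A) x); last first.
    have -> : C k `&` A = set0 by apply/seteqP; split => // x Cx; apply: nA; exists x.
    by rewrite hcost0 add0e; apply: le_hcost => x [].
  have -> : C k `&` B = set0.
    apply/seteqP; split => // y [Cy By].
    have := (ediam_leP (C k) (ltW e0)).1 (Ce k) y x Cy Cx.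
    have := phiL y x; have := As x Ax; have := Bt y By.
    by have := ler_norm (phi y - phi x)%R; lra.
  by rewrite hcost0 adde0; apply: le_hcost => z [].
(* Two independent scales allow the two suprema on the left to be taken one after the other. *)
have sep2 (e1 e2 : R) : (0 < e1)%R -> (0 < e2)%R ->
    hausdorff_delta n e1 A + hausdorff_delta n e2 B <= hausdorff n (A `|` B).
  move=> e10 e20; pose e := Num.min (Num.min e1 e2) ((t - s) / 2)%R.
  have e0 : (0 < e)%R by rewrite !lt_min e10 e20/= divr_gt0// subr_gt0.
  apply: le_trans (hausdorff_delta_le_hausdorff _ e0).
  apply: le_trans (sep e e0 _).
    by apply: leeD; apply: le_hausdorff_delta; rewrite /e !ge_min lexx ?orbT.
  rewrite /e gt_min; apply/orP; right; rewrite ltr_pdivrMr// mulr_natr mulr2n ltrDl.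
  by rewrite subr_gt0.
have [->|] := eqVneq (hausdorff n (A `|` B)) +oo; first exact: leey.
move: sep2 (hausdorff_ge0 n (A `|` B)).
case: (hausdorff n (A `|` B)) => [z sep2 _ _| |//]; last by rewrite eqxx.
have ge0 e X : 0 <= hausdorff_delta n e X by apply: cover_outer_ge0; exact: hcost_ge0.
have fA (e : R) : (0 < e)%R -> hausdorff_delta n e A \is a fin_num.
  move=> e0; rewrite ge0_fin_numE//; apply: le_lt_trans (ltry z).
  by apply: le_trans (sep2 e e e0 e0); rewrite leeDl.
have fB : hausdorff n B <= z%:E.
  apply: ge_ereal_sup => _ [e /= e0 <-].
  by apply: le_trans (sep2 e e e0 e0); rewrite leeDr.
have fB' : hausdorff n B \is a fin_num.
  by rewrite ge0_fin_numE ?hausdorff_ge0//; apply: le_lt_trans fB (ltry z).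
rewrite -leeBrDr//; apply: ge_ereal_sup => _ [e1 /= e10 <-].
rewrite leeBrDr// addeC -leeBrDr ?fA//; apply: ge_ereal_sup => _ [e2 /= e20 <-].
by rewrite leeBrDr ?fA// addeC sep2.
Qed.

(* Caratheodory's criterion: the shells cut out by a sequence of levels decreasing
   to 0 have summable measures, each being separated from a superlevel set. *)
Lemma measurable_lipschitz_le0 phi : (forall x y, `|phi x - phi y| <= enorm (x - y))%R ->
  (hausdorff_outer n).-caratheodory [set x | phi x <= 0]%R.
Proof.
move=> phiL; apply: le_caratheodory_measurable => X.
rewrite /hausdorff_outer /=.
have [->|Xoo] := eqVneq (hausdorff n X) +oo; first exact: leey.
have [z XE] : exists z, hausdorff n X = z%:E.
  by move: Xoo (hausdorff_ge0 n X); case: (hausdorff n X) => [z| |]//; exists z.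
rewrite XE.
pose P t := X `&` [set x | t < phi x]%R.
have Pfin Y : Y `<=` X -> hausdorff n Y \is a fin_num.
  move=> YX; rewrite ge0_fin_numE ?hausdorff_ge0//; apply: le_lt_trans (ltry z).
  by rewrite -XE; exact: le_hausdorff.
pose M t := fine (hausdorff n (P t)).
have ME t : hausdorff n (P t) = (M t)%:E by rewrite fineK//; apply: Pfin => x [].
have Mnonincr s t : (s <= t)%R -> (M t <= M s)%R.
  move=> st; rewrite -lee_fin -!ME; apply: le_hausdorff => x [Xx tx]; split => //=.
  exact: le_lt_trans tx.
pose S := [set M t | t in [set t | 0 < t]%R].
have supS : has_sup S.
  split; first by exists (M 1%R), 1%R => //=.
  by exists (M 0%R) => _ [t /= t0 <-]; apply: Mnonincr; exact: ltW.
have ML t : (0 < t)%R -> (M t <= sup S)%R.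
  by move=> t0; apply: ub_le_sup; [case: supS|exists t].
have far : hausdorff n (X `&` [set x | phi x <= 0]%R) + (sup S)%:E <= z%:E.
  have XAE := Pfin (X `&` [set x | phi x <= 0]%R) (@subIsetl _ _ _).
  rewrite -leeBrDl// -(fineK XAE) -EFinB lee_fin; apply: ge_sup; first by case: supS.
  move=> _ [t /= t0 <-]; rewrite lerBrDl -lee_fin EFinD -ME (fineK XAE) -XE.
  apply: le_trans (@hausdorff_separated phi 0 t _ _ phiL t0 _ _) _.
  - by move=> x [].
  - by move=> x [_ /ltW].
  - by apply: le_hausdorff => x [[]|[]].
apply: le_trans far; apply: leeD2l; apply/lee_addgt0Pr => e e0.
have /choice[u uP] : forall k, exists u, (0 < u /\ sup S - e / (2 ^ k.+1)%:R < M u)%R.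
  move=> k.
  have ek : (0 < e / (2 ^ k.+1)%:R)%R by rewrite divr_gt0// ltr0n expn_gt0.
  by have [_ [t /= t0 <-] Mt] := sup_adherent ek supS; exists t.
(* Halving drives the levels to 0, while staying below [u k] keeps the measure above level [t k]
   within e / 2^(k+1) of its supremum. *)
pose t := fix t k := if k is k'.+1 then Num.min (u k) (t k' / 2)%R else u 0%N.
have t0 k : (0 < t k)%R.
  by elim: k => [|k IH] /=; [case: (uP 0%N)|rewrite lt_min divr_gt0// andbT; case: (uP k.+1)].
have tM k : (sup S - e / (2 ^ k.+1)%:R < M (t k))%R.
  apply: lt_le_trans (uP k).2 _; apply: Mnonincr.
  by case: k => [|k] //=; rewrite ge_min lexx.
have t_half k : (t k.+1 <= t k / 2)%R by rewrite /= ge_min lexx orbT.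
have t_lt k : (t k.+1 < t k)%R.
  by apply: le_lt_trans (t_half k) _; rewrite ltr_pdivrMr// mulr_natr mulr2n ltrDl.
have t_small x : (0 < x)%R -> exists k, (t k < x)%R.
  move=> x0; have tb k : (t k <= t 0%N / 2 ^+ k)%R.
    elim: k => [|k IH]; first by rewrite expr0 divr1.
    apply: le_trans (t_half k) _; rewrite exprSr invfM mulrA.
    by rewrite ler_pM2r// invr_gt0.
  pose k := Num.truncn (t 0%N / x).
  exists k.+1; apply: le_lt_trans (tb _) _.
  rewrite ltr_pdivrMr ?exprn_gt0// mulrC -ltr_pdivrMr//.
  apply: lt_trans (truncnS_gt _) _.
  by rewrite -natrX ltr_nat ltn_expl.
pose shell k := X `&` [set x | t k.+2 < phi x <= t k.+1]%R.
(* The gap between [t k.+1] and [t k] separates the shell from [P (t k)]; their measures add up to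
   at most [sup S], of which [P (t k)] already takes almost everything. *)
have shellM k : hausdorff n (shell k) <= (e / (2 ^ k.+1)%:R)%:E.
  have h : hausdorff n (shell k) + hausdorff n (P (t k)) <= (sup S)%:E.
    apply: (@le_trans _ _ (hausdorff n (P (t k.+2)))); last by rewrite ME lee_fin ML.
    apply: le_trans (@hausdorff_separated phi (t k.+1) (t k) _ _ phiL (t_lt k) _ _) _.
    - by move=> x [_ /andP[]].
    - by move=> x [_ /ltW].
    - apply: le_hausdorff => x [[Xx /andP[? _]]|[Xx /= h]]; split => //=.
      by apply: lt_trans h; exact: lt_trans (t_lt _) (t_lt _).
  have shE := Pfin (shell k) (@subIsetl _ _ _).
  move: h; rewrite ME -(fineK shE) -EFinD !lee_fin => h.
  by have := tM k; lra.
have cov : X `&` ~` [set x | phi x <= 0]%R `<=` P (t 1%N) `|` \bigcup_k shell k.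
  move=> x [Xx /= /negP]; rewrite -ltNge => x0.
  have [k0 k0x] := t_small _ x0.
  have ex : exists k, (t k < phi x)%R by exists k0.
  case: (ex_minnP ex) => k tk kmin.
  have [k1|k1] := leqP k 1.
    left; split => //=; apply: le_lt_trans tk.
    by case: k k1 {kmin} => [|[|//]] _ //; exact/ltW/t_lt.
  case: k tk kmin k1 => [|[|k]]// tk kmin _.
  right; exists k => //; split => //; apply/andP; split; first exact: tk.
  by rewrite leNgt; apply/negP => /kmin; rewrite ltnn.
apply: le_trans (le_hausdorff n cov) _.
apply: le_trans (outer_measureU2 (hausdorff_outer n) _ _) _.
rewrite {1}/hausdorff_outer /= ME; apply: leeD; first by rewrite lee_fin; exact: ML (t0 1%N).
apply: le_trans (outer_measure_sigma_subadditive (hausdorff_outer n) shell) _.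
apply: le_trans (epsilon_trick0 xpredT (ltW e0)).
by apply: lee_nneseries => [k _ _|k _]; [exact: hausdorff_ge0|exact: shellM].
Qed.

End hausdorff_theory.

(** * Measure of the sphere *)

Section uniform_cube_boxes.
Context {R : realType}.
Local Open Scope ereal_scope.

Local Notation U := (uniform_prob (@ltr01 R)).

Definition tbox n (A : nat -> set (measurableTypeR R)) : set (n.-tuple (measurableTypeR R)) :=
  [set t | forall i : 'I_n, A i (tnth t i)].

Arguments tbox : clear implicits.

Lemma measurable_tbox n A : (forall i, measurable (A i)) -> measurable (tbox n A).
Proof.
move=> mA; have -> : tbox n A = \big[setI/setT]_(i < n) ((@tnth _ _)^~ i @^-1` A i).
  apply/seteqP; split => t /= h.
    by elim/big_ind: _ => // i _; exact: h.
  move=> i; move: h; rewrite (bigD1 i)//= => -[].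
  exact: id.
apply: bigsetI_measurable => i _; rewrite -[X in measurable X]setTI.
exact: measurable_tnth.
Qed.

Lemma uniform_cube_tbox n A : (forall i, measurable (A i)) ->
  uniform_cube n (tbox n A) = \prod_(i < n) U (A i).
Proof.
elim: n A => [|n IH] A mA.
  rewrite big_ord0 /uniform_cube /= diracE mem_set// => -[]//.
rewrite big_ord_recl /= /distribution /pushforward.
have -> : @tcons R n @^-1` tbox n.+1 A = A 0%N `*` tbox n (fun i => A i.+1).
  apply/seteqP; split => -[x t] /=.
    move=> h; split; first by have := h ord0; rewrite tnth0.
    by move=> i; have := h (lift ord0 i); rewrite tnthS.
  move=> [h0 h] i; case: (unliftP ord0 i) => [j ->|->]; last by rewrite tnth0.
  by rewrite tnthS; exact: h.
rewrite product_measure1E//; last exact: measurable_tbox.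
by congr (_ * _); exact: (IH (fun i => A i.+1) (fun i => mA i.+1)).

Qed.

Lemma uniform01_segment (a w : R) : (0 <= w)%R -> U `[a, (a + w)%R]%classic <= w%:E.
Proof.
move=> w0; rewrite /uniform_prob /=.
apply: (@le_trans _ _ (\int[lebesgue_measure]_(x in `[a, (a + w)%R]) (cst 1%:E) x)).
  apply: ge0_le_integral => //=.
  - by move=> x _; rewrite lee_fin uniform_pdf_ge0.
  - by apply/measurable_EFinP/measurable_funTS; exact: measurable_uniform_pdf.
  - by move=> x _; rewrite lee_fin /uniform_pdf subr0 invr1; case: ifP.
rewrite integral_cst//= mul1e lebesgue_measure_itv /= lte_fin.
by case: ifP => _; [rewrite -EFinB lee_fin addrAC subrr add0r|rewrite lee_fin].
Qed.

Lemma uniform01_unit : U `[0%R, 1%R]%classic = 1.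
Proof. exact: integral_uniform_pdf1. Qed.

End uniform_cube_boxes.
Arguments tbox {R} n A.

Lemma ball_vol_gt0 (R : realType) m : 0 < ball_vol R m.
Proof.
suff : 0 < ball_vol R m /\ 0 < ball_vol R m.+1 by case.
elim: m => [//|m [h1 h2]]; split => //=.
by rewrite mulr_gt0// divr_gt0// mulr_gt0// pi_gt0.
Qed.

Section sphere_measure.
Context {R : realType} {m : nat}.
Local Open Scope ereal_scope.
Implicit Types (rho : R).

Definition sphere rho : set 'cV[R]_m.+1 := [set x | enorm x = rho].

(** The sphere as a graph over a small cube. The scale rho / (m + 1) keeps the radicand nonnegative
    on the unit cube, since m / (m + 1)^2 <= 1. *)
Definition sphere_chart rho (t : m.-tuple (measurableTypeR R)) : 'cV[R]_m.+1 :=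
  let s := (rho / m.+1%:R)%R in
  \col_i (if unlift ord_max i is Some j then s * tnth t j
          else Num.sqrt (rho ^+ 2 - \sum_j (s * tnth t j) ^+ 2))%R.

Lemma sphere_chart_sphere rho t : (0 < rho)%R -> tbox m (fun=> `[0%R, 1%R]%classic) t ->
  sphere rho (sphere_chart rho t).
Proof.
move=> r0 t01; apply/eqP; rewrite enorm_eq ?ltW//; apply/eqP.
rewrite /dot (bigD1 ord_max)//= mxE unlift_none -expr2 sqr_sqrtr; last first.
  rewrite subr_ge0; apply: (@le_trans _ _ (\sum_(j < m) (rho / m.+1%:R) ^+ 2)%R).
    apply: ler_sum => j _; have := t01 j; rewrite /= in_itv /= => /andP[t0 t1].
    have s0 : (0 <= rho / m.+1%:R)%R by rewrite divr_ge0// ltW.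
    by rewrite ler_sqr ?nnegrE ?mulr_ge0 ?(ltW r0)// ler_piMr.
  rewrite sumr_const card_ord -[leLHS]mulr_natr expr_div_n mulrAC ler_pdivrMr ?exprn_gt0//.
  by rewrite ler_wpM2l ?sqr_ge0// -natrX ler_nat; nia.
rewrite (reindex_omap (lift ord_max) (unlift ord_max)); last first.
  by move=> i im; case: unliftP im => [j ->//|->]; rewrite eqxx.
rewrite [X in (_ - _ + X)%R](eq_bigr (fun j : 'I_m => (rho / m.+1%:R * tnth t j) ^+ 2)%R); last first.
  by move=> j _; rewrite mxE liftK expr2.
rewrite [X in (_ - _ + X)%R](eq_bigl xpredT) ?subrK// => j.
by rewrite liftK eqxx eq_sym neq_lift.
Qed.

(* A cover of the sphere pulls back along the chart to a cover of the cube by boxes. *)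
Lemma hausdorff_sphere_gt0 rho : (0 < m)%N -> (0 < rho)%R -> 0 < hausdorff m (sphere rho).
Proof.
move=> m0 r0; pose s := (rho / m.+1%:R)%R.
have s0 : (0 < s)%R by rewrite divr_gt0.
(* A set of diameter D pulls back into a box of sides 2D / s; this [c] makes c (2D / s)^m equal to
   the Hausdorff cost of the set. *)
pose c := (ball_vol R m / 2 ^+ m * (s / 2) ^+ m)%R.
have c0 : (0 < c)%R by rewrite mulr_gt0 ?exprn_gt0 ?divr_gt0 ?ball_vol_gt0 ?exprn_gt0.
apply: (@lt_le_trans _ _ c%:E) => //.
apply: (@le_trans _ _ (hausdorff_delta m 1 (sphere rho))); last exact: hausdorff_delta_le_hausdorff.
apply: le_ereal_inf_tmp => _ [A [A1 SA] <-].
have /choice[D Dk] : forall k, exists D : R, (0 <= D)%R /\ ediam (A k) = D%:E.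
  by move=> k; have [D D0 AD] := ediam_fin (A1 k); exists D.
pose p k : 'cV[R]_m.+1 := xget 0%R (A k).
(* The i-th side of the box: chart parameters whose coordinate is within [D k] of that of a chosen
   point of [A k]. *)
pose J k i : set (measurableTypeR R) :=
  if `[< A k !=set0 >] then
    (let a := if insub i is Some j then p k (lift ord_max j) 0%R else 0%R in
     `[((a - D k) / s)%R, ((a - D k) / s + 2 * D k / s)%R]%classic)
  else set0.
have mJ k i : measurable (J k i) by rewrite /J; case: asboolP.
have cover : tbox m (fun=> `[0%R, 1%R]%classic) `<=` \bigcup_k tbox m (J k).
  move=> t t01; have [k _ Ak] := SA _ (sphere_chart_sphere r0 t01).
  exists k => // j; rewrite /J; case: asboolP => [Ak0|]; last by case; exists (sphere_chart rho t).
  rewrite valK /= in_itv /=.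
  have pk : A k (p k) by rewrite /p; apply: xgetPex.
  have := (ediam_leP (A k) (Dk k).1).1 _ _ _ Ak pk.
  rewrite (Dk k).2 lexx => /(_ isT) h.
  have := le_trans (coord_le_enorm _ (lift ord_max j)) h.
  rewrite !mxE liftK -/s ler_distl => /andP[h1 h2].
  rewrite ler_pdivrMr// -mulrDl ler_pdivlMr// (mulrC _ s).
  by rewrite h1 /=; apply: le_trans h2 _; lra.
have U1 : uniform_cube m (tbox m (fun=> `[0%R, 1%R]%classic)) = 1 :> \bar R.
  by rewrite uniform_cube_tbox// big1// => i _; exact: uniform01_unit.
have h : 1 <= \sum_(k <oo) uniform_cube m (tbox m (J k)).
  rewrite -[X in X <= _]U1; apply: measure_sigma_subadditive cover.
    by move=> k; exact: measurable_tbox.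
  by apply: measurable_tbox => _; exact: measurable_itv.
have box k : c%:E * uniform_cube m (tbox m (J k)) <= hcost m (A k).
  rewrite uniform_cube_tbox//; have [[Ak0 Ak]|Ak] := pselect (A k !=set0 /\ True).
    have JD i : uniform_prob (@ltr01 R) (J k i) <= (2 * D k / s)%:E.
      rewrite /J; case: asboolP => // _; apply: uniform01_segment.
      by rewrite divr_ge0 ?mulr_ge0 ?(Dk k).1// ltW.
    have prodD : \prod_(i < m) uniform_prob (@ltr01 R) (J k i) <= ((2 * D k / s) ^+ m)%:E.
      elim: (m) => [|n IH]; first by rewrite big_ord0 expr0.
      rewrite big_ord_recr /= exprSr EFinM; apply: lee_pmul => //.
      by apply: prode_ge0 => i _; exact: measure_ge0.
    apply: (@le_trans _ _ (c%:E * ((2 * D k / s) ^+ m)%:E)); first by rewrite lee_pmul2l.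
    rewrite /hcost ifF; last by apply/negP => /eqP A0; case: Ak0; rewrite A0.
    rewrite (Dk k).2 -EFin_expe -!EFinM lee_fin /c -(mulrA (_ / _)%R) -exprMn.
    by rewrite le_eqVlt; apply/orP; left; apply/eqP; congr (_ * _ ^+ _)%R; field; rewrite gt_eqF.
  (* For empty [A k] the box must have measure 0; this uses [0 < m], an empty product being 1. *)
  rewrite (bigD1 (Ordinal m0))//= {1}/J; case: asboolP => [Ak0|_]; first by exfalso; apply: Ak.
  by rewrite measure0 mul0e mule0 hcost_ge0.
apply: (@le_trans _ _ (c%:E * \sum_(k <oo) uniform_cube m (tbox m (J k)))).
  by rewrite -[leLHS]mule1 lee_pmul2l.
rewrite -nneseriesZl; last by move=> *; exact: measure_ge0.
by apply: lee_nneseries => [k _ _|k _]; [rewrite mule_ge0// lee_fin ltW|exact: box].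
Qed.

End sphere_measure.

Section hausdorff_finite_cover.
Context {R : realType} {d n : nat}.
Local Open Scope ereal_scope.

Lemma hausdorff_delta_finite_cover (J : finType) (A : J -> set 'cV[R]_d) X (e : R) :
  (0 < e)%R -> (forall j, ediam (A j) <= e%:E) -> (forall x, X x -> exists j, A j x) ->
  hausdorff_delta n e X <= \sum_j hcost n (A j).
Proof.
move=> e0 Ae XA.
pose A' k := if insub k is Some i then A (enum_val (i : 'I_#|J|)) else set0.
apply: (@le_trans _ _ (\sum_(k <oo) hcost n (A' k))).
  apply: hausdorff_delta_le => [k|x /XA[j Aj]].
    by rewrite /A'; case: insubP => // _; rewrite ediam0 lee_fin ltW.
  exists (enum_rank j : nat) => //; rewrite /A' insubT//= => jJ.
  by rewrite (_ : Sub _ _ = enum_rank j) ?enum_rankK//; exact: val_inj.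
rewrite (nneseries_split 0 #|J|); last by move=> *; exact: hcost_ge0.
rewrite add0n [X in _ + X]eseries0 ?adde0; last first.
  by move=> k Jk _; rewrite /A' insubF ?hcost0// ltnNge Jk.
rewrite big_mkord (reindex (@enum_rank J)) /=; last exact/onW_bij/enum_rank_bij.
by apply: lee_sum => j _; rewrite /A' valK enum_rankK.
Qed.

End hausdorff_finite_cover.

(** * Finiteness of the measure of the sphere *)

Section sphere_measure_finite.
Context {R : realType} {m : nat}.
Implicit Types (rho : R).

(* Where the coordinate j.1.1 is the largest and has constant sign, it is a
   Lipschitz function of the other ones, which are localised by j.2. *)
Definition sphere_piece rho N (j : 'I_m.+1 * bool * {ffun 'I_m -> 'I_N.+1}) : set 'cV[R]_m.+1 :=
  [set x | [/\ enorm x = rho, forall k, `|x k 0| <= `|x j.1.1 0|, j.1.2 = (0 <= x j.1.1 0) &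
    forall k, Num.truncn ((x (lift j.1.1 k) 0 + rho) * (N%:R / (2 * rho))) = j.2 k]].

Lemma sphere_piece_cover rho N x : 0 < rho -> (0 < N)%N -> sphere rho x ->
  exists j, sphere_piece (N := N) rho j x.
Proof.
move=> r0 N0 Sx.
have [i _ imax] := @Order.TotalTheory.arg_maxP _ _ _ (@ord0 m) xpredT (fun i => `|x i 0|) isT.
pose f k := Num.truncn ((x (lift i k) 0 + rho) * (N%:R / (2 * rho))).
have fN k : (f k < N.+1)%N.
  rewrite ltnS; have := coord_le_enorm x (lift i k); rewrite Sx ler_norml => /andP[h1 h2].
  have f0 : 0 <= (x (lift i k) 0 + rho) * (N%:R / (2 * rho)).
    by rewrite mulr_ge0// ?divr_ge0 ?mulr_ge0 ?(ltW r0)//; lra.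
  rewrite -(ler_nat R); have /andP[+ _] := truncn_itv f0 => /le_trans; apply.
  rewrite mulrA ler_pdivrMr ?mulr_gt0// mulrC ler_wpM2l//; lra.
exists (i, 0 <= x i 0, [ffun k => Ordinal (fN k)]); split => //= k.
  exact: imax.
by rewrite ffunE.
Qed.

(** The other coordinates agree up to eta by construction. On the sphere x_i^2 - y_i^2 is the sum of
    the y_k^2 - x_k^2, each at most eta (|x_i| + |y_i|) because coordinate i dominates; as x_i and
    y_i have the same sign, the factor |x_i| + |y_i| cancels. *)
Lemma sphere_piece_diam rho N j : 0 < rho -> (0 < N)%N ->
  (ediam (sphere_piece (N := N) rho j) <=
   (Num.sqrt m.+1%:R * (m.+1%:R * (2 * rho)) / N%:R)%:E)%E.
Proof.
move=> r0 N0; have N0' : 0 < N%:R :> R by rewrite ltr0n.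
set eta := 2 * rho / N%:R.
have eta0 : 0 <= eta by rewrite divr_ge0 ?mulr_ge0// ltW.
apply/ediam_leP; first by rewrite divr_ge0 ?mulr_ge0 ?sqrtr_ge0// ltW.
move=> x y [xr xmax xs xf] [yr ymax ys yf].
have lift_close k : `|x (lift j.1.1 k) 0 - y (lift j.1.1 k) 0| <= eta.
  have [hx hy] := (xf k, yf k).
  have pos z : enorm z = rho -> 0 <= (z (lift j.1.1 k) 0 + rho) * (N%:R / (2 * rho)).
    move=> zr; have := coord_le_enorm z (lift j.1.1 k); rewrite zr ler_norml => /andP[h1 h2].
    by rewrite mulr_ge0// ?divr_ge0 ?mulr_ge0 ?(ltW r0)//; lra.
  have := truncn_itv (pos x xr); have := truncn_itv (pos y yr).
  rewrite hx hy => /andP[y1 y2] /andP[x1 x2].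
  have : `|(x (lift j.1.1 k) 0 - y (lift j.1.1 k) 0) * (N%:R / (2 * rho))| <= 1.
    rewrite ler_norml; move: x1 x2 y1 y2; move: (nat_of_ord (j.2 k)) => q.
    by rewrite -!natr1 => *; apply/andP; split; lra.
  rewrite normrM (ger0_norm (_ : 0 <= N%:R / (2 * rho))); last first.
    by rewrite divr_ge0 ?mulr_ge0// ltW.
  by rewrite -ler_pdivlMr ?divr_gt0 ?mulr_gt0// mul1r invf_div.
pose i := j.1.1; rewrite -/i in xmax xs xf ymax ys yf lift_close.
have xyi : 0 < `|x i 0| + `|y i 0|.
  rewrite lt_neqAle addr_ge0// andbT eq_sym paddr_eq0// !normr_eq0.
  apply/negP => /andP[/eqP xi0 _]; suff : x = 0 by move=> x0; move: xr r0; rewrite x0 enorm0 => <-; rewrite ltxx.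
  apply/matrixP => k l; rewrite ord1 mxE; apply/eqP; rewrite -normr_le0.
  by apply: le_trans (xmax k) _; rewrite xi0 normr0.
have i_close : `|x i 0 - y i 0| <= m%:R * eta.
  rewrite -(ler_pM2r xyi).
  have -> : `|x i 0 - y i 0| * (`|x i 0| + `|y i 0|) = `|x i 0 ^+ 2 - y i 0 ^+ 2|.
    rewrite subr_sqr normrM; congr (_ * _); rewrite ys in xs.
    have [hx|hx] := leP 0 (x i 0); have [hy|hy] := leP 0 (y i 0).
    - by rewrite (ger0_norm hx) (ger0_norm hy) ger0_norm// addr_ge0.
    - by move: xs; rewrite hx leNgt hy.
    - by move: xs; rewrite hy leNgt hx.
    - by rewrite (ltr0_norm hx) (ltr0_norm hy) ltr0_norm ?opprD//; lra.
  have sq z : enorm z = rho -> z i 0 ^+ 2 = rho ^+ 2 - \sum_k z (lift i k) 0 ^+ 2.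
    move=> zr; rewrite -zr sqr_enorm.
    suff -> : dot z z = z i 0 ^+ 2 + \sum_k z (lift i k) 0 ^+ 2 by rewrite addrK.
    by rewrite /dot (bigD1_ord i)//= -expr2; congr (_ + _); apply: eq_bigr => k _; rewrite expr2.
  rewrite (sq _ xr) (sq _ yr) opprD opprK addrACA subrr add0r addrC -sumrB.
  apply: le_trans (ler_norm_sum _ _ _) _.
  apply: (@le_trans _ _ (\sum_(k < m) eta * (`|x i 0| + `|y i 0|))); last first.
    by rewrite sumr_const card_ord -[leLHS]mulr_natl mulrA.
  apply: ler_sum => k _; rewrite subr_sqr normrM distrC ler_pM//.
  by apply: le_trans (ler_normD _ _) _; rewrite addrC lerD.
have all_close k : `|(x - y) k 0| <= m.+1%:R * eta.
  rewrite !mxE; case: (unliftP i k) => [l ->|->].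
    by apply: le_trans (lift_close l) _; rewrite ler_peMl// ler1n.
  by apply: le_trans i_close _; rewrite ler_wpM2r// ler_nat.
have := enorm_le_coord (mulr_ge0 (ler0n _ m.+1) eta0) all_close.
by rewrite /eta !mulrA.
Qed.

Lemma hausdorff_sphere_lty rho : 0 < rho -> (hausdorff m (sphere rho : set 'cV[R]_m.+1) < +oo)%E.
Proof.
move=> r0; pose C := Num.sqrt m.+1%:R * (m.+1%:R * (2 * rho)).
have C0 : 0 <= C by rewrite !mulr_ge0 ?sqrtr_ge0// ltW.
have k0 : 0 <= ball_vol R m / 2 ^+ m by rewrite divr_ge0 ?ball_vol_ge0 ?exprn_ge0.
(* There are 2 (m + 1) (N + 1)^m pieces of diameter at most C / N, and (N + 1) C / N <= 2 C, so the
   bound is independent of the scale. *)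
pose K := (m.+1 * 2)%:R * (ball_vol R m / 2 ^+ m * (2 * C) ^+ m).
apply: (@le_lt_trans _ _ K%:E); last exact: ltry.
apply: ge_ereal_sup => _ [e /= e0 <-].
pose N := (Num.truncn (C / e)).+1.
have CN : C / N%:R <= e.
  rewrite ler_pdivrMr ?ltr0n// mulrC -ler_pdivrMr//; apply: ltW; exact: truncnS_gt.
apply: le_trans (@hausdorff_delta_finite_cover _ _ m _ (sphere_piece (N := N) rho) _ e e0 _ _) _.
- by move=> j; apply: le_trans (sphere_piece_diam j r0 (ltn0Sn _)) _; rewrite lee_fin.
- by move=> x Sx; exact: sphere_piece_cover.
apply: (@le_trans _ _ (\sum_(j : 'I_m.+1 * bool * {ffun 'I_m -> 'I_N.+1})
    (ball_vol R m / 2 ^+ m * (C / N%:R) ^+ m)%:E)%E).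
  apply: lee_sum => j _; rewrite /hcost; case: ifP => _.
    by rewrite lee_fin mulr_ge0// exprn_ge0// divr_ge0.
  rewrite [leRHS]EFinM; apply: lee_wpmul2l; first by rewrite lee_fin.
  rewrite EFin_expe; apply: le_expe; first exact: ediam_ge0.
  exact: sphere_piece_diam.
rewrite sumEFin lee_fin sumr_const !card_prod card_ord card_bool card_ffun !card_ord.
rewrite -[leLHS]mulr_natl natrM -mulrA /K; apply: ler_wpM2l => //.
rewrite mulrCA; apply: ler_wpM2l => //; rewrite natrX -exprMn.
have h1 : 0 <= N.+1%:R * (C / N%:R) by exact/mulr_ge0/divr_ge0.
have h2 : 0 <= 2 * C by exact: mulr_ge0.
apply: lerXn2r => //.
rewrite mulrA (mulrC _ C) -mulrA [leRHS]mulrC; apply: ler_wpM2l => //.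
by rewrite ler_pdivrMr ?ltr0n// -natrM ler_nat mul2n; lia.
Qed.

End sphere_measure_finite.

(** * Invariance of the intrinsic volume *)

Section orthogonal_involution.
Context {R : realType} {d : nat}.
Variable g : 'M[R]_d.
Hypotheses (gT : g^T = g) (gg : g *m g = 1%:M).
Implicit Types (X A : set 'cV[R]_d) (x y v : 'cV[R]_d).

Definition premul X : set 'cV[R]_d := [set x | X (g *m x)].

Let gK v : g *m (g *m v) = v.
Proof. by rewrite mulmxA gg mul1mx. Qed.

Let gorth : g *m g^T = 1%:M.
Proof. by rewrite gT. Qed.

Lemma enorm_mulB x y : enorm (g *m x - y) = enorm (x - g *m y).
Proof. by rewrite -{1}(gK y) -mulmxBr enorm_orth. Qed.

Lemma premulK X : premul (premul X) = X.
Proof. by apply/seteqP; split => x; rewrite /premul /= gK. Qed.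

Lemma premul_image X : (mulmx g) @` X = premul X.
Proof.
apply/seteqP; split => [_ [x Xx <-]|x Xx]; first by rewrite /premul /= gK.
by exists (g *m x).
Qed.

Lemma closure_premul X x : closure (premul X) x <-> closure X (g *m x).
Proof.
split=> /closure_enormP cl; apply/closure_enormP => e /cl[y Xy xy].
  by exists (g *m y) => //; rewrite -mulmxBr enorm_orth.
by exists (g *m y); [rewrite /premul /= gK|rewrite enorm_mulB].
Qed.

Lemma interior_premul X x : (premul X)° x <-> X° (g *m x).
Proof.
split=> /interior_enormP[e e0 eX]; apply/interior_enormP; exists e => // y yx.
  by rewrite -(gK y); apply: eX; rewrite enorm_mulB.
by apply: eX; rewrite -mulmxBr enorm_orth.
Qed.

Lemma bd_premul X x : bd (premul X) x <-> bd X (g *m x).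
Proof.
split=> -[cl nI]; split.
- exact/closure_premul.
- by move=> /(interior_premul X x).2.
- exact/closure_premul.
- by move=> /(interior_premul X x).1.
Qed.

Lemma closed_premul X : closed X -> closed (premul X).
Proof. by move=> cX x /closure_premul /cX. Qed.

Lemma ecball_premul c (r : R) x : ecball (g *m c) r x <-> ecball c r (g *m x).
Proof. by rewrite /ecball /= enorm_mulB. Qed.

Lemma r_regular_premul (r : R) X : r_regular r X -> r_regular r (premul X).
Proof.
move=> [cX rX]; split; first exact: closed_premul.
move=> x /bd_premul /rX[ci [co [xi xo iX oX]]].
exists (g *m ci), (g *m co); split; [exact/ecball_premul..| |].
  by move=> y /ecball_premul /iX.
move=> y /interior_enormP[e e0 eo]; apply: oX; apply/interior_enormP; exists e => // z zy.
by rewrite -(gK z); apply/ecball_premul/eo; rewrite enorm_mulB.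
Qed.

Lemma tangent_premul X x v : tangent (premul X) x v -> tangent X (g *m x) (g *m v).
Proof.
move=> [gamma [g0 bg gv]]; exists (fun t => g *m gamma t); split.
- by rewrite g0.
- by apply: filterS bg => t /bd_premul.
- move=> A /nbhs_enormP[e e0 eA].
  suff H : \forall h \near (0 : R)^', A (h^-1 *: (g *m gamma h - g *m x)) by exact: H.
  have : \forall h \near (0 : R)^', enorm (h^-1 *: (gamma h - x) - v) < e.
    by apply: (gv [set w | enorm (w - v) < e]); apply/nbhs_enormP; exists e.
  apply: filterS => h hv; apply: eA.
  by rewrite -mulmxBr scalemxAr -mulmxBr enorm_orth.
Qed.

Section regular.
Variables (r : R).
Hypothesis r0 : 0 < r.

Lemma normal_premul X x : r_regular r X -> bd (premul X) x ->
  normal (premul X) x = g *m normal X (g *m x).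
Proof.
move=> rX bx; have bx' := (bd_premul X x).1 bx.
have [n nx] := r_regular_ball_normal r0 rX bx'.
rewrite (normal_eq r0 rX.1 bx' nx).
apply: (normal_eq r0 (closed_premul rX.1) bx); have [n1 iX oX] := nx; split.
- by rewrite enorm_orth.
- rewrite scalemxAr -{1}(gK x) -mulmxBr => y /ecball_premul; exact: iX.
- move=> y; rewrite scalemxAr -{1}(gK x) -mulmxDr -enorm_mulB => h; exact: oX.
Qed.

Lemma normal_diff_premul X x (A : 'M[R]_d) : r_regular r X -> bd (premul X) x ->
  normal_diff X (g *m x) A -> normal_diff (premul X) x (g *m A *m g).
Proof.
move=> rX bx dA e e0; have /nbhs_enormP[k k0 kA] := dA e e0.
apply/nbhs_enormP; exists k => // y yx byy.
rewrite !normal_premul// -(mulmxBr g) -!mulmxA -(mulmxBr g) (enorm_orth _ gorth).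
rewrite -(enorm_orth (y - x) gorth) (mulmxBr g); apply: kA; last exact/bd_premul.
by rewrite -mulmxBr enorm_orth.
Qed.

(** The differential is conjugated by [g] and the tangent basis is moved by [g], so the matrix [M]
    in that basis, and with it the characteristic polynomial, stays the same. *)
Lemma is_principal_curvatures_premul X x k : r_regular r X -> bd (premul X) x ->
  is_principal_curvatures X (g *m x) k -> is_principal_curvatures (premul X) x k.
Proof.
move=> rX bx [A [B [M [dA rB tB AB pM]]]].
exists (g *m A *m g), (g *m B), M; split => //.
- exact: normal_diff_premul.
- have fg : row_full g by rewrite row_full_unit; have [] := mulmx1_unit gg.
  by rewrite (eqmxMfull _ fg).
- move=> v; split.
    by move=> /tangent_premul /tB[c gv]; exists c; rewrite -mulmxA -gv gK.
  move=> [c ->]; rewrite -{1}(premulK X) in tB.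
  have /tangent_premul : tangent (premul (premul X)) (g *m x) (B *m c) by apply/tB; exists c.
  by rewrite gK mulmxA.
- by rewrite !mulmxA -(mulmxA _ g g) gg mulmx1 -mulmxA AB mulmxA.
Qed.

(** The sets of admissible lists coincide, so [xget] makes the same choice for both, including the
    order of the list and the default value where none exists. *)
Lemma principal_curvatures_premul X x : r_regular r X -> bd (premul X) x ->
  principal_curvatures (premul X) x = principal_curvatures X (g *m x).
Proof.
move=> rX bx; rewrite /principal_curvatures; congr (xget _ _).
apply/seteqP; split => k /=; last exact: is_principal_curvatures_premul.
rewrite -{2}(premulK X) => h; apply: is_principal_curvatures_premul.
- exact: r_regular_premul.
- by rewrite premulK; exact/bd_premul.
- by rewrite gK.
Qed.

End regular.

Lemma hausdorff_premul n A : hausdorff n (premul A) = hausdorff n A.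
Proof.
have le X : (hausdorff n (premul X) <= hausdorff n X)%E.
  rewrite -premul_image; have := @hausdorff_lipschitz _ _ n (mulmx g) 1 X ltr01.
  rewrite expr1n mul1e; apply => x y _ _; by rewrite mul1r -mulmxBr enorm_orth.
by apply/eqP; rewrite eq_le le/= -{1}(premulK A) le.
Qed.

Lemma caratheodory_premul n A : (hausdorff_outer n).-caratheodory A ->
  (hausdorff_outer n).-caratheodory (premul A).
Proof.
move=> cA X; rewrite -[LHS]/(hausdorff n X) -(hausdorff_premul n X).
rewrite -[LHS]/(hausdorff_outer n (premul X)) cA.
rewrite -[LHS]/(hausdorff n (premul X `&` A) + hausdorff n (premul X `&` ~` A))%E.
rewrite -(hausdorff_premul n (_ `&` A)) -(hausdorff_premul n (_ `&` ~` A)).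
rewrite -[RHS]/(hausdorff n (X `&` premul A) + hausdorff n (X `&` ~` premul A))%E.
by congr (_ + _)%E; congr hausdorff; apply/seteqP; split => x; rewrite /premul /setI /setC /= gK.
Qed.

Lemma intrinsic_volume_premul (r : R) X : 0 < r -> r_regular r X ->
  intrinsic_volume_dm2 (premul X) = intrinsic_volume_dm2 X.
Proof.
move=> r0 rX; rewrite /intrinsic_volume_dm2; congr (_ * _)%E.
rewrite (_ : bd (premul X) = mulmx g @^-1` bd X); last first.
  by apply/seteqP; split => x; [move=> /bd_premul|move=> ?; exact/bd_premul].
pose f : 'cV[R]_d -> \bar R := fun x => (\sum_(i < d.-1) principal_curvatures X x 0 i)%:E.
pose f' : 'cV[R]_d -> \bar R := fun x => (\sum_(i < d.-1) principal_curvatures (premul X) x 0 i)%:E.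
have ff' : {in mulmx g @^-1` bd X, f' =1 f \o mulmx g}.
  move=> x; rewrite inE => bx; rewrite /f' /f /=.
  by rewrite (principal_curvatures_premul r0 rX)//; exact/bd_premul.
have mg : measurable_fun [set: caratheodory_type (hausdorff_outer (R := R) (d := d) d.-1)]
    (mulmx g : caratheodory_type (hausdorff_outer d.-1) -> caratheodory_type (hausdorff_outer d.-1)).
  by move=> _ A mA; rewrite setTI; exact: caratheodory_premul mA.
have E1 := @eq_integral _ (caratheodory_type (hausdorff_outer d.-1)) R (hausdorff_measure d.-1) (mulmx g @^-1` bd X) (f \o mulmx g) f' ff'.
have E2 := @integral_involution _ _ _ (hausdorff_measure d.-1) (mulmx g) gK mg (hausdorff_premul _) (bd X) f.
exact: (etrans E1 E2).
Qed.

End orthogonal_involution.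

(** * Curvature of the ball *)

Section ball_curvature.
Context {R : realType} {m : nat}.
Implicit Types (x y v : 'cV[R]_m.+1) (rho : R).

Local Notation eball := (ecball (0 : 'cV[R]_m.+1)).

Lemma eballE rho x : eball rho x <-> enorm x <= rho.
Proof. by rewrite /ecball /= subr0. Qed.

Lemma ler_enormB x y : `|enorm x - enorm y| <= enorm (x - y).
Proof.
rewrite ler_norml; apply/andP; split.
  have := enormD (y - x) x; rewrite subrK enormB; lra.
have := enormD (x - y) y; rewrite subrK; lra.
Qed.

Lemma closed_eball rho : closed (eball rho).
Proof.
move=> x /closure_enormP cl; apply/eballE/ler_addgt0Pl => e e0.
have [y /eballE yr yx] := cl e e0.
have := ler_enormB x y; rewrite enormB => /(le_trans (ler_norm _)); lra.
Qed.

Lemma bd_eball rho : 0 < rho -> bd (eball rho) = sphere rho.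
Proof.
move=> r0; apply/seteqP; split => x.
  move=> [cl nI]; apply/eqP; rewrite eq_le; apply/andP; split.
    exact/eballE/closed_eball.
  rewrite leNgt; apply/negP => h; apply: nI; apply: interior_ecball; by rewrite subr0.
move=> xr; split; first by apply: subset_closure; apply/eballE; rewrite xr.
move=> /interior_enormP[e e0 eB].
have t0 : 0 < e / (2 * rho) by rewrite divr_gt0// mulr_gt0.
have /eballE : eball rho ((1 + e / (2 * rho)) *: x).
  apply: eB; rewrite scalerDl scale1r addrAC subrr add0r enormZ xr gtr0_norm//.
  have -> : e / (2 * rho) * rho = e / 2 by field; rewrite gt_eqF.
  by rewrite ltr_pdivrMr// mulr_natr mulr2n ltrDl.
rewrite enormZ xr gtr0_norm ?addr_gt0//; nra.
Qed.

Lemma ball_normal_eball rho x : 0 < rho -> sphere rho x ->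
  ball_normal rho (eball rho) x (rho^-1 *: x).
Proof.
move=> r0 xr; split.
- by rewrite enormZ xr gtr0_norm ?invr_gt0// mulVf// gt_eqF.
- by rewrite scalerA mulfV ?gt_eqF// scale1r subrr.
- move=> y; rewrite scalerA mulfV ?gt_eqF// scale1r -mulr2n -scaler_nat => h /eballE yr.
  have := ler_enormB (2%:R *: x) y; rewrite enormB enormZ xr (ger0_norm (ler0n R 2)) => /(le_trans (ler_norm _)); lra.
Qed.

Lemma normal_eball rho x : 0 < rho -> sphere rho x -> normal (eball rho) x = rho^-1 *: x.
Proof.
move=> r0 xr; apply: (normal_eq r0 (@closed_eball rho)); last exact: ball_normal_eball.
by rewrite bd_eball.
Qed.

Lemma tangent_eball rho x v : 0 < rho -> sphere rho x ->
  tangent (eball rho) x v <-> dot x v = 0.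
Proof.
move=> r0 xr; have bx : bd (eball rho) x by rewrite bd_eball.
rewrite (tangent_ball_normal r0 (@closed_eball rho) bx (ball_normal_eball r0 xr)).
rewrite dotZl; split=> [/eqP|->]; last by rewrite mulr0.
by rewrite mulf_eq0 invr_eq0 gt_eqF//= => /eqP.
Qed.

Lemma enorm_mulmx_bound (L : 'M[R]_m.+1) :
  exists2 K, 0 <= K & forall w : 'cV[R]_m.+1, enorm (L *m w) <= K * enorm w.
Proof.
pose S := \sum_i \sum_j `|L i j|.
have S0 : 0 <= S by apply: sumr_ge0 => i _; apply: sumr_ge0.
exists (Num.sqrt m.+1%:R * S) => [|w]; first by rewrite mulr_ge0// sqrtr_ge0.
rewrite -mulrA; apply: enorm_le_coord => [|i]; first by rewrite mulr_ge0// enorm_ge0.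
rewrite mxE; apply: le_trans (ler_norm_sum _ _ _) _.
apply: (@le_trans _ _ (\sum_j `|L i j| * enorm w)).
  by apply: ler_sum => j _; rewrite normrM ler_wpM2l// coord_le_enorm.
rewrite -mulr_suml ler_wpM2r ?enorm_ge0// /S [leRHS](bigD1 i)//= lerDl.
by apply: sumr_ge0 => k _; apply: sumr_ge0.
Qed.

(** The normal is linear on the sphere, so [L] maps boundary increments to o(t). Along the curve of
    [curve_along] the increment is t v + O(t^2); dividing by t gives [L *m v = 0]. *)
Lemma normal_diff_eball rho x (A : 'M[R]_m.+1) v : 0 < rho -> sphere rho x ->
  normal_diff (eball rho) x A -> dot x v = 0 -> A *m v = rho^-1 *: v.
Proof.
move=> r0 xr dA xv; pose L := rho^-1%:M - A.
suff Lv : L *m v = 0.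
  by apply/esym/eqP; rewrite -subr_eq0 -Lv mulmxBl mul_scalar_mx.
have [K K0 LK] := enorm_mulmx_bound L.
have bx : bd (eball rho) x by rewrite bd_eball.
have nx := ball_normal_eball r0 xr.
have nv : dot (rho^-1 *: x) v = 0 by rewrite dotZl xv mulr0.
have [gamma [g0 bg [t0 t00 gv]]] := curve_along r0 (@closed_eball rho) bx nx nv.
set C := (dot v v + 1) / rho in gv.
have C0 : 0 <= C by rewrite divr_ge0 ?addr_ge0 ?dot_ge0// ltW.
apply/eqP; rewrite -enorm_eq0 eq_le enorm_ge0 andbT.
apply/ler_addgt0Pl => e e0; rewrite addr0.
pose V := enorm v + C.
have V0 : 0 <= V by rewrite addr_ge0// enorm_ge0.
pose e' := e / 2 / (V + 1).
have e'0 : 0 < e' by rewrite !divr_gt0// ltr_wpDl.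
have /nbhs_enormP[k k0 kA] := dA e' e'0.
(* The bounds keep [t] in the range of the curve, keep [gamma t] in the neighbourhood where [dA]
   applies, and give the quadratic error of the curve at most half of [e]; [e'] accounts for the
   other half. *)
pose t := Num.min (Num.min 1 (t0 / 2)) (Num.min (k / 2 / (V + 1)) (e / 2 / (K * C + 1))).
have KC : 0 < K * C + 1 by rewrite ltr_wpDl// mulr_ge0.
have tp : 0 < t by rewrite !lt_min ltr01 !divr_gt0// ltr_wpDl.
have [t1 tt0 tk te] : [/\ t <= 1, t < t0, t * (V + 1) < k & t * (K * C + 1) <= e / 2].
  split.
  - by rewrite /t !ge_min lexx.
  - apply: (@le_lt_trans _ _ (t0 / 2)); first by rewrite /t !ge_min lexx !orbT.
    by rewrite ltr_pdivrMr// mulr_natr mulr2n ltrDl.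
  - apply: (@le_lt_trans _ _ (k / 2)); last by rewrite ltr_pdivrMr// mulr_natr mulr2n ltrDl.
    by rewrite -ler_pdivlMr ?ltr_wpDl// /t !ge_min lexx !orbT.
  - by rewrite -ler_pdivlMr// /t !ge_min lexx !orbT.
have := gv t; rewrite gtr0_norm// => /(_ tt0).
pose w := gamma t - (x + t *: v); rewrite -/w => wC.
have gx : gamma t - x = t *: v + w by apply/matrixP => a b; rewrite /w !mxE; ring.
have wt : enorm w <= t * C.
  apply: le_trans wC _; rewrite expr2 -mulrA; apply: ler_piMl => //.
  exact: mulr_ge0 (ltW tp) C0.
have gt : enorm (gamma t - x) <= t * V.
  rewrite gx; apply: le_trans (enormD _ _) _; rewrite enormZ (gtr0_norm tp) /V mulrDr.
  by apply: lerD => //; exact: wt.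
have gS : sphere rho (gamma t) by rewrite -bd_eball.
have := kA (gamma t); rewrite !normal_eball// => /(_ _ (bg t)).
have -> : rho^-1 *: gamma t - rho^-1 *: x - A *m (gamma t - x) = L *m (gamma t - x).
  by rewrite -scalerBr mulmxBl mul_scalar_mx.
move=> h; have {}h : enorm (L *m (gamma t - x)) <= e' * (t * V).
  apply: le_trans (h _) _; last by rewrite ler_wpM2l// ltW.
  by apply: le_lt_trans gt _; apply: le_lt_trans tk; rewrite ler_wpM2l ?lerDl// ltW.
have Lv : t *: (L *m v) = L *m (gamma t - x) - L *m w.
  by rewrite gx mulmxDr -scalemxAr addrK.
have : t * enorm (L *m v) <= e' * (t * V) + K * (t ^+ 2 * C).
  rewrite -[X in X * _ <= _](gtr0_norm tp) -enormZ Lv.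
  apply: le_trans (enormD _ _) _; rewrite enormN lerD//.
  by apply: le_trans (LK _) _; rewrite ler_wpM2l.
have -> : e' * (t * V) + K * (t ^+ 2 * C) = t * (e' * V + t * (K * C)) by ring.
rewrite ler_pM2l// => /le_trans; apply.
have : e' * V <= e / 2 by rewrite /e' mulrAC ler_pdivrMr ?ltr_wpDl// ler_wpM2l ?lerDl// divr_ge0// ltW.
move: te; rewrite mulrDr mulr1; lra.
Qed.

Lemma kernel_basis x : x != 0 -> exists B : 'M[R]_(m.+1, m),
  \rank B = m /\ forall v, dot x v = 0 <-> exists c : 'cV[R]_m, v = B *m c.
Proof.
move=> x0.
have rk : \rank (kermx x) = m.
  rewrite mxrank_ker (_ : \rank x = 1%N) ?subn1//.
  by apply/eqP; rewrite eqn_leq rank_leq_col lt0n mxrank_eq0.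
have [B0 [rB eB]] : exists B0 : 'M[R]_(m, m.+1), \rank B0 = m /\ (B0 :=: kermx x)%MS.
  move: (row_base (kermx x)) (eq_row_base (kermx x)) => B0 eB.
  move: B0 eB; rewrite {1 2}rk => B0 eB; exists B0; split => //.
  by rewrite eB rk.
exists B0^T; split; first by rewrite mxrank_tr.
move=> v; have -> : dot x v = 0 <-> (v^T <= B0)%MS.
  rewrite eB; split.
    move=> xv; apply/sub_kermxP/matrixP => i j; rewrite !ord1 !mxE -{2}xv.
    by apply: eq_bigr => k _; rewrite mxE mulrC.
  move=> /sub_kermxP /matrixP /(_ 0 0); rewrite !mxE => <-.
  by apply: eq_bigr => k _; rewrite mxE mulrC.
split=> [/submxP[c vc]|[c ->]]; last by rewrite trmx_mul trmxK submxMl.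
by exists c^T; rewrite -trmx_mul -vc trmxK.
Qed.

(** Existence of some list is shown first, so that [xget] returns an admissible one. Any admissible
    [M] is then rho^-1 times the identity, as [B] has independent columns, and evaluating the
    characteristic polynomial at the i-th entry determines it. *)
Lemma principal_curvatures_eball rho x i : 0 < rho -> sphere rho x ->
  principal_curvatures (eball rho) x 0 i = rho^-1.
Proof.
move=> r0 xr.
have x0 : x != 0 by rewrite -enorm_eq0 xr gt_eqF.
have ex : exists k, is_principal_curvatures (eball rho) x k.
  have [B [rB xB]] := kernel_basis x0.
  exists (const_mx rho^-1), rho^-1%:M, B, rho^-1%:M; split => //.
  - move=> e e0; near=> y => byy.
    rewrite !normal_eball// -?bd_eball//.
    by rewrite -scalerBr mul_scalar_mx subrr enorm0 mulr_ge0 ?enorm_ge0// ltW.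
  - by move=> v; rewrite tangent_eball// xB.
  - by rewrite mul_scalar_mx mul_mx_scalar.
  - rewrite char_poly_trig; last exact: scalar_mx_is_trig.
    by apply: eq_bigr => j _; rewrite !mxE eqxx.
have /= [A [B [M [dA rB tB AB pM]]]] : is_principal_curvatures (eball rho) x (principal_curvatures (eball rho) x).
  exact: (xgetPex 0 ex).
have AB' : A *m B = rho^-1 *: B.
  apply/matrixP => a b; have : A *m (B *m delta_mx b (0 : 'I_1)) = rho^-1 *: (B *m delta_mx b (0 : 'I_1)).
    apply: (normal_diff_eball r0 xr dA); apply/(tangent_eball _ r0 xr)/tB.
    by exists (delta_mx b 0).
  by rewrite mulmxA scalemxAl -!colE => /matrixP /(_ a 0); rewrite !mxE.
have MB : M = rho^-1%:M.
  apply/trmx_inj; rewrite tr_scalar_mx.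
  have fB : row_free B^T by rewrite /row_free mxrank_tr rB.
  apply: (row_free_inj fB); rewrite /= -trmx_mul -AB AB' mul_scalar_mx.
  by rewrite linearZ.
have : ('X - (rho^-1)%:P) ^+ m = \prod_(j < m) ('X - (principal_curvatures (eball rho) x 0 j)%:P).
  rewrite -pM MB char_poly_trig; last exact: scalar_mx_is_trig.
  rewrite (eq_bigr (fun=> 'X - (rho^-1)%:P)); last by move=> j _; rewrite !mxE eqxx.
  by rewrite prodr_const card_ord.
set k := principal_curvatures _ _ => /(congr1 (horner^~ (k 0 i))).
rewrite [RHS]horner_prod (bigD1 i)//= !hornerE subrr mul0r => /eqP.
rewrite expf_eq0 => /andP[_]; by rewrite subr_eq0 => /eqP.
Unshelve. all: by end_near. Qed.

Lemma caratheodory_sphere n rho :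
  (hausdorff_outer n).-caratheodory (sphere rho : set 'cV[R]_m.+1).
Proof.
have -> : sphere rho = [set x : 'cV[R]_m.+1 | enorm x - rho <= 0] `&` [set x | rho - enorm x <= 0].
  apply/seteqP; split => x; rewrite /sphere /= !subr_le0; first by move=> ->; rewrite lexx.
  by move=> [h1 h2]; apply/eqP; rewrite eq_le h1.
apply: caratheodory_measurable_setI; apply: measurable_lipschitz_le0 => x y.
  by rewrite opprD addrACA subrr addr0 ler_enormB.
have -> : rho - enorm x - (rho - enorm y) = enorm y - enorm x by ring.
by rewrite distrC ler_enormB.
Qed.

Lemma intrinsic_volume_eball rho : 0 < rho ->
  intrinsic_volume_dm2 (eball rho) =
  (((2 * pi)^-1)%:E * ((m%:R / rho)%:E * hausdorff m (sphere rho : set 'cV[R]_m.+1)))%E.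
Proof.
move=> r0; rewrite /intrinsic_volume_dm2 bd_eball//; congr (_ * _)%E.
rewrite (eq_integral (fun=> (m%:R / rho)%:E)); last first.
  move=> x; rewrite inE => xr; congr (_%:E).
  rewrite (eq_bigr (fun=> rho^-1)); first by rewrite sumr_const card_ord mulr_natl.
  by move=> i _; exact: principal_curvatures_eball.
by rewrite integral_cst//; exact: (@caratheodory_sphere m rho).
Qed.

Lemma hausdorff_sphere_fin rho : 0 < rho ->
  exists2 h, 0 <= h & hausdorff m (sphere rho : set 'cV[R]_m.+1) = h%:E.
Proof.
move=> r0; have := hausdorff_sphere_lty (m := m) r0.
have := hausdorff_ge0 m (sphere rho : set 'cV[R]_m.+1).
by case: (hausdorff m _) => [h h0 _| |//]; [exists h|].
Qed.

(** A homothety bounds the measure of the smaller sphere by (rho / rho')^m times the larger one. One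
    factor is absorbed by the curvature, and the remaining power m - 1 is positive: this is where d
    >= 3 enters. Strictness also uses that the larger sphere has positive finite measure. *)
Lemma lt_intrinsic_volume_eball rho rho' : (2 <= m)%N -> 0 < rho -> rho < rho' ->
  (intrinsic_volume_dm2 (eball rho) < intrinsic_volume_dm2 (eball rho'))%E.
Proof.
move=> m2 r0 rr'; have r'0 := lt_trans r0 rr'.
rewrite !intrinsic_volume_eball//.
have t0 : 0 < rho / rho' by rewrite divr_gt0.
have : (hausdorff m (sphere rho : set 'cV[R]_m.+1) <= ((rho / rho') ^+ m)%:E * hausdorff m (sphere rho' : set 'cV[R]_m.+1))%E.
  have <- : ( *:%R (rho / rho')) @` sphere rho' = (sphere rho : set 'cV[R]_m.+1).
    apply/seteqP; split => [_ [x xr <-]|x xr].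
      by rewrite /sphere /= enormZ xr gtr0_norm// divfK ?gt_eqF.
    exists ((rho' / rho) *: x).
      by rewrite /sphere /= enormZ xr gtr0_norm ?divr_gt0// divfK ?gt_eqF.
    by rewrite scalerA mulrA divfK ?gt_eqF// divff ?gt_eqF// scale1r.
  by apply: hausdorff_lipschitz => // x y _ _; rewrite -scalerBr enormZ gtr0_norm.
have := @hausdorff_sphere_gt0 R m rho' (ltnW m2) r'0.
have [h h0 ->] := hausdorff_sphere_fin r0; have [h' h'0 ->] := hausdorff_sphere_fin r'0.
rewrite -!EFinM !lte_fin lee_fin => h'p hh'.
have p0 : 0 < (2 * pi)^-1 :> R by rewrite invr_gt0 mulr_gt0// pi_gt0.
rewrite ltr_pM2l// -!mulrA ltr_pM2l ?ltr0n ?(ltnW m2)//.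
apply: (@le_lt_trans _ _ (rho^-1 * ((rho / rho') ^+ m * h'))).
  by rewrite ler_pM2l ?invr_gt0.
rewrite mulrA ltr_pM2r//.
case: (m) m2 => [//|k] k1; rewrite exprS !mulrA mulVf ?gt_eqF// mul1r.
rewrite -[ltRHS]mulr1 ltr_pM2l ?invr_gt0//.
have k0 : k != 0%N by case: k k1.
have t1 : rho / rho' < 1 by rewrite ltr_pdivrMr// mul1r.
by rewrite exprn_ilt1 ?k0 ?(ltW t0).
Qed.

Lemma intrinsic_volume_eball_fin rho : 0 < rho -> intrinsic_volume_dm2 (eball rho) \is a fin_num.
Proof.
move=> r0; rewrite intrinsic_volume_eball//.
by have [h h0 ->] := hausdorff_sphere_fin r0; rewrite -!EFinM.
Qed.

End ball_curvature.

(** * C^{1,1} bump functions *)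

Section smooth_functions.
Context {R : realType} {d : nat}.
Implicit Types (chi psi : 'cV[R]_d -> R) (x y b : 'cV[R]_d) (M : R).

(** C^{1,1} regularity expressed by a candidate gradient [G] and a quadratic Taylor remainder, the
    form in which [lev_taylor] consumes it. *)
Definition C11 M chi := [/\ 0 <= M, forall x, 0 <= chi x <= 1 &
  exists G : 'cV[R]_d -> 'cV[R]_d, (forall x, enorm (G x) <= M) /\
    forall x y, `|chi y - chi x - dot (G x) (y - x)| <= M * dot (y - x) (y - x)].

Lemma C11_le M M' chi : M <= M' -> C11 M chi -> C11 M' chi.
Proof.
move=> MM' [M0 c01 [G [GM Gr]]]; split => //; first exact: le_trans MM'.
exists G; split=> [x|x y]; first exact: le_trans MM'.
by apply: le_trans (Gr x y) _; rewrite ler_wpM2r ?dot_ge0.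
Qed.

Lemma C11_cst (k : R) : 0 <= k <= 1 -> C11 0 (fun=> k).
Proof.
move=> k01; split => //; exists (fun=> 0); split=> [x|x y]; first by rewrite enorm0.
by rewrite dot0l subrr subr0 normr0 mul0r.
Qed.

Lemma C11_onem M chi : C11 M chi -> C11 M (fun x => 1 - chi x).
Proof.
move=> [M0 c01 [G [GM Gr]]]; split => //.
  by move=> x; have /andP[? ?] := c01 x; apply/andP; split; lra.
exists (fun x => - G x); split=> [x|x y]; first by rewrite enormN.
rewrite dotNl (_ : _ - _ - _ = - (chi y - chi x - dot (G x) (y - x))); last by ring.
by rewrite normrN.
Qed.

Lemma C11_near M chi x y : C11 M chi -> enorm (y - x) <= 1 ->
  `|chi y - chi x| <= 2 * M * enorm (y - x).
Proof.
move=> [M0 c01 [G [GM Gr]]] h1.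
have e0 := enorm_ge0 (y - x).
have -> : chi y - chi x = (chi y - chi x - dot (G x) (y - x)) + dot (G x) (y - x) by ring.
apply: le_trans (ler_normD _ _) _.
have h2 := Gr x y; have h3 := le_trans (cauchy_schwarz (G x) (y - x)) (ler_wpM2r e0 (GM x)).
have h4 : M * dot (y - x) (y - x) <= M * enorm (y - x).
  by rewrite ler_wpM2l// -sqr_enorm expr2 ler_piMl.
lra.
Qed.

(** The Taylor bound handles distances up to 1; beyond, the oscillation is at most 1, which explains
    the summand 1. *)
Lemma C11_lipschitz M chi x y : C11 M chi ->
  `|chi y - chi x| <= (2 * M + 1) * enorm (y - x).
Proof.
move=> cM; have [M0 c01 _] := cM.
have [h1|h1] := leP (enorm (y - x)) 1.
  apply: le_trans (C11_near cM h1) _; rewrite [leRHS]mulrDl mul1r lerDl; exact: enorm_ge0.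
have -> : (2 * M + 1) * enorm (y - x) = 2 * M * enorm (y - x) + enorm (y - x) by ring.
have := mulr_ge0 (mulr_ge0 (ler0n R 2) M0) (enorm_ge0 (y - x)).
have /andP[? ?] := c01 x; have /andP[? ?] := c01 y.
have : `|chi y - chi x| <= 1 by rewrite ler_norml; apply/andP; split; lra.
lra.
Qed.

Lemma C11_mul M1 M2 chi psi : C11 M1 chi -> C11 M2 psi ->
  exists M, C11 M (fun x => chi x * psi x).
Proof.
move=> c1 c2; have [M10 c01 [G1 [GM1 Gr1]]] := c1; have [M20 p01 [G2 [GM2 Gr2]]] := c2.
exists (M1 + M2 + (2 * M1 + 1) * M2); split.
- by rewrite addr_ge0 ?mulr_ge0 ?addr_ge0 ?mulr_ge0.
- move=> x; have /andP[? ?] := c01 x; have /andP[? ?] := p01 x.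
  by rewrite mulr_ge0//= mulr_ile1.
- exists (fun x => chi x *: G2 x + psi x *: G1 x); split.
    move=> x; have /andP[a0 a1] := c01 x; have /andP[b0 b1] := p01 x.
    apply: le_trans (enormD _ _) _; rewrite !enormZ !ger0_norm//.
    have h1 : chi x * enorm (G2 x) <= M2 by apply: le_trans (GM2 x); rewrite ler_piMl// enorm_ge0.
    have h2 : psi x * enorm (G1 x) <= M1 by apply: le_trans (GM1 x); rewrite ler_piMl// enorm_ge0.
    have h3 : 0 <= (2 * M1 + 1) * M2 by rewrite mulr_ge0 ?addr_ge0 ?mulr_ge0.
    lra.
  move=> x y /=; have := Gr1 x y; have := Gr2 x y; have := C11_lipschitz x y c1.
  move: (y - x) => h Lh Gr2xy Gr1xy; rewrite dotDl !dotZl.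
  set r1 := chi y - chi x - dot (G1 x) h in Gr1xy *; set r2 := psi y - psi x - dot (G2 x) h in Gr2xy *.
  (* Leibniz rule with remainder: the mixed term is quadratic in [h] because [chi] is Lipschitz. *)
  have -> : chi y * psi y - chi x * psi x - (chi x * dot (G2 x) h + psi x * dot (G1 x) h) =
     chi y * r2 + (chi y - chi x) * dot (G2 x) h + psi x * r1 by rewrite /r1 /r2; ring.
  have /andP[a0 a1] := c01 y; have /andP[b0 b1] := p01 x.
  apply: le_trans (ler_normD _ _) _.
  have hh := dot_ge0 h.
  have n1 : `|psi x * r1| <= M1 * dot h h.
    rewrite normrM ger0_norm//; apply: le_trans Gr1xy; by rewrite ler_piMl.
  have n2 : `|chi y * r2| <= M2 * dot h h.
    rewrite normrM ger0_norm//; apply: le_trans Gr2xy; by rewrite ler_piMl.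
  have n3 : `|(chi y - chi x) * dot (G2 x) h| <= (2 * M1 + 1) * M2 * dot h h.
    rewrite normrM -sqr_enorm expr2 mulrACA; apply: ler_pM => //.
    by apply: le_trans (cauchy_schwarz _ _) _; rewrite ler_wpM2r ?enorm_ge0.
  have n4 := ler_normD (chi y * r2) ((chi y - chi x) * dot (G2 x) h).
  lra.
Qed.

Lemma C11_prod (I : Type) (s : seq I) (f : I -> 'cV[R]_d -> R) :
  (forall i, exists M, C11 M (f i)) -> exists M, C11 M (fun x => \prod_(i <- s) f i x).
Proof.
move=> fM; elim: s => [|i s [M IH]].
  exists 0; have -> : (fun x => \prod_(i <- [::]) f i x) = (fun=> 1).
    by apply/funext => x; rewrite big_nil.
  by apply: C11_cst; rewrite ler01 lexx.
have [M' fi] := fM i; have [M'' h] := C11_mul fi IH; exists M''.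
have -> : (fun x => \prod_(i <- i :: s) f i x) = (fun x => f i x * \prod_(i <- s) f i x) => //.
by apply/funext => x; rewrite big_cons.
Qed.

Definition pos (t : R) : R := Num.max 0 t.

Lemma pos_cases t : (0 <= t /\ pos t = t) \/ (t <= 0 /\ pos t = 0).
Proof. by rewrite /pos; case: (leP 0 t) => h; [left|right; split => //; exact: ltW]. Qed.

(* The integral of the quadratic B-spline kernel: a C^{1,1} step from 0 to 1. *)
Definition step (t : R) : R :=
  2 * (pos t ^+ 2 - 2 * pos (t - 2^-1) ^+ 2 + pos (t - 1) ^+ 2).

Definition dstep (t : R) : R := 4 * (pos t - 2 * pos (t - 2^-1) + pos (t - 1)).

Lemma step_le0 t : t <= 0 -> step t = 0.
Proof.
rewrite /step; case: (pos_cases t) => -[? ->]; case: (pos_cases (t - 2^-1)) => -[? ->];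
case: (pos_cases (t - 1)) => -[? ->] => h; nra.
Qed.

Lemma step_ge1 t : 1 <= t -> step t = 1.
Proof.
rewrite /step; case: (pos_cases t) => -[? ->]; case: (pos_cases (t - 2^-1)) => -[? ->];
case: (pos_cases (t - 1)) => -[? ->] => h; try lra; try (by field); have -> : t = 1 by lra.
by field.
Qed.

Lemma step01 t : 0 <= step t <= 1.
Proof.
rewrite /step; case: (pos_cases t) => -[? ->]; case: (pos_cases (t - 2^-1)) => -[? ->];
case: (pos_cases (t - 1)) => -[? ->]; apply/andP; split; nra.
Qed.

Lemma dstep_bound t : `|dstep t| <= 2.
Proof.
rewrite /dstep ler_norml; case: (pos_cases t) => -[? ->]; case: (pos_cases (t - 2^-1)) => -[? ->];
case: (pos_cases (t - 1)) => -[? ->]; apply/andP; split; lra.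
Qed.

Lemma pos_sqr_remainder u v : `|pos v ^+ 2 - pos u ^+ 2 - 2 * pos u * (v - u)| <= (v - u) ^+ 2.
Proof.
have h1 := sqr_ge0 (v - u); have h2 := sqr_ge0 u; have h3 := sqr_ge0 v.
case: (pos_cases u) => -[u0 ->]; case: (pos_cases v) => -[v0 ->]; rewrite ler_norml.
- by apply/andP; split; lra.
- have uv : 0 <= u * - v by rewrite mulr_ge0// oppr_ge0.
  by apply/andP; split; lra.
- have uv : 0 <= v * - u by rewrite mulr_ge0// oppr_ge0.
  by apply/andP; split; lra.
- by apply/andP; split; lra.
Qed.

(** The constant is 2 (1 + 2 + 1), from the absolute coefficients of the three truncated squares. *)
Lemma step_remainder u v : `|step v - step u - dstep u * (v - u)| <= 8 * (v - u) ^+ 2.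
Proof.
have h0 := pos_sqr_remainder u v.
have h1 := pos_sqr_remainder (u - 2^-1) (v - 2^-1).
have h2 := pos_sqr_remainder (u - 1) (v - 1).
move: h0 h1 h2; rewrite !opprB !addrA !subrK !ler_norml /step /dstep.
move=> /andP[? ?] /andP[? ?] /andP[? ?]; apply/andP; split; lra.
Qed.

Lemma C11_step (i : 'I_d) (a k : R) : exists M, C11 M (fun x => step (a * x i 0 + k)).
Proof.
exists (2 * `|a| + 8 * a ^+ 2); split.
- apply: addr_ge0; [exact: mulr_ge0|apply: mulr_ge0 => //; exact: sqr_ge0].
- by move=> x; exact: step01.
have dd x : dot (delta_mx i 0) x = x i 0.
  rewrite /dot (bigD1 i)//= mxE !eqxx mul1r big1 ?addr0// => j ji.
  by rewrite mxE (negbTE ji) mul0r.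
have de : enorm (delta_mx i 0 : 'cV[R]_d) = 1.
  by rewrite /enorm dd mxE !eqxx sqrtr1.
exists (fun x => (dstep (a * x i 0 + k) * a) *: delta_mx i 0); split=> [x|x y].
  rewrite enormZ de mulr1 normrM.
  apply: (@le_trans _ _ (2 * `|a|)); first by rewrite ler_wpM2r// dstep_bound.
  by rewrite lerDl mulr_ge0// sqr_ge0.
rewrite dotZl dd -mulrA.
have -> : a * (y - x) i 0 = (a * y i 0 + k) - (a * x i 0 + k) by rewrite !mxE; ring.
apply: le_trans (step_remainder _ _) _.
have -> : (a * y i 0 + k - (a * x i 0 + k)) ^+ 2 = a ^+ 2 * ((y - x) i 0) ^+ 2 by rewrite !mxE; ring.
rewrite mulrA; apply: ler_pM.
- by apply: mulr_ge0 => //; exact: sqr_ge0.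
- exact: sqr_ge0.
- by rewrite lerDr; exact: mulr_ge0.
- rewrite -sqr_enorm -real_normK ?num_real// ler_sqr ?nnegrE ?enorm_ge0//.
  exact: coord_le_enorm.
Qed.

(** The shift 2 gives a plateau of height 1 on the cube of half-side [eta] about [b] and the value 0
    outside the cube of half-side [2 * eta]. *)
Definition cube_bump (eta : R) b x : R :=
  \prod_(i < d) (step (2 + (x i 0 - b i 0) / eta) * step (2 - (x i 0 - b i 0) / eta)).

Lemma C11_cube_bump eta b : exists M, C11 M (cube_bump eta b).
Proof.
apply: C11_prod => i.
have [M1 h1] := C11_step i eta^-1 (2 - b i 0 / eta).
have [M2 h2] := C11_step i (- eta^-1) (2 + b i 0 / eta).
have [M h] := C11_mul h1 h2; exists M.
rewrite (_ : (fun x => _) = (fun x => step (eta^-1 * x i 0 + (2 - b i 0 / eta)) *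
  step (- eta^-1 * x i 0 + (2 + b i 0 / eta))))//.
by apply/funext => x; congr (step _ * step _); ring.
Qed.

Lemma cube_bump_eq1 eta b x : 0 < eta -> (forall i, `|x i 0 - b i 0| <= eta) -> cube_bump eta b x = 1.
Proof.
move=> e0 h; rewrite /cube_bump big1// => i _.
have := h i; rewrite ler_norml => /andP[h1 h2].
have t1 : -1 <= (x i 0 - b i 0) / eta by rewrite ler_pdivlMr//; lra.
have t2 : (x i 0 - b i 0) / eta <= 1 by rewrite ler_pdivrMr//; lra.
by rewrite !step_ge1 ?mulr1//; lra.
Qed.

Lemma cube_bump_eq0 eta b x i : 0 < eta -> 2 * eta <= `|x i 0 - b i 0| -> cube_bump eta b x = 0.
Proof.
move=> e0 h; rewrite /cube_bump (bigD1 i)//=.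
suff -> : step (2 + (x i 0 - b i 0) / eta) * step (2 - (x i 0 - b i 0) / eta) = 0 by rewrite mul0r.
move: h; rewrite ler_normr => /orP[h|h].
  have t1 : 2 <= (x i 0 - b i 0) / eta by rewrite ler_pdivlMr.
  by rewrite [X in _ * X]step_le0 ?mulr0//; lra.
have t1 : (x i 0 - b i 0) / eta <= -2 by rewrite ler_pdivrMr//; lra.
by rewrite step_le0 ?mul0r//; lra.
Qed.

(** One minus the product of the complements of the bumps. In contrast to a sum it stays in [0, 1],
    and a further bump changes it only where that bump is nonzero. *)
Fixpoint cube_bumps (eta : R) (s : seq 'cV[R]_d) x : R :=
  if s is b :: s' then 1 - (1 - cube_bump eta b x) * (1 - cube_bumps eta s' x) else 0.

Lemma C11_cube_bumps eta s : exists M, C11 M (cube_bumps eta s).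
Proof.
elim: s => [|b s [M IH]]; first by exists 0; apply: C11_cst; rewrite lexx ler01.
have [M' hb] := C11_cube_bump eta b.
have [M'' h] := C11_mul (C11_onem hb) (C11_onem IH).
by exists M''; exact: C11_onem h.
Qed.

(** A single constant for all stages of the chain, so that one [eps] serves every step. *)
Lemma C11_cube_bumps_drop eta s : exists M, forall k, C11 M (cube_bumps eta (drop k s)).
Proof.
elim: s => [|b s [M IH]].
  by exists 0 => k; rewrite drop_oversize//; apply: C11_cst; rewrite lexx ler01.
have [M' h] := C11_cube_bumps eta (b :: s).
exists (Num.max M M') => -[|k].
  by rewrite drop0; apply: C11_le h; rewrite le_max lexx orbT.
by apply: C11_le (IH k); rewrite le_max lexx.
Qed.

Lemma cube_bump01 eta b x : 0 <= cube_bump eta b x <= 1.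
Proof. by have [M []] := C11_cube_bump eta b. Qed.

Lemma cube_bumps01 eta s x : 0 <= cube_bumps eta s x <= 1.
Proof. by have [M []] := C11_cube_bumps eta s. Qed.

Lemma le_cube_bumps_cons eta b s x : cube_bumps eta s x <= cube_bumps eta (b :: s) x.
Proof.
rewrite /=; have /andP[? ?] := cube_bump01 eta b x; have /andP[? ?] := cube_bumps01 eta s x; nra.
Qed.

Lemma cube_bumps_mem1 eta b s x : b \in s -> cube_bump eta b x = 1 -> cube_bumps eta s x = 1.
Proof.
move=> + b1; elim: s => // b' s IH; rewrite inE => /orP[/eqP <-|/IH h] /=.
  by rewrite b1 subrr mul0r subr0.
by rewrite h subrr mulr0 subr0.
Qed.

End smooth_functions.

(** * Perturbed balls *)

Section level_sets.
Context {R : realType} {d : nat}.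
Implicit Types (chi : 'cV[R]_d -> R) (x y n : 'cV[R]_d) (X : set 'cV[R]_d).

(** A ball whose squared radius is perturbed; the defining function is then a quadratic polynomial
    minus [eps * chi]. *)
Definition lev (rho eps : R) chi : set 'cV[R]_d :=
  [set x | dot x x <= rho ^+ 2 + eps * chi x].

Lemma compact_closed_ebounded X K : closed X -> (forall x, X x -> enorm x <= K) -> compact X.
Proof.
move=> cX XK.
have -> : X = trmx @` [set v : 'rV[R]_d | X v^T].
  apply/seteqP; split => [x Xx|_ [v Xv <-]//].
  by exists x^T; [rewrite /= trmxK|rewrite trmxK].
have ctr : continuous (trmx : 'rV[R]_d -> 'cV[R]_d).
  move=> v A /nbhs_ballP[e e0 eA]; apply/nbhs_ballP; exists e => // w [_ vw].
  by apply: eA; split => // i j; rewrite !mxE.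
apply: continuous_compact; first exact/continuous_subspaceT.
apply: bounded_closed_compact.
  exists K; split; first exact: num_real.
  move=> k Kk v /= Xv.
  have vk : enorm v^T <= k by apply: le_trans (XK _ Xv) (ltW Kk).
  change (mx_norm v <= k); have [->|/mx_norm_neq0[[i j] ->]] := eqVneq (mx_norm v) 0.
    exact: le_trans (enorm_ge0 _) vk.
  by apply: le_trans vk; have := coord_le_enorm v^T j; rewrite mxE ord1.
exact: (closed_comp (fun v _ => ctr v) cX).
Qed.

Variables (M r rho eps : R) (chi : 'cV[R]_d -> R).
Hypotheses (cM : C11 M chi) (r0 : 0 < r) (rho2 : rho = 2 * r) (e0 : 0 <= eps).
Hypothesis eM : eps * M * (1 + 2 * r) <= r.

Let F x := dot x x - rho ^+ 2 - eps * chi x.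

Let M0 : 0 <= M. Proof. by case: cM. Qed.

Let eM1 : eps * M <= 1 / 2.
Proof.
have h : eps * M * (2 * r) <= r.
  by apply: le_trans eM; rewrite ler_wpM2l ?mulr_ge0// lerDr.
have r2 : 0 < 2 * r by rewrite mulr_gt0.
rewrite -(ler_pM2r r2); lra.
Qed.

Let levF x : lev rho eps chi x <-> F x <= 0.
Proof. by rewrite /lev /F /=; split; lra. Qed.

Lemma lev_taylor x : exists2 N : 'cV[R]_d, 2 * enorm x - eps * M <= enorm N &
  forall y, `|F y - F x - dot N (y - x) - dot (y - x) (y - x)| <= eps * M * dot (y - x) (y - x).
Proof.
have [_ _ [G [GM Gr]]] := cM; exists (2 *: x - eps *: G x).
  have -> : 2 * enorm x = enorm (2 *: x) by rewrite enormZ ger0_norm.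
  have := enormD (2 *: x - eps *: G x) (eps *: G x); rewrite subrK.
  rewrite [X in _ + X]enormZ (ger0_norm e0); have := ler_wpM2l e0 (GM x); lra.
have sqD h : dot (x + h) (x + h) = dot x x + 2 * dot x h + dot h h.
  by rewrite !dotE (dotC h x); ring.
move=> y; have := Gr x y; have := sqD (y - x); rewrite (addrC x) subrK /F => ->.
move: (y - x) => h hG; rewrite dotDl dotNl !dotZl.
rewrite (_ : _ - _ = - (eps * (chi y - chi x - dot (G x) h))); last by ring.
by rewrite normrN normrM (ger0_norm e0) -mulrA ler_wpM2l.
Qed.

Lemma lev_continuous x e : 0 < e -> exists2 k, 0 < k &
  forall y, enorm (y - x) < k -> `|F y - F x| < e.
Proof.
move=> e'0; have [N _ hN] := lev_taylor x.
have K0 : 0 < enorm N + 2 by rewrite ltr_wpDl// enorm_ge0.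
exists (Num.min 1 (e / (enorm N + 2))); first by rewrite lt_min ltr01 divr_gt0.
move=> y; rewrite lt_min => /andP[h1]; rewrite ltr_pdivlMr// => h2.
apply: le_lt_trans h2; have := hN y; move: (y - x) h1 => h h1 hF.
have hh : dot h h <= enorm h.
  by rewrite -sqr_enorm expr2 ler_piMl ?enorm_ge0// ltW.
have hN' := cauchy_schwarz N h.
have := enorm_ge0 h; have := dot_ge0 h.
have := ler_wpM2r (dot_ge0 h) eM1.
move: hF hN'; rewrite mulrDr (mulrC (enorm h)) !ler_norml => /andP[? ?] /andP[? ?] *.
apply/andP; split; lra.
Qed.

Lemma closed_lev : closed (lev rho eps chi).
Proof.
move=> x /closure_enormP cl; apply/levF/ler_addgt0Pl => e e'0; rewrite addr0.
have [k k0 kF] := lev_continuous x e'0; have [y /levF Fy yx] := cl k k0.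
have := kF y yx; rewrite ltr_norml => /andP[? ?]; lra.
Qed.

Lemma ebounded_lev x : lev rho eps chi x -> enorm x <= rho + eps + 1.
Proof.
have [_ /(_ x)/andP[c0 c1] _] := cM; have p0 : 0 < rho by rewrite rho2 mulr_gt0.
rewrite /lev /= enorm_le ?addr_ge0 ?(ltW p0)// => /le_trans; apply.
have h1 : eps * chi x <= eps by rewrite ler_piMr.
have h2 := mulr_ge0 (ltW p0) e0; have e0' := e0; have h3 := sqr_ge0 eps.
lra.
Qed.

Lemma bd_lev x : bd (lev rho eps chi) x -> F x = 0.
Proof.
move=> [/closed_lev /levF Fx nI]; apply/eqP; rewrite eq_le Fx leNgt; apply/negP => Fx0.
apply: nI; apply/interior_enormP; have [|k k0 kF] := @lev_continuous x (- F x); first by rewrite oppr_gt0.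
exists k => // y /kF; rewrite ltr_norml => /andP[? ?]; apply/levF; lra.
Qed.

(** At a boundary point the gradient [N] has length at least 4r - eps M, which by [eM] is at least
    2r (1 + eps M), while the second-order part of [F] is |v|^2 up to eps M |v|^2. On the balls of
    radius [r] touching at [x] the first-order term therefore decides the sign of [F]. *)
Lemma r_regular_lev : r_regular r (lev rho eps chi).
Proof.
split; first exact: closed_lev.
move=> x /bd_lev Fx0; have [N hN1 hN] := lev_taylor x.
have [_ /(_ x)/andP[c0 c1] _] := cM.
have xrho : rho <= enorm x.
  rewrite leNgt enorm_lt ?rho2 ?mulr_ge0 ?ltW//; apply/negP => h.
  by have := mulr_ge0 e0 c0; move: Fx0 h; rewrite /F rho2; lra.
have em0 : 0 <= 1 + eps * M by exact/addr_ge0/mulr_ge0.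
have NN : 2 * r * (1 + eps * M) <= enorm N.
  have eM' : eps * M + eps * M * (2 * r) <= r by rewrite -[X in X + _]mulr1 -mulrDr.
  rewrite (_ : 2 * r * (1 + eps * M) = 2 * r + eps * M * (2 * r)); last by ring.
  by move: hN1 xrho r0; rewrite rho2; lra.
have N0 : 0 < enorm N.
  by apply: lt_le_trans NN; rewrite mulr_gt0 ?mulr_gt0// ltr_wpDr// mulr_ge0.
pose n := (enorm N)^-1 *: N.
have n1 : enorm n = 1 by rewrite enormZ gtr0_norm ?invr_gt0// mulVf// gt_eqF.
have nn : dot n n = 1 by rewrite -sqr_enorm n1 expr1n.
have Nn : N = enorm N *: n by rewrite scalerA mulfV ?gt_eqF// scale1r.
clearbody n.
exists (x - r *: n), (x + r *: n); split.
- by rewrite /ecball /= opprB addrC subrK enormZ n1 mulr1 gtr0_norm.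
- by rewrite /ecball /= opprD addNKr enormN enormZ n1 mulr1 gtr0_norm.
- move=> y; rewrite /ecball /= enorm_le ?(ltW r0)// => h; apply/levF.
  have := hN y; rewrite Fx0 Nn dotZl.
  have yx : y - (x - r *: n) = (y - x) + r *: n by rewrite opprB addrA addrAC.
  move: h; rewrite yx; move: (y - x) => v; rewrite !dotE (dotC v n) nn ler_norml => h /andP[_ h2].
  have vv := dot_ge0 v.
  have h' : 0 <= - (2 * r * dot n v) - dot v v by lra.
  have nv : 0 <= - dot n v by rewrite -(pmulr_rge0 _ (mulr_gt0 (ltr0n R 2) r0)); lra.
  have : enorm N * dot n v <= - (1 + eps * M) * dot v v.
    have h3 := ler_wpM2r nv NN.
    have h4 : 0 <= (1 + eps * M) * (- (2 * r * dot n v) - dot v v).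
      exact: mulr_ge0 em0 h'.
    lra.
  lra.
- move=> y yI; apply: contraPnot yI => /levF Fy.
  (* The point [x] itself satisfies [F x = 0] but lies on the outer sphere; elsewhere in the outer
     ball [F] is positive. *)
  have [->|yx0] := eqVneq y x.
    move=> /interior_enormP[k k0 kB].
    have : ecball (x + r *: n) r (x - (k / 2) *: n).
      apply: kB; rewrite addrAC subrr add0r enormN enormZ n1 mulr1 gtr0_norm ?divr_gt0//.
      by rewrite ltr_pdivrMr// mulr_natr mulr2n ltrDl.
    rewrite /ecball /= opprD addrACA subrr add0r -opprD -scalerDl enormN enormZ n1 mulr1.
    by rewrite gtr0_norm ?addr_gt0 ?divr_gt0// gerDr leNgt divr_gt0.
  move=> /interior_subset; rewrite /ecball /= enorm_le ?(ltW r0)// => h.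
  have := hN y; rewrite Fx0 Nn dotZl.
  have yx : y - (x + r *: n) = (y - x) - r *: n by rewrite opprD addrA.
  have vp : 0 < dot (y - x) (y - x) by rewrite lt_def dot_eq0 subr_eq0 yx0 dot_ge0.
  move: h vp; rewrite yx; move: (y - x) => v; rewrite !dotE (dotC v n) nn ler_norml => h vp /andP[h2 _].
  have h' : 0 <= 2 * r * dot n v - dot v v by lra.
  have nv : 0 <= dot n v by rewrite -(pmulr_rge0 _ (mulr_gt0 (ltr0n R 2) r0)); lra.
  have h3 := ler_wpM2r nv NN.
  have h4 : 0 <= (1 + eps * M) * (2 * r * dot n v - dot v v).
    exact: mulr_ge0 em0 h'.
  lra.
Qed.

End level_sets.

(** * The local modification of the estimator *)

Section householder.
Context {R : realType} {d : nat}.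
Implicit Types (p q w : 'cV[R]_d).

Lemma tr_dot p q : p^T *m q = (dot p q)%:M.
Proof.
apply/matrixP => i j; rewrite !ord1 !mxE eqxx mulr1n.
by apply: eq_bigr => k _; rewrite !mxE.
Qed.

(** The reflection in the hyperplane orthogonal to [p - q]. *)
Lemma householder p q : dot p p = dot q q ->
  exists g : 'M[R]_d, [/\ g^T = g, g *m g = 1%:M & g *m p = q].
Proof.
move=> pq; have [->|neq] := eqVneq p q.
  by exists 1%:M; rewrite trmx1 !mul1mx.
pose w := p - q; pose k := 2 / dot w w.
have ww : dot w w != 0 by rewrite dot_eq0 subr_eq0.
exists (1%:M - k *: (w *m w^T)); split.
- by rewrite linearB /= linearZ /= trmx1 trmx_mul trmxK.
- rewrite mulmxBl mul1mx mulmxBr mulmx1 -scalemxAl -scalemxAr.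
  rewrite -mulmxA (mulmxA w^T) tr_dot mul_scalar_mx -scalemxAr.
  rewrite !scalerA; have -> : k * (k * dot w w) = k + k by rewrite /k; field.
  by move: (w *m w^T) => P; apply/matrixP => i j; rewrite !mxE; ring.
- rewrite mulmxBl mul1mx -scalemxAl -mulmxA tr_dot mul_mx_scalar scalerA.
  have -> : k * dot w p = 1.
    have : dot w w = 2 * dot w p by rewrite /w !dotE (dotC q p) -pq; ring.
    by rewrite /k => h; rewrite mulrAC -h mulfV.
  by rewrite scale1r /w opprB addrC subrK.
Qed.

End householder.

Section integral_monotone.
Context {R : realType} {D : measure_display} {T : measurableType D}.
Variable mu : {measure set T -> \bar R}.
Local Open Scope ereal_scope.

(* No measurability is needed: the integral is a difference of lower integrals. *)
Lemma le_integralT (f f' : T -> \bar R) : (forall x, f x <= f' x) ->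
  \int[mu]_x f x <= \int[mu]_x f' x.
Proof.
move=> ff'.
have ge0_le (h h' : T -> \bar R) : (forall x, 0 <= h x) -> (forall x, h x <= h' x) ->
    \int[mu]_x h x <= \int[mu]_x h' x.
  move=> h0 hh'; rewrite !ge0_integralTE//; last by move=> x; exact: le_trans (hh' x).
  apply: le_ereal_sup => _ [s /= sh <-]; exists s => // x; exact: le_trans (hh' x).
rewrite integralE [leRHS]integralE; apply: leeB; apply: ge0_le => x.
- exact: funepos_ge0.
- by rewrite !funeposE; apply: le_max2 => //.
- exact: funeneg_ge0.
- by rewrite !funenegE; apply: le_max2 => //; rewrite leeN2.
Qed.

End integral_monotone.

Section local_step.
Context {R : realType} {d : nat}.
Variable Q : 'M[R]_d.
Hypothesis QQ : Q *m Q^T = 1%:M.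
Implicit Types (chi : 'cV[R]_d -> R) (x y b c v : 'cV[R]_d) (e : 'cV[bool]_d).

(** In this direction the vertices of the unit cell have distinct integer heights, so any two
    heights differ by at least 1. *)
Definition binary_vector : 'cV[R]_d := \col_i (2 ^ i)%:R.

Lemma dot_binary_vector e : dot (toR (vert e)) binary_vector = (vidx e)%:R.
Proof.
rewrite /dot /vidx natr_sum; apply: eq_bigr => i _; rewrite !mxE natrM mulrC.
by case: (e i 0).
Qed.

Lemma enorm_edge e e' : enorm (Q *m (toR (vert e') - toR (vert e))) <= Num.sqrt d%:R :> R.
Proof.
rewrite enorm_orth// -[leRHS]mulr1; apply: enorm_le_coord => // i.
by rewrite !mxE; case: (e i 0); case: (e' i 0); rewrite ?subrr ?subr0 ?sub0r ?normrN ?normr0 ?normr1.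
Qed.

Lemma dot_edge e e' : (vidx e < vidx e')%N ->
  1 <= dot (Q *m (toR (vert e') - toR (vert e))) (Q *m binary_vector).
Proof.
move=> ee'; rewrite dot_orth// dotDl dotNl !dot_binary_vector lerBrDr.
by rewrite addrC natr1 ler_nat.
Qed.

Variables (M rho eps delta : R) (b : 'cV[R]_d) (g : 'M[R]_d).
Let D : R := Num.sqrt d%:R.
Let mu := enorm binary_vector.
Hypotheses (gT : g^T = g) (gg : g *m g = 1%:M).
Hypothesis gb : g *m b = (enorm b / mu) *: (Q *m binary_vector).
Hypotheses (rho0 : 0 < rho) (e0 : 0 <= eps) (mu0 : 0 < mu).
Hypothesis b_large : rho / 2 <= enorm b.
Hypothesis small : 2 * delta * D + 2 * eps * M * D <= rho / (2 * mu).

(** Stepping to a lower vertex moves against the normal: the squared norm drops by 2a <y, v> - a^2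
    |v|^2, where <y, v> is at least rho / (2 mu) minus the location error (delta + a D) D. The drop
    outweighs the change 2 eps M a D of the bump term: [small] pays for the terms in [delta] and
    [eps], and the bound on 3 a D^2 pays for the two terms quadratic in [a]. *)
Lemma lev_monotone chi a y e e' : C11 M chi -> 0 < a -> a * D <= 1 ->
  3 * a * D ^+ 2 <= rho / (2 * mu) ->
  enorm (y - g *m b) <= delta + a * D -> (vidx e < vidx e')%N ->
  premul g (lev rho eps chi) y ->
  premul g (lev rho eps chi) (y - a *: (Q *m (toR (vert e') - toR (vert e)))).
Proof.
move=> cM a0 aD1 aD yb ee'.
have vD := enorm_edge e e'; have v1 := dot_edge ee'.
move: (Q *m (toR (vert e') - toR (vert e))) vD v1 => v vD v1.
have D0 : 0 <= D by exact: sqrtr_ge0.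
have M0 : 0 <= M by case: cM.
have rmu : rho / (2 * mu) = rho / 2 / mu by rewrite invfM mulrA.
have yv : rho / 2 / mu - (delta + a * D) * D <= dot y v.
  have -> : dot y v = dot (g *m b) v + dot (y - g *m b) v by rewrite !dotE; ring.
  have h1 : rho / 2 / mu <= dot (g *m b) v.
    rewrite gb dotZl dotC -[leLHS]mulr1; apply: ler_pM => //.
      by rewrite !divr_ge0// ltW.
    by rewrite ler_pM2r ?invr_gt0.
  have h2 : - ((delta + a * D) * D) <= dot (y - g *m b) v.
    have : `|dot (y - g *m b) v| <= (delta + a * D) * D.
      apply: le_trans (cauchy_schwarz _ _) _; apply: ler_pM => //; exact: enorm_ge0.
    by rewrite ler_norml => /andP[].
  lra.
rewrite /premul /lev /= mulmxBr -scalemxAr.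
have gorth : g *m g^T = 1%:M by rewrite gT.
have gyv : dot (g *m y) (g *m v) = dot y v by rewrite dot_orth.
have gvv : dot (g *m v) (g *m v) <= D ^+ 2 by rewrite dot_orth// -enorm_le.
have gvD : enorm (g *m v) <= D by rewrite enorm_orth.
move: (g *m y) (g *m v) gyv gvv gvD => x u xu uu uD hx.
have aM : `|chi (x - a *: u) - chi x| <= 2 * M * (a * D).
  have xx : x - a *: u - x = - (a *: u) by rewrite addrAC subrr add0r.
  have au : enorm (a *: u) <= a * D by rewrite enormZ gtr0_norm// ler_pM2l.
  apply: le_trans (C11_near cM _) _; rewrite xx enormN; first exact: le_trans au _.
  by rewrite ler_wpM2l ?mulr_ge0.
have xau : dot (x - a *: u) (x - a *: u) = dot x x - 2 * a * dot y v + a ^+ 2 * dot u u.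
  by rewrite !dotE (dotC u x) xu; ring.
rewrite xau; move: aM; rewrite ler_norml => /andP[aM _].
have h1 : a ^+ 2 * dot u u <= a ^+ 2 * D ^+ 2 by rewrite ler_wpM2l// sqr_ge0.
have h2 := ler_wpM2l e0 aM.
have h3 : a * (rho / 2 / mu - (delta + a * D) * D) <= a * dot y v by rewrite ler_wpM2l// ltW.
have h4 : a * (2 * delta * D + 2 * eps * M * D) <= a * (rho / 2 / mu) by rewrite -rmu ler_wpM2l// ltW.
have h5 : a * (3 * a * D ^+ 2) <= a * (rho / 2 / mu) by rewrite -rmu ler_wpM2l// ltW.
lra.
Qed.

Variables chi chi' : 'cV[R]_d -> R.
Hypotheses (cM : C11 M chi) (cM' : C11 M chi').
Hypothesis chi_far : forall x, delta <= enorm (x - b) -> chi x = chi' x.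
Let Y := premul g (lev rho eps chi).
Let Y' := premul g (lev rho eps chi').
Hypotheses (bY : ebounded Y) (bY' : ebounded Y').

Lemma estimator_local_step (w : nat -> R) a c : 0 < a -> a * D <= 1 ->
  3 * a * D ^+ 2 <= rho / (2 * mu) ->
  estimator w Y' a Q c = estimator w Y a Q c + a ^+ (d - 2) * full_weight (d := d) w *
    ((ncard (occupied Y' a Q c))%:R - (ncard (occupied Y a Q c))%:R).
Proof.
move=> a0 aD1 aD.
have gorth : g *m g^T = 1%:M by rewrite gT.
(* One vertex within [delta] of [g *m b] suffices, so that a cell outside [near] sees no
   modification at any vertex; all vertices of a near cell are within [delta + a * D]. *)
pose near : set 'cV[int]_d := [set u | exists e, enorm (lattice_point a Q c (u + vert e) - g *m b) < delta].
have ptB u e e' : lattice_point a Q c (u + vert e') - lattice_point a Q c (u + vert e) =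
    a *: (Q *m (toR (vert e') - toR (vert e))).
  by rewrite /lattice_point -scalerBr -mulmxBr !toRD; congr (_ *: (_ *m _)); apply/matrixP => i j; rewrite !mxE; ring.
have nearD u e : near u -> enorm (lattice_point a Q c (u + vert e) - g *m b) <= delta + a * D.
  move=> [e1 h]; apply: le_trans (enorm_distD (lattice_point a Q c (u + vert e1)) _ _) _.
  rewrite addrC lerD ?(ltW h)// ptB enormZ gtr0_norm// ler_pM2l//.
  exact: enorm_edge.
have mono chi0 : C11 M chi0 -> monotone_near vert vidx near (occupied (premul g (lev rho eps chi0)) a Q c).
  move=> c0 u e e' nu ee'; rewrite /occupied /=.
  have -> : lattice_point a Q c (u + vert e) = lattice_point a Q c (u + vert e') - a *: (Q *m (toR (vert e') - toR (vert e))).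
    by rewrite -(ptB u e e') subKr.
  exact: (lev_monotone c0 a0 aD1 aD (nearD u e' nu) ee').
apply: (@estimator_local_modification _ _ near) => //.
- by rewrite gt_eqF.
- move=> u e nu; rewrite /Y /Y' /premul /lev /=.
  rewrite chi_far// -(enorm_orth _ gorth) mulmxBr mulmxA gg mul1mx leNgt.
  by apply/negP => h; apply: nu; exists e.
- exact: mono.
- exact: mono.
Qed.

End local_step.

(** * Measurability of the estimator *)

Section measurable_estimator.
Context {R : realType} {d : nat}.
Variables (Q : 'M[R]_d) (a rho : R).
Hypotheses (QQ : Q *m Q^T = 1%:M) (a0 : 0 < a) (rho0 : 0 <= rho).
Implicit Types (t : d.-tuple (measurableTypeR R)) (u : 'cV[int]_d) (e : 'cV[bool]_d).

Let B : set 'cV[R]_d := ecball 0 rho.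

Let occB t := occupied B a Q (cube_point t).

Let coord2 t u := a ^+ 2 * \sum_i (toR u i 0 + tnth t i) ^+ 2.

Let occBE t u : occB t u <-> coord2 t u <= rho ^+ 2.
Proof.
rewrite /occB /occupied /B /ecball /= subr0 enorm_le// /lattice_point dotZl dotZr mulrA -expr2 dot_orth//.
rewrite (_ : dot _ _ = \sum_i (toR u i 0 + tnth t i) ^+ 2)//.
by apply: eq_bigr => i _; rewrite !mxE expr2.
Qed.

Let measurable_occB u : measurable [set t | occB t u].
Proof.
have -> : [set t | occB t u] = (coord2 ^~ u) @^-1` `]-oo, rho ^+ 2].
  by apply/seteqP; split => t /=; rewrite in_itv /=; [move=> /occBE|move=> h; exact/occBE].
rewrite -[X in measurable X]setTI.
suff : measurable_fun setT (coord2 ^~ u) by move=> h; exact: h.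
apply: measurable_funM; first exact: measurable_cst.
apply: measurable_sum => i; apply: measurable_funX; apply: measurable_funD.
  exact: measurable_cst.
exact: measurable_tnth.
Qed.

Let cfgB (S : set 'cV[bool]_d) t := cfg vert S (occB t).

Let measurable_cfgB S u : measurable [set t | cfgB S t u].
Proof.
have -> : [set t | cfgB S t u] =
    \big[setI/setT]_(e : 'cV[bool]_d) [set t | occB t (u + vert e) <-> S e].
  apply/seteqP; split => t /= h.
    by elim/big_ind: _ => // e _; exact: h.
  by move=> e; move: h; rewrite (bigD1 e)//= => -[].
apply: bigsetI_measurable => e _; have [Se|Se] := pselect (S e).
  rewrite (_ : [set t | _] = [set t | occB t (u + vert e)])//.
  by apply/seteqP; split => t /= h; [apply/h|split].
rewrite (_ : [set t | _] = ~` [set t | occB t (u + vert e)]); first exact: measurableC.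
by apply/seteqP; split => t /= h; [move=> /h|split].
Qed.

Definition int_box n : {fset 'cV[int]_d} :=
  fset_set [set u : 'cV[int]_d | forall i, (absz (u i ord0) <= n)%N].

Lemma int_boxP n u : (u \in int_box n) = `[< forall i, (absz (u i ord0) <= n)%N >].
Proof.
rewrite /int_box in_fset_set; last exact: finite_int_box.
by apply/idP/asboolP; rewrite inE.
Qed.

Lemma ncard_int_box n (A : set 'cV[int]_d) : A `<=` [set` int_box n] ->
  (ncard A)%:R = \sum_(u <- int_box n) (u \in A)%:R :> R.
Proof.
move=> AB; have finA : finite_set A.
  apply: sub_finite_set AB _; exact: finite_fset.
rewrite /ncard card_fset_sum1 natr_sum.
rewrite (eq_big_seq (fun u => (u \in A)%:R)); last first.
  by move=> u; rewrite in_fset_set// => ->.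
apply: big_fset_incl.
  by apply/fsubsetP => u; rewrite in_fset_set// inE => /AB.
by move=> u _; rewrite in_fset_set// => /negPf ->.
Qed.

Lemma finite_sub_int_box (A : set 'cV[int]_d) : finite_set A ->
  exists n0, forall n, (n0 <= n)%N -> A `<=` [set` int_box n].
Proof.
move=> finA; pose N := \max_(u <- fset_set A) \max_i absz (u i ord0).
exists N => n Nn u Au; rewrite /= int_boxP; apply/asboolP => i.
apply: leq_trans Nn; apply: (@leq_trans (\max_i absz (u i ord0))).
  exact: (@leq_bigmax _ (fun i => absz (u i ord0)) i).
by apply: leq_bigmax_seq => //; rewrite in_fset_set// inE.
Qed.

(** The count is a pointwise limit of sums of indicators over growing integer boxes; for each shift
    the sums are eventually constant. *)
Lemma measurable_Nconf_ball l : (0 < l < 2 ^ (2 ^ d))%N ->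
  measurable_fun setT (fun t => (Nconf l B a Q (cube_point t))%:R : R).
Proof.
move=> ld.
have bB : ebounded B by exists rho => y; rewrite /B /ecball /= subr0.
apply: (@measurable_fun_cvg _ _ _ _ (fun n t => \sum_(u <- int_box n) (u \in cfgB (vconf l) t)%:R)).
  move=> n; apply: measurable_sum => u.
  rewrite (_ : (fun t => _) = \1_[set t | cfgB (vconf l) t u]).
    exact: measurable_indic.
  by apply/funext => t; rewrite indicE; congr (nat_of_bool _)%:R; apply/idP/idP; rewrite !inE.
move=> t _; rewrite Nconf_cfg// ?gt_eqF//.
have finA : finite_set (cfg vert (vconf l) (occB t)).
  apply: finite_cfg; last by apply: finite_occupied; rewrite ?gt_eqF.
  by have [e] := config_neq0 ld; exists e.
have [n0 hn] := finite_sub_int_box finA.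
apply: cvg_near_cst; exists n0 => // n /= n0n.
by rewrite (ncard_int_box (hn n n0n)).
Qed.

Lemma measurable_estimator_ball w :
  measurable_fun setT (fun t => estimator w B a Q (cube_point t)).
Proof.
rewrite /estimator; apply: measurable_funM; first exact: measurable_cst.
pose h l t := if (0 < l < 2 ^ (2 ^ d))%N then w l * (Nconf l B a Q (cube_point t))%:R else 0 : R.
rewrite (_ : (fun t => _) = (fun t => \sum_(1 <= l < 2 ^ (2 ^ d)) h l t)); last first.
  apply/funext => t; rewrite big_nat_cond [RHS]big_nat_cond.
  by apply: eq_bigr => l /andP[ld _]; rewrite /h ifT.
apply: measurable_sum => l; rewrite /h; have [ld|_] := boolP (0 < l < 2 ^ (2 ^ d))%N; last exact: measurable_cst.
by apply: measurable_funM; [exact: measurable_cst|exact: measurable_Nconf_ball].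
Qed.

End measurable_estimator.

(** * Growth of the mean estimator *)

Section lattice_count.
Context {R : realType} {d : nat}.
Variables (Q : 'M[R]_d) (a : R).
Hypotheses (QQ : Q *m Q^T = 1%:M) (a0 : 0 < a).

Lemma ncard_setT (T : finType) : ncard [set: T] = #|T|.
Proof.
rewrite /ncard cardE; apply: perm_size; apply: uniq_perm.
- exact: fset_uniq.
- exact: enum_uniq.
- by move=> x; rewrite mem_enum in_fset_set ?in_setT//; exact: finite_finset.
Qed.

(** A block of N lattice points in each direction fits into the ball of radius [kappa] about [z],
    and all of them are newly occupied. *)
Lemma ncard_occupied_ball (Y Y' : set 'cV[R]_d) z c kappa N : ebounded Y' -> Y `<=` Y' ->
  (forall x, enorm (x - z) < kappa -> Y' x /\ ~ Y x) ->
  (0 < N)%N -> a * (Num.sqrt d%:R * N%:R) < kappa ->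
  (N ^ d + ncard (occupied Y a Q c) <= ncard (occupied Y' a Q c))%N.
Proof.
move=> bY' YY' zB N0 aN.
have finY' : finite_set (occupied Y' a Q c) by apply: finite_occupied; rewrite ?gt_eqF.
rewrite (ncardID (occupied Y a Q c) finY') setIidr; last by move=> u; exact: YY'.
rewrite addnC leq_add2l.
pose q := a^-1 *: (Q^T *m z).
(* Here [q] holds the lattice coordinates of [z]. Rounding down costs less than 1 and [k i] is at
   most N - 1, so each coordinate is off by at most N. *)
pose f (k : {ffun 'I_d -> 'I_N}) : 'cV[int]_d := \col_i (Num.floor (q i 0 - c i 0) + (k i)%:Z).
have fI : injective f.
  move=> k k' /matrixP kk'; apply/ffunP => i; have := kk' i 0; rewrite !mxE.
  by move=> /addrI [] /val_inj.
have -> : (N ^ d)%N = ncard (f @` setT).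
  by rewrite (ncard_image fI) ?ncard_setT ?card_ffun ?card_ord//; exact: finite_finset.
apply: le_ncard; first exact: finite_setD.
move=> _ [k _ <-]; have [|? ?] := zB (lattice_point a Q c (f k)); last by split.
apply: le_lt_trans aN.
have -> : lattice_point a Q c (f k) - z = a *: (Q *m (toR (f k) + c - q)).
  rewrite mulmxBr scalerBr /lattice_point /q -scalemxAr scalerA mulfV ?gt_eqF// scale1r.
  by rewrite mulmxA QQ mul1mx.
rewrite enormZ enorm_orth// gtr0_norm// ler_pM2l//; apply: enorm_le_coord => // i.
rewrite /f; clearbody q; rewrite !mxE intrD.
have h1 := Num.Theory.floor_le_tmp (q i 0 - c i 0); have h2 := Num.Theory.floorD1_gt (q i 0 - c i 0).
have kN : ((k i)%:Z)%:~R + 1 <= N%:R :> R by rewrite -pmulrn natr1 ler_nat.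
have k0 : 0 <= ((k i)%:Z)%:~R :> R by rewrite -pmulrn.
move: h1 h2; rewrite intrD1 => h1 h2.
by rewrite ler_norml; apply/andP; split; lra.
Qed.

End lattice_count.

Section mean_estimator_theory.
Context {R : realType} {d : nat}.
Variables (Q : 'M[R]_d) (w : nat -> R).
Implicit Types (Y : set 'cV[R]_d).

Lemma le_mean_estimator Y Y' a :
  (forall c, estimator w Y a Q c <= estimator w Y' a Q c) ->
  (mean_estimator w Y a Q <= mean_estimator w Y' a Q)%E.
Proof.
by move=> h; rewrite /mean_estimator unlock; apply: le_integralT => t; rewrite lee_fin.
Qed.

(** A finite mean forces finite integrals of the positive and negative parts, so the estimator of
    [Y] is integrable and the constant [K] can be split off. For [Y'] only monotonicity of the
    integral is used. *)
Lemma mean_estimator_shift Y Y' a K :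
  measurable_fun setT (fun t => estimator w Y a Q (cube_point t)) ->
  mean_estimator w Y a Q \is a fin_num ->
  (forall c, estimator w Y a Q c + K <= estimator w Y' a Q c) ->
  (mean_estimator w Y a Q + K%:E <= mean_estimator w Y' a Q)%E.
Proof.
rewrite /mean_estimator unlock; set f := fun t => _ => mf finf hK.
have mfE : measurable_fun setT (EFin \o f) by exact/measurable_EFinP.
have intf : (uniform_cube d).-integrable setT (EFin \o f).
  apply/integrableP; split => //.
  move: finf; rewrite integralE fin_numB => /andP[fp fn].
  rewrite (_ : (fun x => _) = (fun x => ((EFin \o f)^\+ x + (EFin \o f)^\- x)%E)); last first.
    by apply/funext => x; have /(congr1 (fun h => h x)) := fune_abse (EFin \o f).
  rewrite ge0_integralD//; first by rewrite lte_add_pinfty// ltey_eq ?fp ?fn.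
  - exact: measurable_funepos.
  - exact: measurable_funeneg.
apply: (@le_trans _ _ (\int[uniform_cube d]_t ((EFin \o f) t + cst K%:E t))%E); last first.
  by apply: le_integralT => t; rewrite -EFinD lee_fin; exact: hK.
rewrite integralD//; last exact: finite_measure_integrable_cst.
rewrite [X in (_ <= _ + X)%E]integral_cst//.
by rewrite [X in (_ <= _ + _ * X)%E](probability_setT (uniform_cube d)) mule1.
Qed.

End mean_estimator_theory.

(** * The chain of local modifications *)

Section chain.
Context {R : realType} {d : nat}.
Variables (r : R) (Q : 'M[R]_d) (w : nat -> R).
Hypotheses (d0 : (0 < d)%N) (r0 : 0 < r) (QQ : Q *m Q^T = 1%:M).
Hypothesis w_cvg : forall X : set 'cV[R]_d, compact X -> r_regular r X ->
  mean_estimator w X a Q @[a --> 0^'+] --> intrinsic_volume_dm2 X.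

Local Notation V := intrinsic_volume_dm2.
Local Notation W := (full_weight (d := d) w).
Let rho := 2 * r.
Let D : R := Num.sqrt d%:R.
Let mu : R := enorm (binary_vector : 'cV[R]_d).

Let rho0 : 0 < rho. Proof. by rewrite mulr_gt0. Qed.

Let D0 : 0 < D. Proof. by rewrite sqrtr_gt0 ltr0n. Qed.

Let mu0 : 0 < mu.
Proof.
rewrite lt_neqAle enorm_ge0 andbT eq_sym enorm_eq0; apply/eqP => /matrixP /(_ (Ordinal d0) 0).
by rewrite !mxE => /eqP; rewrite pnatr_eq0 expn_eq0.
Qed.

Lemma mean_estimator_le_intrinsic_volume (X X' : set 'cV[R]_d) a1 :
  compact X -> r_regular r X -> compact X' -> r_regular r X' -> 0 < a1 ->
  (forall a c, 0 < a -> a < a1 -> estimator w X a Q c <= estimator w X' a Q c) ->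
  (V X <= V X')%E.
Proof.
move=> kX rX kX' rX' a10 h; apply: lee_cvg_to (w_cvg kX rX) (w_cvg kX' rX') _.
near=> a; apply: le_mean_estimator => c; apply: h.
  by near: a; exact: nbhs_right_gt.
by near: a; exact: nbhs_right_lt.
Unshelve. all: by end_near. Qed.

Lemma compact_premul_lev g M eps (chi : 'cV[R]_d -> R) : g^T = g -> g *m g = 1%:M ->
  C11 M chi -> 0 <= eps -> eps * M * (1 + 2 * r) <= r ->
  compact (premul g (lev rho eps chi)).
Proof.
move=> gT gg cM e0 eM.
apply: (@compact_closed_ebounded _ _ _ (rho + eps + 1)).
  apply: closed_premul => //; exact: (closed_lev cM r0 e0 eM).
move=> x; rewrite /premul /= => /(ebounded_lev cM r0 erefl e0).
by rewrite enorm_orth// gT.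
Qed.

Variables (M eps delta : R).
Hypotheses (e0 : 0 <= eps) (eM : eps * M * (1 + 2 * r) <= r).
Hypothesis delta_r : delta <= r.
Hypothesis small : 2 * delta * D + 2 * eps * M * D <= rho / (2 * mu).

Lemma local_step (chi chi' : 'cV[R]_d -> R) b : C11 M chi -> C11 M chi' ->
  (forall x, delta <= enorm (x - b) -> chi x = chi' x) -> r <= enorm b ->
  exists g : 'M[R]_d, [/\ g^T = g, g *m g = 1%:M & exists2 a1, 0 < a1 &
    forall a c, 0 < a -> a < a1 ->
    let Y := premul g (lev rho eps chi) in let Y' := premul g (lev rho eps chi') in
    estimator w Y' a Q c = estimator w Y a Q c + a ^+ (d - 2) * W *
      ((ncard (occupied Y' a Q c))%:R - (ncard (occupied Y a Q c))%:R)].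
Proof.
move=> cM cM' chib rb.
have [|g [gT gg gb]] := @householder R d b ((enorm b / mu) *: (Q *m binary_vector)).
  rewrite -[RHS]sqr_enorm enormZ enorm_orth// -/mu ger0_norm; last by rewrite divr_ge0 ?enorm_ge0// ltW.
  by rewrite divfK ?gt_eqF// sqr_enorm.
exists g; split => //.
pose t := rho / (2 * mu).
have t0 : 0 < t by rewrite divr_gt0// mulr_gt0.
exists (Num.min (D^-1) (t / (3 * D ^+ 2))).
  by rewrite lt_min invr_gt0 D0/= divr_gt0// mulr_gt0// exprn_gt0.
move=> a c a0; rewrite lt_min => /andP[aD at3] /=.
apply: (@estimator_local_step _ _ Q QQ M rho eps delta b g gT gg gb rho0 e0 mu0 _ small chi chi' cM cM' chib) => //.
- by rewrite /rho mulrAC mulfV ?mul1r ?gt_eqF.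
- exists (rho + eps + 1) => y; rewrite /premul /= => /(ebounded_lev cM r0 erefl e0).
  by rewrite enorm_orth// gT.
- exists (rho + eps + 1) => y; rewrite /premul /= => /(ebounded_lev cM' r0 erefl e0).
  by rewrite enorm_orth// gT.
- by rewrite -ler_pdivlMr// div1r ltW.
- rewrite (mulrC 3) -mulrA -ler_pdivlMr ?mulr_gt0 ?exprn_gt0//; exact: ltW.
Qed.

(** The estimators of the reflected sets are ordered for all small [a]; the assumed convergence
    passes this to their intrinsic volumes, and invariance under [g] brings it back to the original
    sets. *)
Lemma chain_step (chi chi' : 'cV[R]_d -> R) b : C11 M chi -> C11 M chi' ->
  (forall x, chi x <= chi' x) ->
  (forall x, delta <= enorm (x - b) -> chi x = chi' x) ->
  (0 <= W -> (V (lev rho eps chi) <= V (lev rho eps chi'))%E) /\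
  (W <= 0 -> (V (lev rho eps chi') <= V (lev rho eps chi))%E).
Proof.
(* For |b| < r the modified region lies in the ball of radius 2r, which both sets contain, so
   nothing changes. Otherwise [b] is far enough from 0 to define a direction. *)
move=> cM cM' cc' chib; have [rb|rb] := leP r (enorm b); last first.
  have -> : lev rho eps chi = lev rho eps chi'; last by [].
  apply/seteqP; split => x; rewrite /lev /= => h.
    by apply: le_trans h _; rewrite lerD2l ler_wpM2l.
  have [xb|xb] := leP delta (enorm (x - b)); first by rewrite chib.
  have xr : enorm x <= rho.
    have := enormD (x - b) b; rewrite subrK /rho; move: delta_r; lra.
  have [_ /(_ x)/andP[c0 _] _] := cM; apply: le_trans (_ : rho ^+ 2 <= _).
    by rewrite -enorm_le// ltW.
  by rewrite lerDl mulr_ge0.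
have [g [gT gg [a1 a10 step]]] := local_step cM cM' chib rb.
have rX := r_regular_lev cM r0 erefl e0 eM.
have rX' := r_regular_lev cM' r0 erefl e0 eM.
rewrite -(intrinsic_volume_premul gT gg r0 rX) -(intrinsic_volume_premul gT gg r0 rX').
have rY := r_regular_premul gT gg rX; have rY' := r_regular_premul gT gg rX'.
have kY := compact_premul_lev gT gg cM e0 eM.
have kY' := compact_premul_lev gT gg cM' e0 eM.
have ncard_le a c : 0 < a -> (ncard (occupied (premul g (lev rho eps chi)) a Q c))%:R <=
    (ncard (occupied (premul g (lev rho eps chi')) a Q c))%:R :> R.
  move=> a0; rewrite ler_nat; apply: le_ncard.
    apply: finite_occupied; rewrite ?gt_eqF//.
    exists (rho + eps + 1) => y; rewrite /premul /= => /(ebounded_lev cM' r0 erefl e0).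
    by rewrite enorm_orth// gT.
  move=> u; rewrite /occupied /premul /lev /= => /le_trans; apply.
  by rewrite lerD2l ler_wpM2l.
split=> W0.
  apply: (mean_estimator_le_intrinsic_volume kY rY kY' rY' a10) => a c a0 aa1.
  rewrite step// lerDl; apply: mulr_ge0; last by rewrite subr_ge0 ncard_le.
  by apply: mulr_ge0 => //; rewrite exprn_ge0// ltW.
apply: (mean_estimator_le_intrinsic_volume kY' rY' kY rY a10) => a c a0 aa1.
rewrite step// gerDl; apply: mulr_le0_ge0; last by rewrite subr_ge0 ncard_le.
by apply: mulr_ge0_le0 => //; rewrite exprn_ge0// ltW.
Qed.

Local Notation chi0 := (fun _ : 'cV[R]_d => 0 : R).

Lemma lev0 (e : R) : lev rho e chi0 = (ecball 0 rho : set 'cV[R]_d).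
Proof.
by apply/seteqP; split => x; rewrite /lev /ecball /= mulr0 addr0 subr0 enorm_le// ltW.
Qed.

(** The bump adds at least N^d lattice points with a N bounded below, so the estimator grows by W (a
    N)^d / a^2 or more for every shift. This is unbounded as [a] tends to 0, against two finite
    limits. *)
Lemma blow_up (chi : 'cV[R]_d -> R) b z kappa : (2 <= d)%N -> 0 < W ->
  C11 M chi0 -> C11 M chi ->
  (forall x, delta <= enorm (x - b) -> chi x = 0) -> r <= enorm b -> 0 < kappa ->
  (forall x, enorm (x - z) < kappa -> lev rho eps chi x /\ ~ lev rho eps chi0 x) ->
  V (lev rho eps chi0) \is a fin_num -> V (lev rho eps chi) \is a fin_num -> False.
Proof.
move=> d2 W0 c0M cM chib rb k0 zk; move: (cM) => [M0 c01 _].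
have [g [gT gg [a1 a10 step]]] := local_step c0M cM (fun x h => esym (chib x h)) rb.
set Y := premul g (lev rho eps chi0); set Y' := premul g (lev rho eps chi).
have rX := r_regular_lev c0M r0 erefl e0 eM.
have rX' := r_regular_lev cM r0 erefl e0 eM.
rewrite -(intrinsic_volume_premul gT gg r0 rX) -(intrinsic_volume_premul gT gg r0 rX').
rewrite -/Y -/Y' => /fineK VY /fineK VY'.
have gorth : g *m g^T = 1%:M by rewrite gT.
have YB : Y = ecball 0 rho.
  rewrite /Y lev0; apply/seteqP; split => x; rewrite /premul /ecball /=;
  by rewrite !subr0 enorm_orth.
have YY' : Y `<=` Y'.
  move=> x; rewrite /Y /Y' /premul /lev /= => /le_trans; apply.
  by rewrite lerD2l ler_wpM2l//; have /andP[] := c01 (g *m x).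
have bY' : ebounded Y'.
  exists (rho + eps + 1) => y; rewrite /Y' /premul /= => /(ebounded_lev cM r0 erefl e0).
  by rewrite enorm_orth.
have zk' x : enorm (x - g *m z) < kappa -> Y' x /\ ~ Y x.
  by move=> h; apply: zk; rewrite enorm_mulB.
(* An increase by one more than the difference of the two limits already suffices. *)
pose K := fine (V Y') - fine (V Y) + 1.
pose k1 := kappa / (4 * D).
have k10 : 0 < k1 by rewrite divr_gt0// mulr_gt0.
(* The bound by [k1] makes a N >= k1 in spite of truncation; with a <= 1, the last bound gives K a^2
   <= |K| a < W k1^d. *)
pose a2 := Num.min (Num.min a1 1) (Num.min k1 (W * k1 ^+ d / (`|K| + 1))).
have K1 : 0 < `|K| + 1 by rewrite ltr_wpDl.
have a20 : 0 < a2.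
  by rewrite !lt_min a10 ltr01 k10/= divr_gt0// mulr_gt0// exprn_gt0.
have grow a c : 0 < a -> a < a2 -> estimator w Y a Q c + K <= estimator w Y' a Q c.
  move=> a0; rewrite !lt_min => /andP[/andP[aa1 a_1] /andP[ak1 aK]].
  rewrite step// lerD2l.
  pose N := Num.truncn (kappa / (2 * a * D)).
  have aD0 : 0 < 2 * a * D by rewrite !mulr_gt0.
  have /andP[N1 N2] := truncn_itv (divr_ge0 (ltW k0) (ltW aD0)); rewrite -/N in N1 N2.
  have Nk : k1 <= a * N%:R.
    rewrite -natr1 in N2; move: N2; rewrite ltr_pdivrMr// => N2.
    have h1 : a * (4 * D) < kappa by rewrite -ltr_pdivlMr// mulr_gt0.
    rewrite /k1 ler_pdivrMr ?mulr_gt0//.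
    have -> : a * N%:R * (4 * D) = 2 * ((N%:R + 1) * (2 * a * D)) - a * (4 * D) by ring.
    lra.
  have N0 : (0 < N)%N by rewrite -(ltr_nat R) -(pmulr_rgt0 _ a0); exact: lt_le_trans Nk.
  have aN : a * (D * N%:R) < kappa.
    move: N1; rewrite ler_pdivlMr// => N1.
    have : 0 < N%:R * (a * D) by rewrite !mulr_gt0// ltr0n.
    lra.
  have cnt := ncard_occupied_ball QQ a0 c bY' YY' zk' N0 aN.
  have cntR : (N ^ d)%:R <= (ncard (occupied Y' a Q c))%:R - (ncard (occupied Y a Q c))%:R :> R.
    by rewrite lerBrDr -natrD ler_nat.
  have W1 : 0 <= a ^+ (d - 2) * W by rewrite mulr_ge0 ?exprn_ge0 ?ltW.
  apply: (le_trans _ (ler_wpM2l W1 cntR)).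
  have -> : a ^+ (d - 2) * W * (N ^ d)%:R = W * (a * N%:R) ^+ d / a ^+ 2.
    have -> : (a * N%:R) ^+ d = a ^+ (d - 2) * a ^+ 2 * N%:R ^+ d.
      by rewrite exprMn -exprD subnK.
    by rewrite natrX; field; rewrite gt_eqF.
  have h1 : k1 ^+ d <= (a * N%:R) ^+ d.
    by apply: lerXn2r; rewrite ?nnegrE ?(ltW k10) ?mulr_ge0// ltW.
  have h2 : a * (`|K| + 1) < W * k1 ^+ d by rewrite -ltr_pdivlMr.
  rewrite ler_pdivlMr ?exprn_gt0//.
  have h3 : W * k1 ^+ d <= W * (a * N%:R) ^+ d by rewrite ler_wpM2l// ltW.
  have h4 : K * a ^+ 2 <= `|K| * a.
    apply: (@le_trans _ _ (`|K| * a ^+ 2)); first by rewrite ler_wpM2r ?sqr_ge0 ?ler_norm.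
    by rewrite ler_wpM2l// expr2 ler_piMl// ltW.
  lra.
have rY := r_regular_premul gT gg rX; have rY' := r_regular_premul gT gg rX'.
have cY := w_cvg (compact_premul_lev gT gg c0M e0 eM) rY.
have cY' := w_cvg (compact_premul_lev gT gg cM e0 eM) rY'.
(* A finite limit makes the mean itself finite for small [a], as [mean_estimator_shift] requires. *)
have /fine_cvgP[finE _] : mean_estimator w Y a Q @[a --> 0^'+] --> (fine (V Y))%:E.
  by rewrite VY.
have cYK : (mean_estimator w Y a Q + K%:E)%E @[a --> 0^'+] --> ((fine (V Y))%:E + K%:E)%E.
  by apply: cvgeD => //; [rewrite VY|exact: cvg_cst].
have : ((fine (V Y))%:E + K%:E <= (fine (V Y'))%:E)%E.
  apply: lee_cvg_to cYK _ _; first by rewrite VY'; exact: cY'.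
  near=> a.
  have a0 : 0 < a by near: a; exact: nbhs_right_gt.
  have aa2 : a < a2 by near: a; exact: nbhs_right_lt.
  apply: mean_estimator_shift => [|| c]; last exact: grow.
    by rewrite YB; apply: measurable_estimator_ball => //; exact: ltW.
  by near: a.
by rewrite -EFinD lee_fin /K; lra.
Unshelve. all: by end_near. Qed.

End chain.

(** * Covering a ball by finitely many bumps *)

Section covering_bumps.
Context {R : realType} {d : nat}.
Hypothesis d0 : (0 < d)%N.
Implicit Types (x b : 'cV[R]_d).

(** The support, a cube of half-side 2 eta, lies in the ball of radius 2 eta sqrt d = delta / 2. *)
Lemma cube_bump_far (delta : R) b x : 0 < delta -> delta <= enorm (x - b) ->
  cube_bump (delta / (4 * Num.sqrt d%:R)) b x = 0.
Proof.
move=> de0 h; set eta := delta / _.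
have D0 : 0 < Num.sqrt d%:R :> R by rewrite sqrtr_gt0 ltr0n.
have eta0 : 0 < eta by rewrite divr_gt0// mulr_gt0.
have [[i hi]|hn] := pselect (exists i, 2 * eta <= `|x i 0 - b i 0|).
  exact: cube_bump_eq0 eta0 hi.
exfalso; move: h; apply/negP; rewrite -ltNge.
apply: (@le_lt_trans _ _ (Num.sqrt d%:R * (2 * eta))).
  apply: enorm_le_coord => [|i]; first by rewrite mulr_ge0// ltW.
  by rewrite !mxE leNgt; apply/negP => /ltW hi; apply: hn; exists i.
have -> : Num.sqrt d%:R * (2 * eta) = delta / 2 by rewrite /eta; field; rewrite gt_eqF.
by rewrite ltr_pdivrMr// mulr_natr mulr2n ltrDl.
Qed.

Lemma grid_cover (eta K : R) : 0 < eta -> 0 <= K -> exists s : seq 'cV[R]_d,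
  forall x, enorm x <= K -> exists2 b, b \in s & cube_bump eta b x = 1.
Proof.
(* One unit compensates the truncation, the other the floor of a negative coordinate. *)
move=> eta0 K0; pose n := (Num.truncn (K / eta)).+2.
exists [seq eta *: toR u | u <- int_box (d := d) n] => x xK.
pose u : 'cV[int]_d := \col_i Num.floor (x i 0 / eta).
exists (eta *: toR u).
  apply: map_f; rewrite int_boxP; apply/asboolP => i; rewrite mxE.
  have xi : `|x i 0 / eta| <= K / eta.
    rewrite normrM (gtr0_norm (_ : 0 < eta^-1)) ?invr_gt0// ler_pM2r ?invr_gt0//.
    exact: le_trans (coord_le_enorm x i) xK.
  have h1 := Num.Theory.floor_le_tmp (x i 0 / eta).
  have h2 := Num.Theory.floorD1_gt (x i 0 / eta).
  have h3 := truncnS_gt (K / eta).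
  have nE : n%:R = (Num.truncn (K / eta)).+1%:R + 1 :> R by rewrite natr1.
  rewrite -lez_nat abszE -(ler_int R) intr_norm -pmulrn.
  move: h2 xi; rewrite intrD1 !ler_norml => h2 /andP[x1 x2].
  by rewrite nE; apply/andP; split; lra.
apply: cube_bump_eq1 => // i; rewrite !mxE.
have h1 := Num.Theory.floor_le_tmp (x i 0 / eta).
have h2 := Num.Theory.floorD1_gt (x i 0 / eta).
move: h1 h2; rewrite intrD1 ler_pdivlMr// ltr_pdivrMr// => h1 h2.
by rewrite ler_norml; apply/andP; split; lra.
Qed.

End covering_bumps.

(** * Comparison of the two ends of the chain *)

Lemma le_first_steps (disp : Order.disp_t) (T : porderType disp) (v : nat -> T) n :
  (forall k, (k < n)%N -> (v k.+1 <= v k)%O) -> forall k, (k <= n)%N -> (v k <= v 0%N)%O.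
Proof.
move=> vS; elim=> [_|k IH kn]; first exact: lexx.
exact: le_trans (vS k kn) (IH (ltnW kn)).
Qed.

Lemma ge_first_steps (disp : Order.disp_t) (T : porderType disp) (v : nat -> T) n :
  (forall k, (k < n)%N -> (v k <= v k.+1)%O) -> forall k, (k <= n)%N -> (v 0%N <= v k)%O.
Proof.
move=> vS; elim=> [_|k IH kn]; first exact: lexx.
exact: le_trans (IH (ltnW kn)) (vS k kn).
Qed.

Theorem theorem1p1 (R : realType) (d : nat) (r : R) (Q : 'M[R]_d) :
  (3 <= d)%N -> 0 < r -> is_rotation Q ->
  ~ exists w : nat -> R, forall X : set 'cV[R]_d,
      compact X -> r_regular r X ->
      mean_estimator w X a Q @[a --> 0^'+] --> intrinsic_volume_dm2 X.
Proof.
move=> d3 r0 [QQ _] [w w_cvg].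
case: d Q d3 QQ w_cvg => // m Q m2 QQ w_cvg.
have d0 : (0 < m.+1)%N by [].
pose rho := 2 * r; pose D : R := Num.sqrt m.+1%:R.
have rho0 : 0 < rho by rewrite mulr_gt0.
have D0 : 0 < D by rewrite sqrtr_gt0 ltr0n.
pose mu : R := enorm (binary_vector : 'cV[R]_m.+1).
have mu0 : 0 < mu.
  rewrite lt_neqAle enorm_ge0 andbT eq_sym enorm_eq0; apply/eqP => /matrixP /(_ 0 0).
  by rewrite !mxE => /eqP; rewrite pnatr_eq0 expn_eq0.
(* The total r / mu allowed in [small] is shared equally: [delta] uses r / (2 mu), [eps] the
   rest. *)
pose delta := Num.min (r / (4 * mu * D)) r.
have delta0 : 0 < delta by rewrite lt_min r0 andbT divr_gt0// !mulr_gt0.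
have delta_r : delta <= r by rewrite ge_min lexx orbT.
have delta_small : 2 * delta * D <= r / (2 * mu).
  have -> : r / (2 * mu) = 2 * (r / (4 * mu * D)) * D.
    by field; rewrite !gt_eqF.
  by rewrite ler_pM2r// ler_pM2l// ge_min lexx.
pose eta := delta / (4 * D).
have eta0 : 0 < eta by rewrite divr_gt0// mulr_gt0.
(* The margin 1 covers the enlarged ball, whose radius sqrt (rho^2 + eps) is at most rho + 1 once
   eps <= 1. *)
have [grid gridP] := @grid_cover R m.+1 eta (rho + 1) eta0 (addr_ge0 (ltW rho0) ler01).
pose b0 : 'cV[R]_m.+1 := rho *: delta_mx 0 0.
have b0rho : enorm b0 = rho.
  rewrite enormZ gtr0_norm//; suff -> : enorm (delta_mx 0 0 : 'cV[R]_m.+1) = 1 by rewrite mulr1.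
  rewrite /enorm /dot (bigD1 0)//= big1 ?addr0 => [|i i0]; first by rewrite !mxE !eqxx mulr1 sqrtr1.
  by rewrite !mxE (negbTE i0) mul0r.
(* The stages drop bumps from the front, so with [b0] at the end the last nontrivial stage is the
   exact ball with a single bump at its boundary point [b0], as [blow_up] requires. *)
pose s := rcons grid b0.
have [M hM] := C11_cube_bumps_drop eta s.
have M0 : 0 <= M by have [] := hM 0%N.
(* The three bounds serve the grid margin, the [r]-regularity of all stages and the second half of
   [small]; the summands 1 keep the denominators positive when M = 0. *)
pose eps := Num.min 1 (Num.min (r / (M * (1 + 2 * r) + 1)) (r / (2 * mu) / (2 * M * D + 1))).
have c1 : 0 < M * (1 + 2 * r) + 1 by rewrite ltr_wpDl// mulr_ge0// addr_ge0// mulr_ge0// ltW.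
have c2 : 0 < 2 * M * D + 1 by rewrite ltr_wpDl// !mulr_ge0// ltW.
have eps0 : 0 < eps by rewrite !lt_min ltr01 !divr_gt0// mulr_gt0.
have eps1 : eps <= 1 by rewrite ge_min lexx.
have epsM : eps * M * (1 + 2 * r) <= r.
  have : eps * (M * (1 + 2 * r) + 1) <= r by rewrite -ler_pdivlMr// !ge_min lexx !orbT.
  by rewrite mulrDr mulr1 mulrA; lra.
have eps_small : 2 * eps * M * D <= r / (2 * mu).
  have : eps * (2 * M * D + 1) <= r / (2 * mu) by rewrite -ler_pdivlMr// !ge_min lexx !orbT.
  by rewrite mulrDr mulr1; lra.
have small : 2 * delta * D + 2 * eps * M * D <= 2 * r / (2 * mu).
  have -> : 2 * r / (2 * mu) = r / (2 * mu) + r / (2 * mu) by field; rewrite gt_eqF.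
  exact: lerD.
(* The chain shrinks with [k]: stage 0 is the large ball, on which the bumps are identically 1, and
   the last stage is the ball of radius [rho]. *)
pose X k := lev rho eps (cube_bumps eta (drop k s)).
have step k : (k < size s)%N ->
    (0 <= full_weight (d := m.+1) w -> (intrinsic_volume_dm2 (X k.+1) <= intrinsic_volume_dm2 (X k))%E) /\
    (full_weight (d := m.+1) w <= 0 -> (intrinsic_volume_dm2 (X k) <= intrinsic_volume_dm2 (X k.+1))%E).
  move=> ks; rewrite /X (drop_nth b0 ks).
  have hMk := hM k; rewrite (drop_nth b0 ks) in hMk.
  apply: (chain_step d0 r0 QQ w_cvg (ltW eps0) epsM delta_r small (hM k.+1) hMk (b := nth b0 s k)).
  - by move=> x; exact: le_cube_bumps_cons.
  - by move=> x h /=; rewrite cube_bump_far// subr0 mul1r subKr.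
have chainP : 0 <= full_weight (d := m.+1) w -> forall k, (k <= size s)%N ->
    (intrinsic_volume_dm2 (X k) <= intrinsic_volume_dm2 (X 0%N))%E.
  move=> W0; apply: (le_first_steps (v := fun k => intrinsic_volume_dm2 (X k))) => k ks.
  exact: (step k ks).1 W0.
have chainN : full_weight (d := m.+1) w <= 0 -> forall k, (k <= size s)%N ->
    (intrinsic_volume_dm2 (X 0%N) <= intrinsic_volume_dm2 (X k))%E.
  move=> W0; apply: (ge_first_steps (v := fun k => intrinsic_volume_dm2 (X k))) => k ks.
  exact: (step k ks).2 W0.
have X_last : X (size s) = ecball 0 rho by rewrite /X drop_size; exact: lev0.
pose rho' := Num.sqrt (rho ^+ 2 + eps).
have rho'E : rho' ^+ 2 = rho ^+ 2 + eps by rewrite sqr_sqrtr// addr_ge0 ?sqr_ge0// ltW.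
have rr' : rho < rho'.
  by rewrite -ltr_sqr ?nnegrE ?sqrtr_ge0 ?(ltW rho0)// rho'E ltrDl.
have X_first : X 0%N = ecball 0 rho'.
  apply/seteqP; split => x; rewrite /X /lev /ecball /= drop0 subr0 enorm_le ?sqrtr_ge0// rho'E.
    move=> /le_trans; apply; rewrite lerD2l ler_piMr ?(ltW eps0)//.
    by have /andP[] := cube_bumps01 eta s x.
  move=> h; have [|b bs bx] := gridP x.
    rewrite enorm_le ?addr_ge0 ?(ltW rho0)//; apply: le_trans h _.
    by rewrite sqrrD1 -addrA lerD2l; move: rho0 eps1; lra.
  by rewrite (cube_bumps_mem1 (b := b))// ?mulr1// mem_rcons inE bs orbT.
have V_lt := lt_intrinsic_volume_eball m2 rho0 rr'.
have [W0|W0] := leP (full_weight (d := m.+1) w) 0.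
  have := chainN W0 (size s) (leqnn _); rewrite X_last X_first.
  by rewrite leNgt V_lt.
have rho'0 := lt_trans rho0 rr'.
have fin_small := @intrinsic_volume_eball_fin R m _ rho0.
have fin_big := @intrinsic_volume_eball_fin R m _ rho'0.
(* Monotonicity squeezes the volume of the one-bump stage between those of two balls; this is how it
   is known to be finite. *)
have V1 : (intrinsic_volume_dm2 (X (size grid)) <= intrinsic_volume_dm2 (ecball 0 rho' : set 'cV[R]_m.+1))%E.
  by rewrite -X_first; apply: chainP; [exact: ltW|rewrite size_rcons].
have V2 : (intrinsic_volume_dm2 (ecball 0 rho : set 'cV[R]_m.+1) <= intrinsic_volume_dm2 (X (size grid)))%E.
  rewrite -X_last size_rcons; apply: (step _ _).1; last exact: ltW.
  by rewrite size_rcons.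
have dropb0 : drop (size grid) s = [:: b0] by rewrite /s -cats1 drop_size_cat.
have b0E x : cube_bumps eta [:: b0] x = cube_bump eta b0 x by rewrite /= subr0 mulr1 subKr.
(* The ball of radius tau rho / 2 about (1 + tau) b0 must avoid the ball of radius rho, stay on the
   plateau of the bump (bound by [eta]), and satisfy |x|^2 <= (1 + 2 tau)^2 rho^2 <= rho^2 + eps,
   where 4 tau + 4 tau^2 <= 8 tau gives the 8. *)
pose tau := Num.min 1 (Num.min (eps / (8 * rho ^+ 2)) (eta / (2 * rho))).
have tau0 : 0 < tau by rewrite !lt_min ltr01 !divr_gt0 ?mulr_gt0// exprn_gt0.
have tau1 : tau <= 1 by rewrite ge_min lexx.
have tau_eps : tau * (8 * rho ^+ 2) <= eps.
  by rewrite -ler_pdivlMr ?mulr_gt0 ?exprn_gt0// !ge_min lexx !orbT.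
have tau_eta : tau * (2 * rho) <= eta by rewrite -ler_pdivlMr ?mulr_gt0// !ge_min lexx !orbT.
have tr : 0 < tau * rho by rewrite mulr_gt0.
have hX : X (size grid) = lev rho eps (cube_bumps eta [:: b0]) by rewrite /X dropb0.
apply: (blow_up d0 r0 QQ w_cvg (ltW eps0) epsM small
  (chi := cube_bumps eta [:: b0]) (b := b0) (z := (1 + tau) *: b0) (kappa := tau * rho / 2)).
- exact: leq_trans m2.
- exact: W0.
- by have := hM (size s); rewrite drop_size.
- by rewrite -dropb0.
- by move=> x h; rewrite b0E cube_bump_far.
- by rewrite b0rho /rho; move: r0; lra.
- by rewrite divr_gt0.
- move=> x xz; have nz : enorm ((1 + tau) *: b0) = (1 + tau) * rho.
    by rewrite enormZ b0rho gtr0_norm// addr_gt0.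
  have := ler_enormB x ((1 + tau) *: b0); rewrite nz ler_norml => /andP[x1 x2].
  have xb : enorm (x - b0) <= eta.
    apply: le_trans (enorm_distD ((1 + tau) *: b0) _ _) _.
    have -> : (1 + tau) *: b0 - b0 = tau *: b0 by rewrite scalerDl scale1r addrAC subrr add0r.
    rewrite [X in _ + X]enormZ b0rho (gtr0_norm tau0); move: xz tau_eta tr; lra.
  have e1 : rho < enorm x by move: x1 xz tr; lra.
  have e2 : enorm x <= (1 + 2 * tau) * rho by move: x2 xz tr; lra.
  split.
    change (dot x x <= rho ^+ 2 + eps * cube_bumps eta [:: b0] x).
    rewrite b0E cube_bump_eq1 ?mulr1//; last first.
      by move=> i; apply: le_trans xb; have := coord_le_enorm (x - b0) i; rewrite !mxE.
    rewrite -sqr_enorm; apply: (@le_trans _ _ (((1 + 2 * tau) * rho) ^+ 2)).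
      by rewrite lerXn2r ?nnegrE ?enorm_ge0// (le_trans (enorm_ge0 x)).
    have : tau * tau * rho ^+ 2 <= tau * rho ^+ 2 by rewrite ler_wpM2r ?sqr_ge0// ler_piMl// ltW.
    move: tau_eps; lra.
  rewrite /lev /= mulr0 addr0 -sqr_enorm; apply/negP; rewrite -ltNge.
  by rewrite ltr_sqr ?nnegrE ?enorm_ge0// ltW.
- by rewrite lev0.
- rewrite -hX fin_numElt; apply/andP; split.
    by apply: lt_le_trans V2; move: fin_small; rewrite fin_numElt => /andP[].
  by apply: le_lt_trans V1 _; move: fin_big; rewrite fin_numElt => /andP[].
Qed.
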